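(* Let $K$ be a real valued, algebraically closed field of characteristic $0$ and $f,g\in\mathfrak{m}\subseteq K\{x\}=K\{x_1,\dots,x_n\}$. 1. If $\tau(f)<\infty$, the following are equivalent: (i) $f$ is contact equivalent to $g$. (ii) For all $k\ge 0$, $T_k(f)\cong T_k(g)$ as $K$-algebras. (iii) There is some $k\ge 0$ such that $T_k(f)\cong T_k(g)$ as $K$-algebras. 2. If $\mu(f)<\infty$, the following are equivalent: (i) $f$ is right equivalent to $g$. (ii) For all $k\ge 0$, $M_k(f)\cong M_k(g)$ as $K\{t\}$-algebras. (iii) There is some $k\ge 0$ such that $M_k(f)\cong M_k(g)$ as $K\{t\}$-algebras.
   Context: A real valued field is a field $K$ with a map $|\ |:K\to\mathbb{R}_{\ge 0}$ satisfying $|a|=0\Leftrightarrow a=0$, $|ab|=|a||b|$, $|a+b|\le|a|+|b|$ (the trivial valuation is allowed; $K$ need not be complete). For $x=(x_1,\dots,x_n)$, $K\{x\}\subseteq K[[x]]$ is the ring of convergent power series: those $f=\sum_\alpha c_\alpha x^\alpha$ for which $\sum_\alpha|c_\alpha|\varepsilon^\alpha<\infty$ for some $\varepsilon\in(\mathbb{R}_{>0})^n$. $\mathfrak{m}=\langle x_1,\dots,x_n\rangle$ is its maximal ideal. $\operatorname{Aut}(K\{x\})$ is the group of automorphisms of $K\{x\}$ as a local $K$-algebra. $f,g\in K\{x\}$ are right equivalent if $f=\varphi(g)$ for some $\varphi\in\operatorname{Aut}(K\{x\})$, and contact equivalent if $f=u\cdot\varphi(g)$ for some $\varphi\in\operatorname{Aut}(K\{x\})$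 and some unit $u\in K\{x\}^*$. $j(f)=\langle\frac{\partial f}{\partial x_1},\dots,\frac{\partial f}{\partial x_n}\rangle$; $\mu(f)=\dim_K K\{x\}/j(f)$; $\tau(f)=\dim_K K\{x\}/\langle f,j(f)\rangle$. For $k\ge 0$, $T_k(f)=K\{x\}/\langle f,\mathfrak{m}^kj(f)\rangle$ (the $k$-th Tjurina algebra) and $M_k(f)=K\{x\}/\mathfrak{m}^kj(f)$ (the $k$-th Milnor algebra). $M_k(f)$ is a $K\{t\}$-algebra ($t$ one variable) with $t$ acting by multiplication with $f$, and $M_k(g)$ is a $K\{t\}$-algebra with $t$ acting by multiplication with $g$; thus an isomorphism $\varphi:M_k(f)\to M_k(g)$ of $K\{t\}$-algebras is a $K$-algebra isomorphism mapping the class of $f$ to the class of $g$. *)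

(* Defs.v *)
From HB Require Import structures.
From mathcomp Require Import all_boot all_order all_algebra mpoly.
From mathcomp Require Import boolp classical_sets functions cardinality fsbigop.
From mathcomp Require Import reals ereal esum.

Set Implicit Arguments.
Unset Strict Implicit.
Unset Printing Implicit Defensive.

Import Order.TTheory GRing.Theory Num.Theory.

Local Open Scope classical_set_scope.
Local Open Scope ring_scope.

Record absval (R : realType) (K : fieldType) := AbsVal {
  absval_fun :> K -> R;
  absval_ge0 : forall a, 0 <= absval_fun a;
  absval_eq0 : forall a, absval_fun a = 0 <-> a = 0;
  absvalM : forall a b, absval_fun (a * b) = absval_fun a * absval_fun b;
  absval_leD : forall a b, absval_fun (a + b) <= absval_fun a + absval_fun b }.

Section AbsvalTheory.
Variables (R : realType) (K : fieldType) (v : absval R K).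

Lemma absval0 : v 0 = 0. Proof. exact/absval_eq0. Qed.

Lemma absval1 : v 1 = 1.
Proof.
have v1 : v 1 != 0 by apply/eqP=> /absval_eq0/eqP; rewrite oner_eq0.
by apply: (mulfI v1); rewrite -absvalM !mulr1.
Qed.

Lemma absval_natr k : v k%:R <= k%:R.
Proof.
elim: k => [|k IH]; first by rewrite absval0.
by rewrite -addn1 !natrD (le_trans (absval_leD _ _ _))// absval1 lerD2r.
Qed.

Lemma absval_sum I (r : seq I) (P : pred I) (F : I -> K) :
  v (\sum_(i <- r | P i) F i) <= \sum_(i <- r | P i) v (F i).
Proof.
elim/big_rec2: _ => [|i x y _ le_yx]; first by rewrite absval0.
by apply: (le_trans (absval_leD _ _ _)); rewrite lerD2l.
Qed.

End AbsvalTheory.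

(* The formal power series ring K[[x_1, ..., x_n]]: a series is the family of *)
(* its coefficients.                                                          *)
Record fps (n : nat) (K : fieldType) := FPS { fps_coef : 'X_{1..n} -> K }.

HB.instance Definition _ n K := gen_eqMixin (fps n K).
HB.instance Definition _ n K := gen_choiceMixin (fps n K).

Section FPS.
Variables (n : nat) (K : fieldType).
Implicit Types (f g h : fps n K) (m k : 'X_{1..n}).
Local Notation "f @c m" := (fps_coef f m) (at level 2, left associativity).

Lemma fpsP f g : (forall m, f @c m = g @c m) -> f = g.
Proof. by case: f g => [f] [g] /= fg; congr FPS; apply/funext. Qed.

Definition fps_zero : fps n K := FPS (fun=> 0).
Definition fps_delta k (c : K) : fps n K := FPS (fun m => c *+ (m == k)).
Definition fps_opp f : fps n K := FPS (fun m => - f @c m).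
Definition fps_add f g : fps n K := FPS (fun m => f @c m + g @c m).
Definition fps_scale (c : K) f : fps n K := FPS (fun m => c * f @c m).
Definition fps_mul f g : fps n K :=
  FPS (fun m => \sum_(k : 'X_{1..n < (mdeg m).+1, (mdeg m).+1}
                       | m == (k.1 + k.2)%MM) f @c k.1 * g @c k.2).
Definition fps_deriv (i : 'I_n) f : fps n K :=
  FPS (fun m => f @c (m + U_(i))%MM *+ (m i).+1).

Let addA : associative fps_add.
Proof. by move=> f g h; apply/fpsP => m /=; rewrite addrA. Qed.
Let addC : commutative fps_add.
Proof. by move=> f g; apply/fpsP => m /=; rewrite addrC. Qed.
Let add0 : left_id fps_zero fps_add.
Proof. by move=> f; apply/fpsP => m /=; rewrite add0r. Qed.
Let addN : left_inverse fps_zero fps_opp fps_add.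
Proof. by move=> f; apply/fpsP => m /=; rewrite addNr. Qed.

HB.instance Definition _ :=
  GRing.isZmodule.Build (fps n K) addA addC add0 addN.

(* The ring axioms are transferred from {mpoly K[n]} by truncation. *)
Definition fps_trunc d f : {mpoly K[n]} :=
  \sum_(k : 'X_{1..n < d}) f @c k *: 'X_[k].

Lemma fps_truncE d f m : (mdeg m < d)%N -> (fps_trunc d f)@_m = f @c m.
Proof.
move=> md; rewrite /fps_trunc raddf_sum /= (bigD1 (BMultinom md)) //=.
rewrite mcoeffZ mcoeffX eqxx mulr1 big1 ?addr0 // => k.
rewrite -val_eqE /= => /negbTE km.
by rewrite mcoeffZ mcoeffX km mulr0.
Qed.

Lemma mcoeffM_eq d (p p' q q' : {mpoly K[n]}) m : (mdeg m < d)%N ->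
  (forall k, (mdeg k < d)%N -> p@_k = p'@_k) ->
  (forall k, (mdeg k < d)%N -> q@_k = q'@_k) ->
  (p * q)@_m = (p' * q')@_m.
Proof.
move=> md pp qq; rewrite !mcoeffM; apply: eq_bigr => -[k1 k2] /= _.
by rewrite pp ?qq // (leq_trans (bmdeg _)).
Qed.

Lemma fps_mulE d f g m : (mdeg m < d)%N ->
  (fps_mul f g) @c m = (fps_trunc d f * fps_trunc d g)@_m.
Proof.
move=> md; rewrite mcoeffM; apply: eq_bigr => -[k1 k2] /= _.
by rewrite !fps_truncE // (leq_trans (bmdeg _)).
Qed.

Lemma fps_trunc_mul d f g m : (mdeg m < d)%N ->
  (fps_trunc d (fps_mul f g))@_m = (fps_trunc d f * fps_trunc d g)@_m.
Proof. by move=> md; rewrite fps_truncE // (fps_mulE _ _ md). Qed.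

Let mulA : associative fps_mul.
Proof.
move=> f g h; apply/fpsP => m; pose d := (mdeg m).+1.
rewrite !(@fps_mulE d) //.
rewrite (@mcoeffM_eq d _ (fps_trunc d f) _ (fps_trunc d g * fps_trunc d h)) //;
  last by move=> k; exact: fps_trunc_mul.
rewrite mulrA; apply: (@mcoeffM_eq d) => // k kd.
by rewrite fps_trunc_mul.
Qed.

Let mulC : commutative fps_mul.
Proof.
move=> f g; apply/fpsP => m; pose d := (mdeg m).+1.
by rewrite !(@fps_mulE d) // mulrC.
Qed.

Let mul1 : left_id (fps_delta 0%MM 1) fps_mul.
Proof.
move=> f; apply/fpsP => m; pose d := (mdeg m).+1.
rewrite (@fps_mulE d) // -[RHS](@fps_truncE d) // -[in RHS](mul1r (fps_trunc d f)).
by apply: (@mcoeffM_eq d) => // k kd; rewrite fps_truncE // mcoeff1.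
Qed.

Let mulDl : left_distributive fps_mul fps_add.
Proof.
move=> f g h; apply/fpsP => m /=; rewrite -big_split /=.
by apply: eq_bigr => k _; rewrite mulrDl.
Qed.

Let one_neq0 : fps_delta 0%MM 1 != 0.
Proof.
apply/eqP => /(congr1 (fun f => f @c 0%MM)) /= /eqP.
by rewrite eqxx oner_eq0.
Qed.

HB.instance Definition _ :=
  GRing.Zmodule_isComNzRing.Build (fps n K) mulA mulC mul1 mulDl one_neq0.

Let scaleA a b f : fps_scale a (fps_scale b f) = fps_scale (a * b) f.
Proof. by apply/fpsP => m /=; rewrite mulrA. Qed.
Let scale1 : left_id 1 fps_scale.
Proof. by move=> f; apply/fpsP => m /=; rewrite mul1r. Qed.
Let scaleDr : right_distributive fps_scale +%R.
Proof. by move=> a f g; apply/fpsP => m /=; rewrite mulrDr. Qed.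
Let scaleDl f : {morph fps_scale^~ f : a b / a + b}.
Proof. by move=> a b; apply/fpsP => m /=; rewrite mulrDl. Qed.

HB.instance Definition _ :=
  GRing.Zmodule_isLmodule.Build K (fps n K) scaleA scale1 scaleDr scaleDl.

Let scaleAl (a : K) f g : a *: (f * g) = a *: f * g.
Proof.
apply/fpsP => m; rewrite [LHS]mulr_sumr.
by apply: eq_bigr => k _; rewrite mulrA.
Qed.

HB.instance Definition _ :=
  GRing.Lmodule_isLalgebra.Build K (fps n K) scaleAl.
HB.instance Definition _ :=
  GRing.Lalgebra_isComAlgebra.Build K (fps n K).

End FPS.

Section Convergence.
Variables (R : realType) (K : fieldType) (v : absval R K) (n : nat).
Implicit Types (f g : fps n K) (m k : 'X_{1..n}).

Definition convergent f : Prop :=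
  exists2 eps : 'I_n -> R, (forall i, 0 < eps i) &
    (\esum_(m in [set: 'X_{1..n}])
       (v (fps_coef f m) * \prod_(i < n) eps i ^+ m i)%:E < +oo)%E.

Lemma sum_bmultinom_le (a : 'X_{1..n} -> R) d (s : seq 'X_{1..n}) :
  (forall m, 0 <= a m) -> uniq s -> (forall m, m \in s -> (mdeg m < d)%N) ->
  \sum_(m <- s) a m <= \sum_(m : 'X_{1..n < d}) a m.
Proof.
move=> a0 us sd.
rewrite -[leRHS](@big_image _ _ _ _ _ (@bmnm n d) predT a) /=.
set t := fintype.image_mem _ _.
have ut : uniq t by rewrite map_inj_uniq ?enum_uniq //; exact: val_inj.
have -> : \sum_(m <- s) a m = \sum_(m <- t | m \in s) a m.
  rewrite -[RHS]big_filter; apply: perm_big; apply: uniq_perm => //.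
    exact: filter_uniq.
  move=> m; rewrite mem_filter; case: (boolP (m \in s)) => //= /sd md.
  by apply/esym/fintype.imageP; exists (BMultinom md).
by rewrite [leRHS](bigID (mem s)) /= lerDl sumr_ge0.
Qed.

Lemma esum_multinom_lty (a : 'X_{1..n} -> R) : (forall m, 0 <= a m) ->
  (\esum_(m in [set: 'X_{1..n}]) (a m)%:E < +oo)%E <->
  exists M, forall d, \sum_(m : 'X_{1..n < d}) a m <= M.
Proof.
move=> a0; split=> [fin|[M leM]].
  exists (fine (\esum_(m in [set: 'X_{1..n}]) (a m)%:E)) => d.
  rewrite -lee_fin fineK; last first.
    by rewrite ge0_fin_numE // esum_ge0 // => m _; rewrite lee_fin.
  apply: esum_ge; exists [set` [seq bmnm k | k : 'X_{1..n < d}]].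
    by split => //; exact: finite_seq.
  rewrite -fsbig_seq; last by rewrite map_inj_uniq ?enum_uniq //; exact: val_inj.
  by rewrite sumEFin lee_fin big_image /=.
apply: (@le_lt_trans _ _ M%:E); last exact: ltry.
apply: ge_ereal_sup => _ [X [finX _] <-].
rewrite fsbig_finite // sumEFin lee_fin.
pose d := (\max_(m <- finmap.enum_fset (fset_set X)) mdeg m).+1.
apply: le_trans (leM d); apply: sum_bmultinom_le => //.
  exact: finmap.fset_uniq.
by move=> m mX; rewrite /d ltnS (bigD1_seq m) ?finmap.fset_uniq //= leq_maxl.
Qed.

Lemma convergentP f : convergent f <->
  exists2 r : R, 0 < r & exists M, forall d,
    \sum_(m : 'X_{1..n < d}) v (fps_coef f m) * r ^+ mdeg m <= M.
Proof.
split=> [[eps eps0]|[r r0 [M leM]]].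
  rewrite esum_multinom_lty; last first.
    by move=> m; rewrite mulr_ge0 ?absval_ge0 ?prodr_ge0 // => i _; rewrite exprn_ge0 // ltW.
  move=> [M leM]; pose r : R := \big[Order.min/1]_(i < n) eps i.
  have r0 : 0 < r by apply: lt_bigmin.
  exists r => //; exists M => d; apply: le_trans (leM d).
  apply: ler_sum => m _; rewrite ler_wpM2l ?absval_ge0 //.
  rewrite mdegE -prodrXr; apply: ler_prod => i _.
  rewrite exprn_ge0 ?(ltW r0) //= lerXn2r ?nnegrE ?(ltW r0) ?(ltW (eps0 i)) //.
  exact: bigmin_le_cond.
exists (fun=> r) => //; rewrite esum_multinom_lty; last first.
  by move=> m; rewrite mulr_ge0 ?absval_ge0 ?prodr_ge0 // => i _; rewrite exprn_ge0 // ltW.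
exists M => d; apply: le_trans (leM d); apply: ler_sum => m _.
by rewrite prodrXr mdegE.
Qed.

Lemma bound_shrink f (r r' M : R) : 0 <= r' -> r' <= r ->
  (forall d, \sum_(m : 'X_{1..n < d}) v (fps_coef f m) * r ^+ mdeg m <= M) ->
  forall d, \sum_(m : 'X_{1..n < d}) v (fps_coef f m) * r' ^+ mdeg m <= M.
Proof.
move=> r'0 r'r leM d; apply: le_trans (leM d); apply: ler_sum => m _.
by rewrite ler_wpM2l ?absval_ge0 // lerXn2r ?nnegrE // (le_trans r'0).
Qed.

Lemma convergent2P f g : convergent f -> convergent g ->
  exists2 r : R, 0 < r & exists M N, forall d,
    \sum_(m : 'X_{1..n < d}) v (fps_coef f m) * r ^+ mdeg m <= M /\
    \sum_(m : 'X_{1..n < d}) v (fps_coef g m) * r ^+ mdeg m <= N.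
Proof.
move=> /convergentP[r1 r10 [M leM]] /convergentP[r2 r20 [N leN]].
have r0 : 0 < Order.min r1 r2 by rewrite lt_min r10.
exists (Order.min r1 r2) => //; exists M, N => d; split.
  by apply: bound_shrink leM d; rewrite ?ge_min ?lexx // ltW.
by apply: bound_shrink leN d; rewrite ?ge_min ?lexx ?orbT // ltW.
Qed.

Lemma convergent_delta k c : convergent (fps_delta k c).
Proof.
apply/convergentP; exists 1 => //; exists (v c) => d.
under eq_bigr do rewrite expr1n mulr1 /=.
have [kd|dk] := ltnP (mdeg k) d.
  rewrite (bigD1 (BMultinom kd)) //= eqxx big1 ?addr0 // => m.
  by rewrite -val_eqE /= => /negbTE ->; rewrite absval0.
rewrite big1 ?absval_ge0 // => m _.
suff /negbTE -> : (m : 'X_{1..n}) != k by rewrite absval0.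
by apply: contraTneq (bmdeg m) => ->; rewrite -leqNgt.
Qed.

Lemma convergent_lin c f g :
  convergent f -> convergent g -> convergent (c *: f + g).
Proof.
move=> cf cg; have [r r0 [M [N leMN]]] := convergent2P cf cg.
apply/convergentP; exists r => //; exists (v c * M + N) => d.
have [leM leN] := leMN d.
apply: le_trans (lerD (ler_wpM2l (absval_ge0 v c) leM) leN).
rewrite mulr_sumr -big_split /=; apply: ler_sum => m _.
rewrite mulrA -absvalM -mulrDl ler_wpM2r ?exprn_ge0 ?(ltW r0) //.
exact: absval_leD.
Qed.

Lemma convergent_mul f g : convergent f -> convergent g -> convergent (f * g).
Proof.
move=> cf cg; have [r r0 [M [N leMN]]] := convergent2P cf cg.
have rX j : 0 <= r ^+ j by rewrite exprn_ge0 // ltW.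
apply/convergentP; exists r => //; exists (M * N) => d.
have [leM leN] := leMN d.
have S0 (h : fps n K) :
    0 <= \sum_(m : 'X_{1..n < d}) v (fps_coef h m) * r ^+ mdeg m.
  by rewrite sumr_ge0 // => m _; rewrite mulr_ge0 ?absval_ge0.
apply: le_trans (ler_pM (S0 f) (S0 g) leM leN).
pose t (k : 'X_{1..n < d, d}) :=
  v (fps_coef f k.1) * r ^+ mdeg k.1 * (v (fps_coef g k.2) * r ^+ mdeg k.2).
have t0 (k : 'X_{1..n < d, d}) : 0 <= t k by rewrite !mulr_ge0 ?absval_ge0.
have coefM (m : 'X_{1..n < d}) : fps_coef (f * g) m =
    \sum_(k : 'X_{1..n < d, d} | (m : 'X_{1..n}) == (k.1 + k.2)%MM)
      fps_coef f k.1 * fps_coef g k.2.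
  rewrite (fps_mulE _ _ (bmdeg m)) (mcoeff_poly_mul _ _ (bmdeg m)).
  by apply: eq_bigr => k _; rewrite !fps_truncE ?bmdeg.
under eq_bigr do rewrite coefM.
rewrite big_distrlr pair_bigA /=.
apply: (@le_trans _ _ (\sum_(m : 'X_{1..n < d})
          \sum_(k : 'X_{1..n < d, d} | (m : 'X_{1..n}) == (k.1 + k.2)%MM) t k)).
  apply: ler_sum => m _.
  apply: le_trans (ler_wpM2r (rX _) (absval_sum _ _ _ _)) _.
  rewrite mulr_suml; apply: ler_sum => k /eqP ->.
  by rewrite mdegD exprD absvalM mulrACA.
rewrite (exchange_big_dep predT) //=; apply: ler_sum => k _.
have [kd|dk] := ltnP (mdeg (k.1 + k.2)%MM) d.
  by rewrite (big_pred1 (BMultinom kd)).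
rewrite big1 ?t0 // => m /eqP mk.
by move: (bmdeg m); rewrite mk ltnNge dk.
Qed.

Lemma convergent_deriv i f : convergent f -> convergent (fps_deriv i f).
Proof.
move=> /convergentP[r r0 [M leM]].
apply/convergentP; exists (r / 2); first by rewrite divr_gt0.
exists (r^-1 * M) => d.
have rX j : 0 <= r ^+ j by rewrite exprn_ge0 // ltW.
apply: le_trans (ler_wpM2l _ (leM d.+1)); last by rewrite invr_ge0 ltW.
pose a m := v (fps_coef f m) * r ^+ mdeg m.
have a0 m : 0 <= a m by rewrite mulr_ge0 ?absval_ge0.
apply: (@le_trans _ _ (r^-1 * \sum_(m : 'X_{1..n < d}) a (m + U_(i))%MM)).
  rewrite mulr_sumr; apply: ler_sum => m _ /=.
  rewrite -[fps_coef _ _ *+ _]mulr_natr absvalM /a mdegD mdeg1 addn1 exprS.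
  rewrite (mulrCA _ r) mulKf ?gt_eqF // -mulrA ler_wpM2l ?absval_ge0 //.
  apply: (le_trans (ler_wpM2r _ (absval_natr _ _))).
    by rewrite exprn_ge0 // divr_ge0 // ltW.
  rewrite expr_div_n mulrCA ler_piMr // ler_pdivrMr ?exprn_gt0 // mul1r.
  rewrite -natrX ler_nat (leq_trans _ (ltn_expl (mdeg m) (ltnSn 1))) // ltnS.
  by rewrite mdegE (bigD1 i) //= leq_addr.
rewrite ler_wpM2l ?invr_ge0 ?(ltW r0) //.
rewrite -[leLHS](@big_image _ _ _ _ _ (fun m : 'X_{1..n < d} => (m + U_(i))%MM)
                  predT a) /=.
apply: sum_bmultinom_le => //.
  by rewrite map_inj_uniq ?enum_uniq // => m1 m2 /addIm/val_inj.
by move=> _ /fintype.imageP[m _ ->]; rewrite mdegD mdeg1 addn1 ltnS bmdeg.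
Qed.

Definition convergent_pred : {pred fps n K} := fun f => `[< convergent f >].

Lemma convergent_subalg : GRing.subalg_closed convergent_pred.
Proof.
split=> [|c f g|f g].
- by apply/asboolP; exact: (convergent_delta 0%MM 1).
- by move=> /asboolP cf /asboolP cg; apply/asboolP/convergent_lin.
- by move=> /asboolP cf /asboolP cg; apply/asboolP/convergent_mul.
Qed.

HB.instance Definition _ :=
  GRing.isSubalgClosed.Build K (fps n K) convergent_pred convergent_subalg.

(* The ring K{x_1, ..., x_n} of convergent power series. *)
Record cps := CPS { fps_of_cps :> fps n K; _ : convergent_pred fps_of_cps }.

HB.instance Definition _ := [isSub for fps_of_cps].
HB.instance Definition _ := [Choice of cps by <:].
HB.instance Definition _ := [SubChoice_isSubAlgebra of cps by <:].
HB.instance Definition _ := [SubNzRing_isSubComNzRing of cps by <:].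
HB.instance Definition _ := GRing.Lalgebra_isComAlgebra.Build K cps.

Implicit Types (p q : cps).

Let cps_unit : pred cps := fun p => `[< exists q, q * p = 1 >].
Let cps_inv p : cps :=
  if pselect (exists q, q * p = 1) is left ex then projT1 (cid ex) else p.

Let cps_mulVr : {in cps_unit, left_inverse 1 cps_inv *%R}.
Proof.
move=> p /asboolP ex; rewrite /cps_inv.
by case: pselect => // {}ex; case: cid.
Qed.
Let cps_unitP p q : q * p = 1 -> cps_unit p.
Proof. by move=> qp; apply/asboolP; exists q. Qed.
Let cps_inv_out : {in [predC cps_unit], cps_inv =1 id}.
Proof. by move=> p /asboolPn nex; rewrite /cps_inv; case: pselect. Qed.

HB.instance Definition _ :=
  GRing.ComNzRing_hasMulInverse.Build cps cps_mulVr cps_unitP cps_inv_out.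

Definition cps_var (i : 'I_n) : cps :=
  CPS (asboolT (convergent_delta U_(i)%MM 1)).

Lemma cps_deriv_subproof i p : convergent_pred (fps_deriv i p).
Proof. by apply/asboolP/convergent_deriv; case: p => p /= /asboolP. Qed.
Definition cps_deriv i p : cps := CPS (cps_deriv_subproof i p).

End Convergence.

Section Ideals.
Variable A : comNzRingType.

Definition ideal_closed (I : set A) : Prop :=
  [/\ I 0, forall x y, I x -> I y -> I (x + y) & forall a x, I x -> I (a * x)].

(* Unlike the library's [idealr], an ideal may be the whole ring, as happens  *)
(* for j(f) when f = x_1.                                                     *)
Record ideal := Ideal { ideal_set :> A -> Prop; idealP : ideal_closed ideal_set }.

Lemma ideal_gen_subproof (S : set A) : ideal_closed (smallest ideal_closed S).
Proof.
split=> [I [[]] //|x y Sx Sy I II|a x Sx I II].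
  by case: (II) => -[_ addI _] _; apply: addI; [exact: Sx|exact: Sy].
by case: (II) => -[_ _ mulI] _; apply: mulI; exact: Sx.
Qed.
Definition ideal_gen (S : set A) : ideal := Ideal (ideal_gen_subproof S).

Definition ideal_mul (I J : ideal) : ideal :=
  ideal_gen [set z | exists x y, [/\ I x, J y & z = x * y]].

Definition ideal_exp (I : ideal) (k : nat) : ideal :=
  iter k (ideal_mul I) (ideal_gen [set 1]).

Definition ideal_pred (I : ideal) : {pred A} := fun x => `[< I x >].

Lemma ideal_predE I x : (x \in ideal_pred I) = `[< I x >]. Proof. by []. Qed.

Lemma ideal_zmod_closed I : zmod_closed (ideal_pred I).
Proof.
have [I0 addI mulI] := idealP I.
split=> [|x y]; rewrite !ideal_predE; first exact/asboolP.
move=> /asboolP Ix /asboolP Iy; apply/asboolP/addI => //.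
by rewrite -mulN1r; exact: mulI.
Qed.

HB.instance Definition _ I :=
  GRing.isZmodClosed.Build A (ideal_pred I) (ideal_zmod_closed I).

End Ideals.

Section QuotientAlgebra.
Variables (K : fieldType) (A : comAlgType K) (I : ideal A).
Local Open Scope quotient_scope.

(* The quotient K-algebra A/I. It is the zero ring when I = A, so it only has *)
(* the ring and K-module structures that do not assume 1 != 0.                *)
Definition quot := Quotient.quot (ideal_pred I).

HB.instance Definition _ := GRing.Zmodule.on quot.

Definition qclass (a : A) : quot := \pi_(Quotient.quot (ideal_pred I)) a.
Let qrepr (x : quot) : A := repr (x : Quotient.quot (ideal_pred I)).

Lemma qclassP a b : qclass a = qclass b <-> I (a - b).
Proof.
rewrite -[I _]asboolE; split=> [/eqP|ab].
  by rewrite piE Quotient.equivE.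
by apply/eqP; rewrite piE Quotient.equivE.
Qed.

Lemma qreprK x : qclass (qrepr x) = x. Proof. exact: reprK. Qed.

Lemma qclass_is_zmod_morphism : zmod_morphism qclass.
Proof. by move=> a b; rewrite /qclass /= !piE. Qed.
HB.instance Definition _ :=
  GRing.isZmodMorphism.Build A quot qclass qclass_is_zmod_morphism.

Let qone : quot := qclass 1.
Let qmul (x y : quot) : quot := qclass (qrepr x * qrepr y).
Let qscale (c : K) (x : quot) : quot := qclass (c *: qrepr x).

Let qmulE a b : qmul (qclass a) (qclass b) = qclass (a * b).
Proof.
have [_ addI mulI] := idealP I; apply/qclassP.
set a' := qrepr _; set b' := qrepr _.
have Ia : I (a' - a) by apply/qclassP; rewrite qreprK.
have Ib : I (b' - b) by apply/qclassP; rewrite qreprK.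
have -> : a' * b' - a * b = b' * (a' - a) + a * (b' - b).
  by rewrite !mulrBr addrA (mulrC b') (mulrC b') subrK.
by apply: addI; exact: mulI.
Qed.

Let qscaleE c a : qscale c (qclass a) = qclass (c *: a).
Proof.
have [_ _ mulI] := idealP I; apply/qclassP.
rewrite -scalerBr -mulr_algl; apply: mulI.
by apply/qclassP; rewrite qreprK.
Qed.

Let qmulA : associative qmul.
Proof.
by move=> x y z; rewrite -(qreprK x) -(qreprK y) -(qreprK z) !qmulE mulrA.
Qed.
Let qmulC : commutative qmul.
Proof. by move=> x y; rewrite /qmul mulrC. Qed.
Let qmul1 : left_id qone qmul.
Proof. by move=> x; rewrite -(qreprK x) qmulE mul1r. Qed.
Let qmulDl : left_distributive qmul +%R.
Proof.
move=> x y z; rewrite -(qreprK x) -(qreprK y) -(qreprK z).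
by rewrite -raddfD !qmulE mulrDl raddfD.
Qed.

HB.instance Definition _ :=
  GRing.Zmodule_isComPzRing.Build quot qmulA qmulC qmul1 qmulDl.

Let qscaleA a b x : qscale a (qscale b x) = qscale (a * b) x.
Proof. by rewrite -(qreprK x) !qscaleE scalerA. Qed.
Let qscale1 : left_id 1 qscale.
Proof. by move=> x; rewrite -(qreprK x) qscaleE scale1r. Qed.
Let qscaleDr : right_distributive qscale +%R.
Proof.
move=> a x y; rewrite -(qreprK x) -(qreprK y).
by rewrite -raddfD !qscaleE scalerDr raddfD.
Qed.
Let qscaleDl x : {morph qscale^~ x : a b / a + b}.
Proof. by move=> a b; rewrite -(qreprK x) !qscaleE scalerDl raddfD. Qed.

HB.instance Definition _ :=
  GRing.Zmodule_isLmodule.Build K quot qscaleA qscale1 qscaleDr qscaleDl.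

Lemma qclass_is_monoid_morphism : monoid_morphism qclass.
Proof. by split=> // a b; rewrite -qmulE. Qed.
HB.instance Definition _ :=
  GRing.isMonoidMorphism.Build A quot qclass qclass_is_monoid_morphism.

Lemma qclass_is_scalable : scalable qclass.
Proof. by move=> c a; rewrite -qscaleE. Qed.
HB.instance Definition _ :=
  GRing.isScalable.Build K A quot *:%R qclass qclass_is_scalable.

Lemma quot_scalerAl (c : K) (x y : quot) : c *: (x * y) = c *: x * y.
Proof.
rewrite -(qreprK x) -(qreprK y) -rmorphM -!linearZ /= -rmorphM.
by rewrite -scalerAl.
Qed.

End QuotientAlgebra.

Definition finite_dim (K : fieldType) (V : lmodType K) : Prop :=
  exists d : nat, inhabited (Vector.axiom d V).

Section Equivalences.
Variables (R : realType) (K : fieldType) (v : absval R K) (n : nat).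
Local Notation Kx := (cps v n).
Implicit Types (f g : Kx) (k : nat).

Definition max_ideal : ideal Kx := ideal_gen (range (@cps_var R K v n)).

Definition jacobian_ideal f : ideal Kx :=
  ideal_gen (range (fun i : 'I_n => cps_deriv i f)).

Definition is_local_aut (phi : Kx -> Kx) : Prop :=
  bijective phi /\ forall h, max_ideal h -> max_ideal (phi h).

Definition right_equivalent f g : Prop :=
  exists phi : {lrmorphism Kx -> Kx}, is_local_aut phi /\ f = phi g.

Definition contact_equivalent f g : Prop :=
  exists phi : {lrmorphism Kx -> Kx}, exists u : Kx,
    [/\ is_local_aut phi, u \is a GRing.unit & f = u * phi g].

Definition milnor_ideal k f : ideal Kx :=
  ideal_mul (ideal_exp max_ideal k) (jacobian_ideal f).

Definition tjurina_ideal k f : ideal Kx :=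
  ideal_gen (f |` ideal_set (milnor_ideal k f)).

Definition milnor_algebra k f := quot (milnor_ideal k f).
Definition tjurina_algebra k f := quot (tjurina_ideal k f).

Definition milnor_finite f : Prop := finite_dim (quot (jacobian_ideal f)).

Definition tjurina_finite f : Prop :=
  finite_dim (quot (ideal_gen (f |` ideal_set (jacobian_ideal f)))).

Definition tjurina_iso k f g : Prop :=
  exists phi : {rmorphism tjurina_algebra k f -> tjurina_algebra k g},
    scalable phi /\ bijective phi.

(* Isomorphism of K{t}-algebras: t acts on M_k(f) as multiplication by f and  *)
(* on M_k(g) as multiplication by g.                                          *)
Definition milnor_iso k f g : Prop :=
  exists phi : {rmorphism milnor_algebra k f -> milnor_algebra k g},
    [/\ scalable phi, bijective phi &
        phi (qclass (milnor_ideal k f) f) = qclass (milnor_ideal k g) g].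

End Equivalences.

(* Main.v *)
(* An isomorphism of k-th Tjurina (Milnor) algebras lifts to an
   automorphism of K{x}, so one may assume that the ideals of f and g coincide
   and that h = g - f lies in this common ideal. Write the line f + s h: solving
   the resulting infinitesimal equation over K{x}[[s]] gives a formal flow which
   trivializes the family. The flow fixes the origin, also for k = 0: along the
   orbit of the origin f and its partial derivatives vanish, hence so does a
   power of each coordinate. Truncating at a high order turns the flow into a
   solution over K[[s]] of polynomial equations over K[s]; as K is algebraically
   closed these have solutions over K for all but finitely many values of s.
   With finite determinacy, f + t h is equivalent to f for almost all t, and
   symmetrically to g for almost all t, so f is equivalent to g. Neither
   completeness nor analytic continuation is needed: convergence only enters
   through a fixed point theorem whose solutions obey a norm bound. *)

(* The flow is formal in s, with no control over the radii of its coefficients. It therefore cannot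
   be evaluated at s = 1, which would carry f to g at once; this forces the detour through jets.
   Solvability for almost all s rests on the following: the finitely many coefficients of a jet
   generate an algebra over K[s] inside the integral domain K[[s]], and K-points of such an algebra
   are built by adjoining one generator at a time. One nonvanishing condition can be carried along,
   here that the Jacobian determinant and the factor E stay nonzero at the origin. One fixed point
   theorem yields units, inverse functions and determinacy. Its equation is quadratic in the
   unknown, so each coefficient of the iterates becomes stationary after finitely many steps and
   lies in [K] itself. Morphisms of power series rings are not assumed continuous: the expansion of
   f - f(0) as a sum of x_i h_i reduces statements about them to the coordinates. The flow stays at
   the origin only if f and g are singular there, so germs of order one are treated apart by a
   change of coordinates. *)
From HB Require Import structures.
Require Import Defs.
From mathcomp Require Import all_boot all_order all_algebra perm mpoly.
From mathcomp Require Import boolp classical_sets.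
From mathcomp Require Import reals ring.

Set Implicit Arguments.
Unset Strict Implicit.
Unset Printing Implicit Defensive.

Import Order.TTheory GRing.Theory Num.Theory.

Local Open Scope ring_scope.

(** * Order filtration of formal power series *)

Notation "f @c m" := (fps_coef f m) (at level 2, left associativity).

Arguments fps_mul : simpl never.
Arguments fps_deriv : simpl never.

Section Order.
Variables (n : nat) (K : fieldType).
Implicit Types (f g h : fps n K) (m : 'X_{1..n}) (d e : nat).

Lemma fcoefD f g m : (f + g) @c m = f @c m + g @c m. Proof. by []. Qed.
Lemma fcoefN f m : (- f) @c m = - f @c m. Proof. by []. Qed.
Lemma fcoefB f g m : (f - g) @c m = f @c m - g @c m. Proof. by []. Qed.
Lemma fcoefZ c f m : (c *: f) @c m = c * f @c m. Proof. by []. Qed.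
Lemma fcoef0 m : (0 : fps n K) @c m = 0. Proof. by []. Qed.
Lemma fcoef1 m : (1 : fps n K) @c m = (m == 0%MM)%:R. Proof. by []. Qed.
Lemma fcoefC c m : (c%:A : fps n K) @c m = c *+ (m == 0%MM).
Proof. by rewrite fcoefZ fcoef1 mulr_natr. Qed.
Lemma fcoef_sum I (r : seq I) (P : pred I) (F : I -> fps n K) m :
  (\sum_(i <- r | P i) F i) @c m = \sum_(i <- r | P i) (F i) @c m.
Proof. by elim/big_rec2: _ => // i x y _ <-. Qed.
Lemma fcoefM f g m : (f * g) @c m =
  \sum_(k : 'X_{1..n < (mdeg m).+1, (mdeg m).+1} | m == (k.1 + k.2)%MM)
     f @c k.1 * g @c k.2.
Proof. by []. Qed.
Lemma fcoefM0 f g : (f * g) @c 0%MM = f @c 0%MM * g @c 0%MM.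
Proof.
rewrite (fps_mulE _ _ (ltnSn _)) -[in RHS](@fps_truncE _ _ 1 f) ?mdeg0 //.
rewrite -[in RHS](@fps_truncE _ _ 1 g) ?mdeg0 //.
exact: (rmorphM (mcoeff 0%MM)).
Qed.

Definition ordge d f := forall m, (mdeg m < d)%N -> f @c m = 0.

Lemma ordge0 f : ordge 0 f. Proof. by []. Qed.
Lemma ordge_zero d : ordge d 0. Proof. by []. Qed.
Lemma ordgeW d e f : (e <= d)%N -> ordge d f -> ordge e f.
Proof. by move=> ed fd m me; apply: fd; apply: leq_trans ed. Qed.
Lemma ordgeD d f g : ordge d f -> ordge d g -> ordge d (f + g).
Proof. by move=> fd gd m md; rewrite fcoefD fd // gd // addr0. Qed.
Lemma ordgeN d f : ordge d f -> ordge d (- f).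
Proof. by move=> fd m md; rewrite fcoefN fd // oppr0. Qed.
Lemma ordgeB d f g : ordge d f -> ordge d g -> ordge d (f - g).
Proof. by move=> fd gd; apply/ordgeD/ordgeN. Qed.
Lemma ordgeZ d c f : ordge d f -> ordge d (c *: f).
Proof. by move=> fd m md; rewrite fcoefZ fd // mulr0. Qed.
Lemma ordge_sum d I (r : seq I) (P : pred I) (F : I -> fps n K) :
  (forall i, P i -> ordge d (F i)) -> ordge d (\sum_(i <- r | P i) F i).
Proof.
by move=> FP; elim/big_rec: _ => [|i x /FP Fi xd]; [exact: ordge_zero|exact: ordgeD].
Qed.
Lemma ordgeM d e f g : ordge d f -> ordge e g -> ordge (d + e) (f * g).
Proof.
move=> fd ge m md; rewrite fcoefM big1 // => -[k1 k2] /= /eqP mk.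
have [k1d|dk1] := ltnP (mdeg k1) d; first by rewrite fd // mul0r.
rewrite ge ?mulr0 // -(ltn_add2l d); apply: leq_ltn_trans md.
have /= dm := congr1 mdeg mk; rewrite mdegD in dm.
by apply: leq_trans (eq_leq (esym dm)); rewrite leq_add2r.
Qed.
Lemma ordgeMl d f g : ordge d g -> ordge d (f * g).
Proof. exact: (@ordgeM 0 d f g (ordge0 f)). Qed.
Lemma ordgeMr d f g : ordge d f -> ordge d (f * g).
Proof. by rewrite mulrC; exact: ordgeMl. Qed.
Lemma ordgeX d f k : ordge d f -> ordge (k * d) (f ^+ k).
Proof.
by move=> fd; elim: k => [|k IH]; [exact: ordge0|rewrite exprS mulSn; exact: ordgeM].
Qed.
Lemma ordge_prod I (r : seq I) (F : I -> fps n K) (D : I -> nat) :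
  (forall i, ordge (D i) (F i)) -> ordge (\sum_(i <- r) D i) (\prod_(i <- r) F i).
Proof.
move=> FD; elim: r => [|i r IH]; first by rewrite !big_nil.
by rewrite !big_cons; exact: ordgeM.
Qed.
Lemma ordge1P f : ordge 1 f <-> f @c 0%MM = 0.
Proof.
split=> [|f0 m]; first by apply; rewrite mdeg0.
by rewrite ltnS leqn0 mdeg_eq0 => /eqP ->.
Qed.
Lemma ordge_eq0 f : (forall d, ordge d f) -> f = 0.
Proof. by move=> fd; apply/fpsP => m; exact: (fd (mdeg m).+1). Qed.
Lemma ordge_eq f g : (forall d, ordge d (f - g)) -> f = g.
Proof. by move=> /ordge_eq0 /eqP; rewrite subr_eq0 => /eqP. Qed.
Lemma ordgeBP d f g : ordge d (f - g) <-> forall m, (mdeg m < d)%N -> f @c m = g @c m.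
Proof.
split=> fg m md; first by apply/eqP; rewrite -subr_eq0; apply/eqP; exact: fg.
by rewrite fcoefB fg // subrr.
Qed.
Lemma ordge_sym d f g : ordge d (f - g) -> ordge d (g - f).
Proof. by move=> /ordgeN; rewrite opprB. Qed.
Lemma ordge_trans d f g h : ordge d (f - g) -> ordge d (g - h) -> ordge d (f - h).
Proof. by move=> fg gh; rewrite -(subrK g f) -addrA; exact: ordgeD. Qed.
Lemma ordge_mulB d f f' g g' :
  ordge d (f - f') -> ordge d (g - g') -> ordge d (f * g - f' * g').
Proof.
move=> ff gg; rewrite -(subrK (f * g') (f * g)) -addrA -mulrBr -mulrBl.
by apply: ordgeD; [exact: ordgeMl|exact: ordgeMr].
Qed.

Definition fpsX (i : 'I_n) : fps n K := fps_delta U_(i)%MM 1.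

Lemma fcoefX i m : (fpsX i) @c m = (m == U_(i)%MM)%:R. Proof. by []. Qed.
Lemma ordgeX1 i : ordge 1 (fpsX i).
Proof.
by apply/ordge1P; rewrite fcoefX eq_sym mnm1_eq0.
Qed.
Lemma fcoefXM i f m :
  (fpsX i * f) @c m = if (0 < m i)%N then f @c (m - U_(i))%MM else 0.
Proof.
have dm := ltnSn (mdeg m); rewrite [LHS](fps_mulE _ _ dm).
rewrite (@mcoeffM_eq _ _ (mdeg m).+1 _ 'X_i _ (fps_trunc (mdeg m).+1 f)) //; last first.
  by move=> k kd; rewrite fps_truncE // mcoeffX fcoefX eq_sym.
rewrite mulrC; case: ifPn => [mi|].
  have um : (U_(i) <= m)%MM.
    apply/mnm_lepP => j; rewrite mnm1E; case: eqP => //= <- //.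
  set p := fps_trunc _ _; have := mcoeffMX p U_(i)%MM (m - U_(i))%MM.
  by rewrite addmC submK // => ->; rewrite fps_truncE // ltnS mdegB.
rewrite -leqNgt leqn0 => /eqP mi; rewrite mcoeffM big1 // => -[k1 k2] /= /eqP mk.
rewrite mcoeffX; case: eqP => [ku|]; last by rewrite mulr0.
have := congr1 (fun k : 'X_{1..n} => k i) mk.
by rewrite /= mi mnmDE -ku mnm1E eqxx addn1.
Qed.

Lemma fcoef_deriv i f m : (fps_deriv i f) @c m = f @c (m + U_(i))%MM *+ (m i).+1.
Proof. by []. Qed.

Lemma fps_derivD i f g : fps_deriv i (f + g) = fps_deriv i f + fps_deriv i g.
Proof. by apply/fpsP => m; rewrite fcoefD !fcoef_deriv fcoefD mulrnDl. Qed.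
Lemma fps_derivZ i c f : fps_deriv i (c *: f) = c *: fps_deriv i f.
Proof. by apply/fpsP => m; rewrite fcoefZ !fcoef_deriv fcoefZ mulrnAr. Qed.
Lemma fps_derivM i f g :
  fps_deriv i (f * g) = fps_deriv i f * g + f * fps_deriv i g.
Proof.
apply/fpsP => m; rewrite fcoefD fcoef_deriv.
pose d := (mdeg m).+2; pose T := @fps_trunc n K d.
have dmi : (mdeg (m + U_(i))%MM < d)%N by rewrite mdegD mdeg1 addn1.
have dm := ltnSn (mdeg m).
rewrite (fps_mulE _ _ dmi) -mcoeff_deriv mderivM mcoeffD.
rewrite [X in _ = X + _](fps_mulE _ _ dm) [X in _ = _ + X](fps_mulE _ _ dm).
have TE (h : fps n K) k : (mdeg k < (mdeg m).+1)%N ->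
    (T h)@_k = (fps_trunc (mdeg m).+1 h)@_k.
  by move=> km; rewrite !fps_truncE // ltnW.
have TD (h : fps n K) k : (mdeg k < (mdeg m).+1)%N ->
    ((T h)^`M(i))@_k = (fps_trunc (mdeg m).+1 (fps_deriv i h))@_k.
  by move=> km; rewrite mcoeff_deriv !fps_truncE // mdegD mdeg1 addn1.
by congr (_ + _); apply: (mcoeffM_eq dm) => k km; rewrite ?TE ?TD.
Qed.
Lemma fps_deriv_comm i j f : fps_deriv i (fps_deriv j f) = fps_deriv j (fps_deriv i f).
Proof.
apply/fpsP => m; rewrite !fcoef_deriv -!mulrnA.
have -> : (m + U_(i) + U_(j) = m + U_(j) + U_(i))%MM by rewrite -!addmA (addmC U_(i)%MM).
congr (GRing.natmul _ _); rewrite !mnmDE !mnm1E eq_sym.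
by case: eqP => [->|_] //=; rewrite !addn0 mulnC.
Qed.
Lemma fps_derivX i j : fps_deriv i (fpsX j) = (i == j)%:R.
Proof.
apply/fpsP => m; rewrite fcoef_deriv fcoefX.
have -> : ((i == j)%:R : fps n K) @c m = ((i == j) && (m == 0%MM))%:R.
  by case: eqP => _ //=; rewrite fcoef1.
have [->|ij] := eqVneq i j; last first.
  case: eqP => [mu|]; last by rewrite mul0rn.
  have := congr1 (fun k : 'X_{1..n} => k i) mu.
  by rewrite mnmDE !mnm1E eqxx eq_sym (negbTE ij) addn1.
rewrite -{2}[U_(j)%MM]add0m; have [->|m0] := eqVneq m 0%MM.
  by rewrite eqxx mnm0E.
rewrite (_ : (_ == _) = false) ?mul0rn //; apply: contraNF m0 => /eqP/addIm ->.
by [].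
Qed.
Lemma fps_derivC i c : fps_deriv i (c%:A : fps n K) = 0.
Proof.
apply/fpsP => m; rewrite fcoef_deriv fcoefC.
case: eqP => [mu|]; last by rewrite mul0rn.
by have := congr1 (fun k : 'X_{1..n} => k i) mu; rewrite mnmDE mnm1E eqxx mnm0E addn1.
Qed.
Lemma ordge_deriv d i f : ordge d.+1 f -> ordge d (fps_deriv i f).
Proof. by move=> fd m md; rewrite fcoef_deriv fd ?mul0rn // mdegD mdeg1 addn1. Qed.

End Order.

(** * Weighted l1-norms and substitution *)

Section Norm.
Variables (R : realType) (K : fieldType) (v : absval R K) (n : nat).
Implicit Types (f g h : fps n K) (r M N : R).

(** The weighted l1-norm at polyradius (r, ..., r) is bounded through its partial sums, so that no
    infinite value or limit enters and the bound can be checked on jets. *)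
Definition norm_le r M f := forall d,
  \sum_(m : 'X_{1..n < d}) v (f @c m) * r ^+ mdeg m <= M.

Lemma norm_leW r M N f : M <= N -> norm_le r M f -> norm_le r N f.
Proof. by move=> MN fM d; apply: le_trans MN. Qed.
Lemma norm_le_shrink r r' M f : 0 <= r' -> r' <= r -> norm_le r M f -> norm_le r' M f.
Proof. exact: bound_shrink. Qed.
Lemma norm_le_ge0 r M f : norm_le r M f -> 0 <= M.
Proof. by move/(_ 0%N); rewrite big1 // => -[m]. Qed.
(** A partial sum sees only finitely many coefficients, so norm balls are closed under
    coefficientwise limits. This takes the place of completeness. *)
Lemma norm_le_approx r M f :
  (forall d, exists2 g, norm_le r M g & ordge d (f - g)) -> norm_le r M f.
Proof.
move=> fM d; have [g gM /ordgeBP fg] := fM d.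
by apply: le_trans (gM d); apply: ler_sum => m _; rewrite fg ?bmdeg.
Qed.
Lemma norm_le0 r : norm_le r 0 (0 : fps n K).
Proof. by move=> d; rewrite big1 // => m _; rewrite fcoef0 absval0 mul0r. Qed.
Lemma norm_leD r M N f g : 0 <= r -> norm_le r M f -> norm_le r N g -> norm_le r (M + N) (f + g).
Proof.
move=> r0 fM gN d; apply: le_trans (lerD (fM d) (gN d)).
rewrite -big_split /=; apply: ler_sum => m _.
by rewrite -mulrDl ler_wpM2r ?exprn_ge0 ?absval_leD.
Qed.
Lemma norm_leZ r M c f : norm_le r M f -> norm_le r (v c * M) (c *: f).
Proof.
move=> fM d; apply: le_trans (ler_wpM2l (absval_ge0 v c) (fM d)).
by rewrite mulr_sumr; apply: ler_sum => m _; rewrite fcoefZ absvalM mulrA.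
Qed.
Lemma norm_le_delta r k c : 0 <= r -> norm_le r (v c * r ^+ mdeg k) (fps_delta k c).
Proof.
move=> r0 d; have [kd|dk] := ltnP (mdeg k) d.
  rewrite (bigD1 (BMultinom kd)) //= eqxx big1 ?addr0 // => m.
  by rewrite -val_eqE /= => /negbTE ->; rewrite absval0 mul0r.
rewrite big1 ?mulr_ge0 ?absval_ge0 ?exprn_ge0 // => m _ /=.
suff /negbTE -> : (m : 'X_{1..n}) != k by rewrite absval0 mul0r.
by apply: contraTneq (bmdeg m) => ->; rewrite -leqNgt.
Qed.
Lemma norm_le1 r : 0 <= r -> norm_le r 1 (1 : fps n K).
Proof. by move=> /(@norm_le_delta r 0%MM 1); rewrite absval1 mdeg0 mulr1. Qed.
Lemma norm_leM r M N f g : 0 <= r -> norm_le r M f -> norm_le r N g -> norm_le r (M * N) (f * g).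
Proof.
move=> r0 fM gN d; have rX j : 0 <= r ^+ j by rewrite exprn_ge0.
have t0 (h : fps n K) m : 0 <= v (h @c m) * r ^+ mdeg m.
  by rewrite mulr_ge0 ?absval_ge0.
have S0 (h : fps n K) : 0 <= \sum_(m : 'X_{1..n < d}) v (h @c m) * r ^+ mdeg m.
  by rewrite sumr_ge0.
apply: le_trans (ler_pM (S0 f) (S0 g) (fM d) (gN d)).
pose t (k : 'X_{1..n < d, d}) :=
  v (f @c k.1) * r ^+ mdeg k.1 * (v (g @c k.2) * r ^+ mdeg k.2).
rewrite big_distrlr pair_bigA.
apply: (@le_trans _ _ (\sum_(m : 'X_{1..n < d})
          \sum_(k : 'X_{1..n < d, d} | (m : 'X_{1..n}) == (k.1 + k.2)%MM) t k)).
  rewrite ler_sum // => m _; have -> := fps_mulE f g (bmdeg m) : (f * g) @c m = _.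
  rewrite (mcoeff_poly_mul _ _ (bmdeg m)).
  apply: le_trans (ler_wpM2r (rX _) (absval_sum _ _ _ _)) _.
  rewrite mulr_suml; apply: ler_sum => k /eqP ->.
  by rewrite !fps_truncE ?bmdeg // mdegD exprD absvalM mulrACA.
rewrite (exchange_big_dep predT) //=; apply: ler_sum => k _.
have [kd|dk] := ltnP (mdeg (k.1 + k.2)%MM) d.
  by rewrite (big_pred1 (BMultinom kd)).
rewrite big1 => [|m /eqP mk]; first by rewrite mulr_ge0.
by move: (bmdeg m); rewrite mk ltnNge dk.
Qed.
Lemma norm_le_sum r I (s : seq I) (P : pred I) (F : I -> fps n K) (M : I -> R) :
  0 <= r -> (forall i, P i -> norm_le r (M i) (F i)) ->
  norm_le r (\sum_(i <- s | P i) M i) (\sum_(i <- s | P i) F i).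
Proof.
move=> r0 FM; elim/big_rec2: _ => [|i x y /FM Fi xy]; first exact: norm_le0.
exact: norm_leD.
Qed.
Lemma norm_le_exp r M f k : 0 <= r -> norm_le r M f -> norm_le r (M ^+ k) (f ^+ k).
Proof.
move=> r0 fM; elim: k => [|k IH]; first exact: norm_le1.
by rewrite !exprS; exact: norm_leM.
Qed.
Lemma norm_le_prod r I (s : seq I) (F : I -> fps n K) (M : I -> R) :
  0 <= r -> (forall i, norm_le r (M i) (F i)) ->
  norm_le r (\prod_(i <- s) M i) (\prod_(i <- s) F i).
Proof.
move=> r0 FM; elim: s => [|i s IH]; first by rewrite !big_nil; exact: norm_le1.
by rewrite !big_cons; exact: norm_leM.
Qed.
(** Every monomial that occurs has degree at least one, so shrinking the radius from r to r' gains
    at least one factor r'/r. *)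
Lemma norm_le_small r M f r' : 0 < r -> 0 <= r' -> r' <= r -> ordge 1 f ->
  norm_le r M f -> norm_le r' (r' / r * M) f.
Proof.
move=> r0 r'0 r'r f1 fM d.
apply: le_trans (ler_wpM2l _ (fM d)); last by rewrite divr_ge0 // ltW.
rewrite mulr_sumr; apply: ler_sum => m _; rewrite mulrCA.
have [m0|m0] := posnP (mdeg m); first by rewrite f1 ?m0 // absval0 !mul0r.
apply: ler_wpM2l; first exact: absval_ge0.
rewrite -(prednK m0) !exprS mulrA mulfVK ?gt_eqF // ler_wpM2l //.
by apply: lerXn2r; rewrite ?nnegrE // ltW.
Qed.

Lemma convergent_norm_le f : convergent v f <-> exists2 r, 0 < r & exists M, norm_le r M f.
Proof. exact: convergentP. Qed.

End Norm.

Section Subst.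
Variables (n p : nat) (K : fieldType) (y : 'I_n -> fps p K).
Implicit Types (f g : fps n K).

Let T := mmap (in_alg (fps p K)) y.

(** When the [y i] have no constant term, monomials of f of degree above |a| cannot reach the
    coefficient at a; the polynomial substitution then gives it exactly. *)
Definition fps_subst f : fps p K :=
  FPS (fun a => (T (fps_trunc (mdeg a).+1 f)) @c a).

Lemma mmap_trunc d f :
  T (fps_trunc d f) = \sum_(k : 'X_{1..n < d}) f @c k *: mmap1 y k.
Proof.
rewrite /T /fps_trunc raddf_sum /=; apply: eq_bigr => k _.
by rewrite mmapZ mmapX /= mulr_algl.
Qed.

Arguments fps_subst : simpl never.
Hypothesis y1 : forall i, ordge 1 (y i).

Lemma ordge_mmap1 k : ordge (mdeg k) (mmap1 y k).
Proof.
rewrite mdegE; apply: ordge_prod => i.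
by rewrite -[X in ordge X]muln1; exact: ordgeX.
Qed.

Lemma ordge_mmap d (q : {mpoly K[n]}) :
  (forall k, (mdeg k < d)%N -> q@_k = 0) -> ordge d (T q).
Proof.
move=> qd; rewrite /T /mmap; apply: ordge_sum => k _ /=; rewrite mulr_algl.
have [kd|dk] := ltnP (mdeg k) d; first by rewrite qd // scale0r.
by apply/ordgeZ/(ordgeW dk)/ordge_mmap1.
Qed.

(** Modulo any order, substitution is evaluation of a polynomial. The algebra laws below are
    inherited from [mmap] this way, through [ordge_eq]. *)
Lemma ordge_substB d f : ordge d (fps_subst f - T (fps_trunc d f)).
Proof.
apply/ordgeBP => m md /=.
suff /ordgeBP : ordge (mdeg m).+1 (T (fps_trunc (mdeg m).+1 f) - T (fps_trunc d f)).
  exact.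
rewrite /T -raddfB; apply: ordge_mmap => k km.
by rewrite mcoeffB !fps_truncE ?subrr // (leq_trans km).
Qed.

Lemma ordge_subst_mmap d f (q : {mpoly K[n]}) :
  (forall k, (mdeg k < d)%N -> q@_k = f @c k) -> ordge d (fps_subst f - T q).
Proof.
move=> qf; apply: ordge_trans (@ordge_substB d f) _; rewrite /T -raddfB.
by apply: ordge_mmap => k kd; rewrite mcoeffB qf // fps_truncE // subrr.
Qed.

Lemma fps_substD f g : fps_subst (f + g) = fps_subst f + fps_subst g.
Proof.
apply: ordge_eq => d; have sfg := ordgeD (@ordge_substB d f) (@ordge_substB d g).
rewrite addrACA -opprD -[X in _ - X](raddfD T) in sfg.
apply: ordge_trans (ordge_sym sfg); apply: ordge_subst_mmap => k kd.
by rewrite mcoeffD !fps_truncE.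
Qed.

Lemma fps_substM f g : fps_subst (f * g) = fps_subst f * fps_subst g.
Proof.
apply: ordge_eq => d; have := ordge_mulB (@ordge_substB d f) (@ordge_substB d g).
rewrite -[X in _ - X](rmorphM T) => /ordge_sym; apply: ordge_trans.
by apply: ordge_subst_mmap => k kd; rewrite [RHS](fps_mulE _ _ kd).
Qed.

Lemma fps_substZ c f : fps_subst (c *: f) = c *: fps_subst f.
Proof.
apply: ordge_eq => d; have := ordgeZ c (@ordge_substB d f).
rewrite scalerBr -[c *: T _]mulr_algl -[X in X * T _]/(in_alg _ c) -mmapZ.
move=> /ordge_sym; apply: ordge_trans.
by apply: ordge_subst_mmap => k kd; rewrite mcoeffZ fps_truncE.
Qed.

Lemma fps_subst1 : fps_subst 1 = 1.
Proof.
apply: ordge_eq => d; rewrite -[X in _ - X](rmorph1 T); apply: ordge_subst_mmap.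
by move=> k kd; rewrite mcoeff1 fcoef1.
Qed.

Lemma fps_substX i : fps_subst (fpsX K i) = y i.
Proof.
apply: ordge_eq => d; have := mmapX y (in_alg (fps p K)) U_(i)%MM.
rewrite mmap1U => <-; apply: ordge_subst_mmap => k kd.
by rewrite mcoeffX fcoefX eq_sym.
Qed.

(** The monomial x^k turns into a product of norm at most s^|k| at radius r, so the norm of f at
    radius s dominates. *)
Lemma norm_le_subst (R : realType) (v : absval R K) (r s M : R) f : 0 <= r ->
  (forall i, norm_le v r s (y i)) -> norm_le v s M f -> norm_le v r M (fps_subst f).
Proof.
move=> r0 ys fM; apply: norm_le_approx => d.
exists (T (fps_trunc d f)); last exact: ordge_substB.
apply: norm_leW (fM d) _; rewrite mmap_trunc; apply: norm_le_sum => // k _.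
apply: norm_leZ; rewrite mdegE -prodrXr; apply: norm_le_prod => // i; exact: norm_le_exp.
Qed.

End Subst.

Lemma fps_subst_eq n p (K : fieldType) (y y' : 'I_n -> fps p K) f :
  (forall m i, f @c m != 0 -> (0 < m i)%N -> y i = y' i) ->
  fps_subst y f = fps_subst y' f.
Proof.
move=> yy; apply/fpsP => a /=; rewrite !mmap_trunc; congr (_ @c _).
apply: eq_bigr => k _; have [->|fk] := eqVneq (f @c k) 0; first by rewrite !scale0r.
congr (_ *: _); apply: eq_bigr => i _; have [->|ki] := posnP (k i); first by rewrite !expr0.
by rewrite (yy k).
Qed.

(** * Convergent power series *)

Lemma fin_bound (I : finType) (P : I -> nat -> Prop) :
  (forall i a b, (a <= b)%N -> P i a -> P i b) ->
  (forall i, exists a, P i a) -> exists a, forall i, P i a.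
Proof.
move=> Pmon /choice[a Pa]; exists (\max_i a i)%N => i.
by apply: Pmon (Pa i); exact: leq_bigmax.
Qed.

Lemma inv_succ_le (R : realType) (x : R) : 0 < x -> exists N, N.+1%:R^-1 <= x.
Proof.
move=> x0; exists (Num.bound x^-1); rewrite -[leRHS]invrK lef_pV2 ?posrE ?invr_gt0 //.
rewrite -natr1 (le_trans (ltW (archi_boundP _))) ?invr_ge0 ?(ltW x0) //.
by rewrite lerDl.
Qed.

Lemma inv_succ_gt0 (R : realType) N : 0 < N.+1%:R^-1 :> R.
Proof. by rewrite invr_gt0. Qed.

Section Cps.
Variables (R : realType) (K : fieldType) (v : absval R K).
Local Notation B := (cps v).

Section OneRing.
Variable n : nat.
Implicit Types (f g h : B n) (m : 'X_{1..n}) (d : nat).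

Lemma cpsP f g : (forall m, f @c m = g @c m) -> f = g.
Proof. by move=> fg; apply/val_inj/fpsP. Qed.
Lemma cps_fpsD f g : fps_of_cps (f + g) = fps_of_cps f + fps_of_cps g.
Proof. by []. Qed.
Lemma cps_fpsB f g : fps_of_cps (f - g) = fps_of_cps f - fps_of_cps g.
Proof. by []. Qed.
Lemma cps_fpsM f g : fps_of_cps (f * g) = fps_of_cps f * fps_of_cps g.
Proof. by []. Qed.
Lemma cps_fpsZ c f : fps_of_cps (c *: f) = c *: fps_of_cps f. Proof. by []. Qed.
Lemma cps_fps0 : fps_of_cps (0 : B n) = 0. Proof. by []. Qed.
Lemma cps_fps1 : fps_of_cps (1 : B n) = 1. Proof. by []. Qed.
Lemma cps_fps_sum I (r : seq I) (P : pred I) (F : I -> B n) :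
  fps_of_cps (\sum_(i <- r | P i) F i) = \sum_(i <- r | P i) fps_of_cps (F i).
Proof. by elim/big_rec2: _ => // i x y _ <-. Qed.
Lemma cps_fpsX (i : 'I_n) : fps_of_cps (cps_var v i) = fpsX K i. Proof. by []. Qed.
Lemma cps_fps_deriv i f : fps_of_cps (cps_deriv i f) = fps_deriv i f.
Proof. by []. Qed.

Lemma cps_norm_le f : exists2 r, 0 < r & exists M, norm_le v r M f.
Proof. by apply/convergent_norm_le; case: f => f /= /asboolP. Qed.

Lemma norm_le_cps r M (f : fps n K) : 0 < r -> norm_le v r M f ->
  exists2 g : B n, fps_of_cps g = f & True.
Proof.
move=> r0 fM; suff /asboolP cf : convergent v f by exists (CPS cf).
by apply/convergent_norm_le; exists r => //; exists M.
Qed.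

Lemma small_cps f (eps : R) : ordge 1 f -> 0 < eps ->
  exists N, forall r, 0 < r -> r <= N.+1%:R^-1 -> norm_le v r eps f.
Proof.
move=> f1 e0; have [s s0 [M fM]] := cps_norm_le f.
have M0 := norm_le_ge0 fM.
have x0 : 0 < Order.min s (eps * s / (M + 1)).
  by rewrite lt_min s0 divr_gt0 ?mulr_gt0 ?ltr_wpDl.
have [N Nx] := inv_succ_le x0; exists N => r r0 rN.
have := le_trans rN Nx; rewrite le_min => /andP[rs re].
apply: norm_leW (norm_le_small s0 (ltW r0) rs f1 fM).
rewrite mulrAC ler_pdivrMr //.
apply: (@le_trans _ _ (r * (M + 1))); first by rewrite ler_pM2l // lerDl.
by rewrite -ler_pdivlMr // ltr_wpDl.
Qed.

Lemma small_fam (I : finType) (y : I -> B n) (eps : R) :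
  (forall i, ordge 1 (y i)) -> 0 < eps ->
  exists N, forall r, 0 < r -> r <= N.+1%:R^-1 -> forall i, norm_le v r eps (y i).
Proof.
move=> y1 e0.
pose P i N := forall r, 0 < r -> r <= N.+1%:R^-1 -> norm_le v r eps (y i).
have [||N PN] := @fin_bound I P.
- move=> i a b ab Pa r r0 rb; apply: Pa => //; apply: le_trans rb _.
  by rewrite lef_pV2 ?posrE // ler_nat.
- by move=> i; exact: small_cps.
- by exists N => r r0 rN i; exact: PN.
Qed.

Lemma cps_derivD i f g : cps_deriv i (f + g) = cps_deriv i f + cps_deriv i g.
Proof. by apply: val_inj; exact: fps_derivD. Qed.
Lemma cps_derivZ i c f : cps_deriv i (c *: f) = c *: cps_deriv i f.
Proof. by apply: val_inj; exact: fps_derivZ. Qed.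
Lemma cps_derivM i f g : cps_deriv i (f * g) = cps_deriv i f * g + f * cps_deriv i g.
Proof. by apply: val_inj; exact: fps_derivM. Qed.
Lemma cps_derivX (i j : 'I_n) : cps_deriv i (cps_var v j) = (i == j)%:R.
Proof. by apply: val_inj => /=; rewrite fps_derivX; case: eqP. Qed.
Lemma cps_derivC i c : cps_deriv i (c%:A : B n) = 0.
Proof. by apply: val_inj; exact: fps_derivC. Qed.
Lemma cps_deriv_comm i j f : cps_deriv i (cps_deriv j f) = cps_deriv j (cps_deriv i f).
Proof. by apply: val_inj; exact: fps_deriv_comm. Qed.
Lemma cps_derivB i f g : cps_deriv i (f - g) = cps_deriv i f - cps_deriv i g.
Proof. by rewrite -scaleN1r cps_derivD cps_derivZ scaleN1r. Qed.
Lemma cps_deriv0 i : cps_deriv i (0 : B n) = 0.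
Proof. by have := cps_derivZ i 0 0; rewrite !scale0r. Qed.
Lemma cps_deriv_sum i I (r : seq I) (P : pred I) (F : I -> B n) :
  cps_deriv i (\sum_(j <- r | P j) F j) = \sum_(j <- r | P j) cps_deriv i (F j).
Proof.
elim/big_rec2: _ => [|j x y _ <-]; first exact: cps_deriv0.
exact: cps_derivD.
Qed.

(* Each monomial meeting [S] is charged to its smallest variable in [S]. *)
Lemma hadamard (S : {pred 'I_n}) f :
  (forall m, (forall i, i \in S -> m i = 0%N) -> f @c m = 0) ->
  exists2 h : 'I_n -> B n, f = \sum_(i in S) cps_var v i * h i &
    forall d, ordge d.+1 f -> forall i, ordge d (h i).
Proof.
move=> fS.
pose q (i : 'I_n) : fps n K := FPS (fun a =>
  if [forall j in S, (j < i)%N ==> (a j == 0%N)] then f @c (a + U_(i))%MM else 0).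
have [r r0 [M fM]] := cps_norm_le f.
have rX j : 0 <= r ^+ j by rewrite exprn_ge0 // ltW.
have qM i : norm_le v r (r^-1 * M) (q i).
  move=> d; apply: le_trans (ler_wpM2l _ (fM d.+1)); last by rewrite invr_ge0 ltW.
  pose a m := v (f @c m) * r ^+ mdeg m.
  have a0 m : 0 <= a m by rewrite mulr_ge0 ?absval_ge0.
  apply: (@le_trans _ _ (r^-1 * \sum_(m : 'X_{1..n < d}) a (m + U_(i))%MM)).
    rewrite mulr_sumr; apply: ler_sum => m _.
    rewrite /a mdegD mdeg1 addn1 exprS (mulrCA _ r) mulKf ?gt_eqF // /=.
    by case: ifP => _; rewrite ?absval0 ?mul0r ?mulr_ge0 ?absval_ge0.
  rewrite ler_wpM2l ?invr_ge0 ?(ltW r0) //.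
  rewrite -[leLHS](@big_image _ _ _ _ _ (fun m : 'X_{1..n < d} => (m + U_(i))%MM)
                    predT a) /=.
  apply: sum_bmultinom_le => //.
    by rewrite map_inj_uniq ?enum_uniq // => m1 m2 /addIm/val_inj.
  by move=> _ /fintype.imageP[m _ ->]; rewrite mdegD mdeg1 addn1 ltnS bmdeg.
have /choice[h hq] : forall i, exists g : B n, fps_of_cps g = q i.
  by move=> i; have [g gq _] := norm_le_cps r0 (qM i); exists g.
exists h => [|d fd i m md]; last first.
  rewrite hq /=; case: ifP => // _; apply: fd.
  by rewrite mdegD mdeg1 addn1.
apply: cpsP => m; rewrite cps_fps_sum fcoef_sum.
have E i : (cps_var v i * h i) @c m =
    if (0 < m i)%N then (q i) @c (m - U_(i))%MM else 0.
  by rewrite cps_fpsM hq; exact: fcoefXM.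
under eq_bigr do rewrite E.
have [noS|] := boolP [forall i in S, m i == 0%N].
  rewrite fS; last by move=> i iS; apply/eqP; exact: (forall_inP noS).
  by rewrite big1 // => i /(forall_inP noS) /eqP ->.
rewrite negb_forall_in => /exists_inP[i0 i0S mi0].
pose Q (i : 'I_n) := (i \in S) && (m i != 0%N).
have Qi0 : Q i0 by rewrite /Q i0S mi0.
case: (arg_minnP (fun i : 'I_n => nat_of_ord i) Qi0) => i /andP[iS mi] imin.
rewrite (bigD1 i) //= lt0n mi big1 ?addr0.
  rewrite ifT.
    rewrite submK //; apply/mnm_lepP => j; rewrite mnm1E.
    by case: eqP => // <-; rewrite lt0n.
  apply/forall_inP => j jS; apply/implyP => ji; rewrite mnmBE mnm1E.
  rewrite subn_eq0; apply: contraTT ji => mj; rewrite -leqNgt; apply: imin.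
  rewrite /Q jS -lt0n; case: (m j) mj => //.
move=> j /andP[jS ji]; case: ifP => // mj; rewrite ifF //.
apply/negbTE; rewrite negb_forall_in; apply/exists_inP; exists i => //.
have ij : (i <= j)%N by apply: imin; rewrite /Q jS -lt0n.
rewrite negb_imply ltn_neqAle ij andbT mnmBE mnm1E (negbTE ji) subn0 mi andbT.
by rewrite eq_sym (inj_eq val_inj).
Qed.

Lemma hadamard1 f : ordge 1 f ->
  exists2 h : 'I_n -> B n, f = \sum_i cps_var v i * h i &
    forall d, ordge d.+1 f -> forall i, ordge d (h i).
Proof.
move=> f1; case: (@hadamard predT f) => [m m0|h -> hd]; last by exists h.
suff -> : m = 0%MM by apply: f1; rewrite mdeg0.
by apply/mnmP => i; rewrite mnm0E m0.
Qed.

Lemma ordge_const f : ordge 1 (f - (f @c 0%MM)%:A).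
Proof. by apply/ordge1P; rewrite cps_fpsB fcoefB cps_fpsZ cps_fps1 fcoefC eqxx subrr. Qed.

Lemma ordge_cpsX (i : 'I_n) : ordge 1 (cps_var v i). Proof. exact: ordgeX1. Qed.

End OneRing.

Section Hom.
Variables (n p : nat).

Definition lochom (phi : B n -> B p) := forall i, ordge 1 (phi (cps_var v i)).

(** Continuity of an abstract algebra morphism is derived here: each use of [hadamard1] trades one
    order of f for a factor [phi (x_i)] of order one. *)
Lemma ordge_hom (phi : {lrmorphism B n -> B p}) d (f : B n) :
  lochom phi -> ordge d f -> ordge d (phi f).
Proof.
move=> phi1; elim: d f => [f _|d IH f fd]; first exact: ordge0.
have [h fh hd] := hadamard1 (ordgeW (ltn0Sn d) fd); rewrite fh.
rewrite rmorph_sum cps_fps_sum; apply: ordge_sum => i _.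
rewrite rmorphM; apply: (@ordgeM _ _ 1 d); [exact: phi1|exact: IH (hd _ fd i)].
Qed.

Lemma hom_cong (phi psi : {lrmorphism B n -> B p}) d (f : B n) : lochom psi ->
  (forall i, ordge d (phi (cps_var v i) - psi (cps_var v i))) ->
  ordge d (phi f - psi f).
Proof.
move=> psi1 eX; suff H e g : (e <= d)%N -> ordge e (phi g - psi g) by exact: H.
elim: e g => [g _|e IH g ed]; first exact: ordge0.
have [h gh _] := hadamard1 (@ordge_const _ g).
have -> : g = (g @c 0%MM)%:A + \sum_i cps_var v i * h i by rewrite -gh addrC subrK.
rewrite !rmorphD /= !rmorph_alg opprD addrACA subrr add0r !rmorph_sum !cps_fps_sum -sumrB.
apply: ordge_sum => i _; rewrite !rmorphM /=.
set a := fps_of_cps (phi _); set b := fps_of_cps (psi _).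
rewrite -[a](subrK b) mulrDl -addrA -mulrBr; apply: ordgeD.
  by apply: ordgeMr; apply: ordgeW ed (eX i).
by apply: (@ordgeM _ _ 1 e); [exact: psi1|exact/IH/ltnW].
Qed.

Lemma hom_eq (phi psi : {lrmorphism B n -> B p}) :
  lochom psi -> (forall i, phi (cps_var v i) = psi (cps_var v i)) -> phi =1 psi.
Proof.
move=> psi1 eX f; apply/val_inj/ordge_eq => d.
by apply: hom_cong => // i; rewrite eX subrr; exact: ordge_zero.
Qed.

(** The defect [D] of the formula is a derivation along [phi] that kills constants and coordinates.
    Expanding its argument by [hadamard1] repeatedly pushes its value into every power of the
    maximal ideal. *)
Lemma chain_rule (phi : {lrmorphism B n -> B p}) j (f : B n) : lochom phi ->
  cps_deriv j (phi f) =
  \sum_l phi (cps_deriv l f) * cps_deriv j (phi (cps_var v l)).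
Proof.
move=> phi1; pose D g := cps_deriv j (phi g) -
  \sum_l phi (cps_deriv l g) * cps_deriv j (phi (cps_var v l)).
suff /eqP : D f = 0 by rewrite subr_eq0 => /eqP.
have DD g h : D (g + h) = D g + D h.
  rewrite /D rmorphD cps_derivD addrACA -opprD -big_split /=; congr (_ - _).
  by apply: eq_bigr => l _; rewrite cps_derivD rmorphD mulrDl.
have DM g h : D (g * h) = D g * phi h + phi g * D h.
  rewrite /D rmorphM cps_derivM mulrBl mulrBr addrACA -opprD; congr (_ - _).
  rewrite mulr_suml mulr_sumr -big_split /=; apply: eq_bigr => l _.
  rewrite cps_derivM rmorphD !rmorphM mulrDl /=.
  by congr (_ + _); [exact: mulrAC|rewrite mulrA].
have DX i : D (cps_var v i) = 0.
  rewrite /D (bigD1 i) //= cps_derivX eqxx rmorph1 mul1r big1 ?addr0 ?subrr //.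
  by move=> l li; rewrite cps_derivX (negbTE li) rmorph0 mul0r.
have DC c : D c%:A = 0.
  rewrite /D rmorph_alg cps_derivC big1 ?subrr // => l _.
  by rewrite cps_derivC rmorph0 mul0r.
have Dsum (h : 'I_n -> B n) : D (\sum_i h i) = \sum_i D (h i).
  elim/big_rec2: _ => [|i a b _ <-]; last exact: DD.
  by have := DC 0; rewrite scale0r.
suff Dd d g : ordge d (D g) by apply/val_inj/ordge_eq0 => d; exact: Dd.
elim: d g => [g|d IH g]; first exact: ordge0.
have [h gh _] := hadamard1 (@ordge_const _ g).
have -> : g = (g @c 0%MM)%:A + \sum_i cps_var v i * h i by rewrite -gh addrC subrK.
rewrite DD DC add0r Dsum cps_fps_sum; apply: ordge_sum => i _.
by rewrite DM DX mul0r add0r; apply: (@ordgeM _ _ 1 d); [exact: phi1|exact: IH].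
Qed.

(** Bundling the vanishing at the origin with the family lets [cps_subst y] be total and carry the
    structure of an algebra morphism. *)
Record locfam := LocFam {
  locfam_fun :> 'I_n -> B p; locfamP : forall i, ordge 1 (locfam_fun i) }.

Variable y : locfam.

Lemma cps_subst_subproof (f : B n) :
  convergent_pred v (fps_subst (fun i => y i) f).
Proof.
apply/asboolP/convergent_norm_le; have [s s0 [M fM]] := cps_norm_le f.
have [N yN] := small_fam (@locfamP y) s0.
exists N.+1%:R^-1; first exact: inv_succ_gt0.
exists M; apply: norm_le_subst fM => [|| i].
- by move=> i; exact: locfamP.
- exact/ltW/inv_succ_gt0.
- by apply: yN => //; exact: inv_succ_gt0.
Qed.
Definition cps_subst (f : B n) : B p := CPS (cps_subst_subproof f).

Lemma cps_substE f : fps_of_cps (cps_subst f) = fps_subst (fun i => y i) f.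
Proof. by []. Qed.

Let y1 := @locfamP y.

Lemma cps_subst_is_linear : linear cps_subst.
Proof.
by move=> c f g; apply: val_inj => /=; rewrite fps_substD ?fps_substZ.
Qed.
HB.instance Definition _ :=
  GRing.isLinear.Build K (B n) (B p) _ cps_subst cps_subst_is_linear.
Lemma cps_subst_is_monoid_morphism : monoid_morphism cps_subst.
Proof.
by split=> [|f g]; apply: val_inj => /=; rewrite ?fps_subst1 ?fps_substM.
Qed.
HB.instance Definition _ :=
  GRing.isMonoidMorphism.Build (B n) (B p) cps_subst cps_subst_is_monoid_morphism.

Lemma cps_substX i : cps_subst (cps_var v i) = y i.
Proof. by apply: val_inj => /=; rewrite fps_substX. Qed.

Lemma cps_subst_loc : lochom cps_subst.
Proof. by move=> i; rewrite cps_substX. Qed.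

End Hom.
End Cps.

(** * Analytic operators and a fixed point theorem *)

Section AnalyticOperators.
Variables (R : realType) (K : fieldType) (v : absval R K) (n : nat) (I : finType).
Local Notation B := (cps v).
Implicit Types (u : I -> B n) (G : (I -> B n) -> B n) (N : nat) (M : R).

Definition in_max u := forall i, ordge 1 (u i).
(** Agreement to order d is only preserved, not improved; the strict gain comes from the quadratic
    factor in [fixed_point]. *)
Definition contracting G := forall d u u', in_max u -> in_max u' ->
  (forall i, ordge d (u i - u' i)) -> ordge d (G u - G u').
(** The single index N limits both the radius and the size of the argument, so finitely many
    operators get a common index by enlarging it. *)
Definition bounded_op N M G := forall r u, 0 < r -> r <= N.+1%:R^-1 -> in_max u ->
  (forall i, norm_le v r N.+1%:R^-1 (u i)) -> norm_le v r M (G u).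
Definition analytic_op G := contracting G /\ exists N, bounded_op N N.+1%:R G.
(** These are the operators that may be substituted into a convergent series: near the origin their
    values fall below its radius of convergence. *)
Definition small_op G := [/\ contracting G, forall u, in_max u -> ordge 1 (G u) &
  forall eps, 0 < eps -> exists N, bounded_op N eps G].

Lemma inv_succ_mono N N' : (N <= N')%N -> N'.+1%:R^-1 <= N.+1%:R^-1 :> R.
Proof. by move=> NN; rewrite lef_pV2 ?posrE // ler_nat. Qed.

Lemma bounded_opW N N' M M' G : (N <= N')%N -> M <= M' -> bounded_op N M G -> bounded_op N' M' G.
Proof.
move=> NN MM GN r u r0 rN u1 uN; apply: norm_leW MM _; apply: GN => //.
  exact: le_trans (inv_succ_mono NN).
by move=> i; apply: norm_leW (uN i); exact: inv_succ_mono.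
Qed.

Lemma nat_ge (x : R) : exists N, x <= N.+1%:R.
Proof.
exists (Num.bound `|x|); apply: le_trans (ler_norm x) _.
by rewrite -natr1 (le_trans (ltW (archi_boundP _))) // lerDl.
Qed.

Lemma analytic_opI N M G : contracting G -> bounded_op N M G -> analytic_op G.
Proof.
move=> cG GN; split=> //; have [N' MN'] := nat_ge M.
exists (N + N')%N; apply: bounded_opW GN; rewrite ?leq_addr //.
by apply: le_trans MN' _; rewrite ler_nat ltnS leq_addl.
Qed.

Lemma small_op_analytic G : small_op G -> analytic_op G.
Proof. by case=> cG _ /(_ 1 ltr01)[N GN]; exact: analytic_opI GN. Qed.

Lemma analytic_op_const (c : B n) : analytic_op (fun=> c).
Proof.
have [s s0 [M cM]] := cps_norm_le c; have [N Ns] := inv_succ_le s0.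
apply: (@analytic_opI N M) => [d u u' _ _ _|r u r0 rN _ _].
  by rewrite subrr; exact: ordge_zero.
by apply: norm_le_shrink cM; [exact: ltW|exact: le_trans Ns].
Qed.

Lemma small_op_const (c : B n) : ordge 1 c -> small_op (fun=> c).
Proof.
move=> c1; split=> [d u u' _ _ _|//|eps e0].
  by rewrite subrr; exact: ordge_zero.
by have [N cN] := small_cps c1 e0; exists N => r u r0 rN _ _; exact: cN.
Qed.

Lemma small_op_proj i : small_op (fun u => u i).
Proof.
split=> [d u u' _ _ uu|u u1|eps e0]; [exact: uu|exact: u1|].
have [N Ne] := inv_succ_le e0; exists N => r u _ _ _ uN.
exact: norm_leW Ne (uN i).
Qed.

Lemma contracting_add G H : contracting G -> contracting H -> contracting (fun u => G u + H u).
Proof.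
move=> cG cH d u u' u1 u1' uu; rewrite opprD addrACA.
by apply: ordgeD; [exact: cG|exact: cH].
Qed.

Lemma contracting_mul G H : contracting G -> contracting H -> contracting (fun u => G u * H u).
Proof.
move=> cG cH d u u' u1 u1' uu.
by apply: (@ordge_mulB _ _ d (G u) (G u') (H u) (H u')); [exact: cG|exact: cH].
Qed.

Lemma analytic_op_add G H : analytic_op G -> analytic_op H -> analytic_op (fun u => G u + H u).
Proof.
move=> [cG [N GN]] [cH [N' HN]].
apply: (@analytic_opI (N + N') (N.+1%:R + N'.+1%:R)); first exact: contracting_add.
move=> r u r0 rN u1 uN; apply: norm_leD; first exact: ltW.
  by apply: (bounded_opW (leq_addr N' N) (lexx _) GN).
by apply: (bounded_opW (leq_addl N N') (lexx _) HN).
Qed.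

Lemma analytic_op_mul G H : analytic_op G -> analytic_op H -> analytic_op (fun u => G u * H u).
Proof.
move=> [cG [N GN]] [cH [N' HN]].
apply: (@analytic_opI (N + N') (N.+1%:R * N'.+1%:R)); first exact: contracting_mul.
move=> r u r0 rN u1 uN; apply: norm_leM; first exact: ltW.
  by apply: (bounded_opW (leq_addr N' N) (lexx _) GN).
by apply: (bounded_opW (leq_addl N N') (lexx _) HN).
Qed.

Lemma small_op_add G H : small_op G -> small_op H -> small_op (fun u => G u + H u).
Proof.
move=> [cG G1 GN] [cH H1 HN]; split; first exact: contracting_add.
  by move=> u u1; apply: ordgeD; [exact: G1|exact: H1].
move=> eps e0; have e2 : 0 < eps / 2 by rewrite divr_gt0.
have [N {}GN] := GN _ e2; have [N' {}HN] := HN _ e2.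
exists (N + N')%N => r u r0 rN u1 uN; rewrite [eps]splitr; apply: norm_leD; first exact: ltW.
  by apply: (bounded_opW (leq_addr N' N) (lexx _) GN).
by apply: (bounded_opW (leq_addl N N') (lexx _) HN).
Qed.

Lemma small_op_mul G H : small_op G -> analytic_op H -> small_op (fun u => G u * H u).
Proof.
move=> [cG G1 GN] [cH [N' HN]]; split; first exact: contracting_mul.
  by move=> u u1; apply: ordgeMr; exact: G1.
move=> eps e0; have e2 : 0 < eps / N'.+1%:R by rewrite divr_gt0.
have [N {}GN] := GN _ e2.
exists (N + N')%N => r u r0 rN u1 uN.
have -> : eps = eps / N'.+1%:R * N'.+1%:R by rewrite divfK ?pnatr_eq0.
apply: norm_leM; first exact: ltW.
  by apply: (bounded_opW (leq_addr N' N) (lexx _) GN).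
by apply: (bounded_opW (leq_addl N N') (lexx _) HN).
Qed.

Lemma analytic_op_sum J (s : seq J) (G : J -> (I -> B n) -> B n) :
  (forall j, analytic_op (G j)) -> analytic_op (fun u => \sum_(j <- s) G j u).
Proof.
move=> Ga; elim: s => [|j s IH].
  under [fun u => _]eq_fun do rewrite big_nil; exact: analytic_op_const.
under [fun u => _]eq_fun do rewrite big_cons; exact: analytic_op_add.
Qed.

Lemma small_op_sum J (s : seq J) (G : J -> (I -> B n) -> B n) :
  (forall j, small_op (G j)) -> small_op (fun u => \sum_(j <- s) G j u).
Proof.
move=> Ga; elim: s => [|j s IH].
  under [fun u => _]eq_fun do rewrite big_nil.
  by apply: small_op_const; exact: ordge_zero.
under [fun u => _]eq_fun do rewrite big_cons; exact: small_op_add.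
Qed.

(** The default 0 makes substitution total in [y], as an operator has to be defined on every family
    [u]. *)
Definition tsubst p (y : 'I_p -> B n) (f : B p) : B n :=
  if pselect (forall i, ordge 1 (y i)) is left y1 then cps_subst (LocFam y1) f
  else 0.

Lemma tsubstE p (y : locfam v p n) f : tsubst y f = cps_subst y f.
Proof.
rewrite /tsubst; case: pselect => [y1|/(_ (@locfamP _ _ _ _ _ y)) //].
exact: val_inj.
Qed.

Lemma tsubst_fam p (y : 'I_p -> B n) f (y1 : forall i, ordge 1 (y i)) :
  tsubst y f = cps_subst (LocFam y1) f.
Proof. exact: (tsubstE (LocFam y1)). Qed.

Lemma cps_subst_cong p (y y' : locfam v p n) d (f : B p) :
  (forall i, ordge d (y i - y' i)) -> ordge d (cps_subst y f - cps_subst y' f).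
Proof.
move=> yy; apply: (@hom_cong _ _ _ _ _ (cps_subst y) (cps_subst y')) => [|i].
  exact: cps_subst_loc.
by have := yy i; rewrite -(cps_substX y) -(cps_substX y').
Qed.

Lemma analytic_op_subst p (Y : 'I_p -> (I -> B n) -> B n) (f : B p) :
  (forall j, small_op (Y j)) -> analytic_op (fun u => tsubst (fun j => Y j u) f).
Proof.
move=> Ys; have [s s0 [M fM]] := cps_norm_le f.
pose P j N := bounded_op N s (Y j).
have Y1 u : in_max u -> forall j, ordge 1 (Y j u).
  by move=> u1 j; case: (Ys j) => _ H _; exact: H.
have [||N PN] := @fin_bound _ P.
- by move=> j a b ab; exact: bounded_opW.
- by move=> j; case: (Ys j) => _ _ H; exact: H.
apply: (@analytic_opI N M) => [d u u' u1 u1' uu|r u r0 rN u1 uN].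
  rewrite (tsubst_fam f (Y1 _ u1)) (tsubst_fam f (Y1 _ u1')).
  by apply: cps_subst_cong => j; case: (Ys j) => H _ _; exact: H.
rewrite (tsubst_fam f (Y1 _ u1)) cps_substE.
apply: norm_le_subst fM => [j||j]; [exact: Y1|exact: ltW|exact: PN].
Qed.

Section FixedPoint.
Variables (A : I -> B n) (G : I -> I -> I -> (I -> B n) -> B n).
Hypothesis A1 : forall a, ordge 1 (A a).
Hypothesis Ga : forall a b c, analytic_op (G a b c).

Let T u a := A a + \sum_b \sum_c u b * u c * G a b c u.

Let T1 u : in_max u -> in_max (T u).
Proof.
move=> u1 a; rewrite /T cps_fpsD; apply: ordgeD => //; rewrite cps_fps_sum; apply: ordge_sum => b _.
rewrite cps_fps_sum; apply: ordge_sum => c _.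
by rewrite !cps_fpsM; apply: ordgeMr; apply: ordgeMr.
Qed.

Let Tc d u u' : in_max u -> in_max u' -> (forall i, ordge d (u i - u' i)) ->
  forall i, ordge d.+1 (T u i - T u' i).
Proof.
move=> u1 u1' uu a; rewrite /T opprD addrACA subrr add0r -sumrB.
rewrite cps_fps_sum; apply: ordge_sum => b _; rewrite -sumrB cps_fps_sum.
apply: ordge_sum => c _; set g := G a b c u; set g' := G a b c u'.
have gg : ordge d (g - g') by case: (Ga a b c) => cG _; exact: cG.
have -> : u b * u c * g - u' b * u' c * g' =
    u b * ((u c - u' c) * g) + (u' c * ((u b - u' b) * g) + u' b * (u' c * (g - g'))).
  by ring.
apply: ordgeD; first by apply: (@ordgeM _ _ 1 d); [exact: u1|exact/ordgeMr/uu].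
apply: ordgeD; first by apply: (@ordgeM _ _ 1 d); [exact: u1'|exact/ordgeMr/uu].
by apply: (@ordgeM _ _ 1 d); [exact: u1'|exact/ordgeMl].
Qed.

(** Since [T] is affine plus quadratic and its arguments vanish at the origin, it improves agreement
    by one order: the iterates from 0 stabilize coefficient by coefficient. At a small radius they
    stay in a norm ball, so the limit converges. *)
Theorem fixed_point : exists2 u, in_max u & forall a, u a = T u a.
Proof.
have [||N GN] := @fin_bound _ (fun t N => bounded_op N N.+1%:R (G t.1.1 t.1.2 t.2)).
- by move=> t a b ab; apply: bounded_opW => //; rewrite ler_nat.
- by move=> [[a b] c]; case: (Ga a b c).
(* With rho = 1/(N'+1), the q^2 quadratic terms have total norm at most q^2 rho^2 (N+1) <= rho/2;
   the other half of rho is left for [A]. The summand N gives N <= N'. *)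
pose q := #|I|; pose N' := (2 * (q * q) * N.+1 + N)%N.
pose rho : R := N'.+1%:R^-1; have rho0 : 0 < rho by exact: inv_succ_gt0.
have rho2 : 0 < rho / 2 by rewrite divr_gt0.
have [N2 AN] := small_fam A1 rho2.
pose r : R := (maxn N' N2).+1%:R^-1; have r0 : 0 < r by exact: inv_succ_gt0.
have rN' : r <= rho by apply: inv_succ_mono; exact: leq_maxl.
have NN' : (N <= N')%N by exact: leq_addl.
have Tn u : in_max u -> (forall i, norm_le v r rho (u i)) -> forall i, norm_le v r rho (T u i).
  move=> u1 un a; rewrite /T cps_fpsD [X in norm_le v r X]splitr; apply: norm_leD; first exact: ltW.
    by apply: AN => //; apply: inv_succ_mono; exact: leq_maxr.
  apply: (@norm_leW _ _ _ _ _ (\sum_(b : I) \sum_(c : I) (rho * rho * N.+1%:R))).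
    rewrite !sumr_const -/q -mulrnA -[leLHS]mulr_natr -!mulrA ler_pM2l //.
    rewrite /rho mulrC ler_pdivrMr // [leRHS]mulrC ler_pdivlMr // -!natrM ler_nat.
    by rewrite ltnW // ltnS /N' mulnC (mulnC N.+1) mulnA leq_addr.
  rewrite cps_fps_sum; apply: norm_le_sum => [|b _]; first exact: ltW.
  rewrite cps_fps_sum; apply: norm_le_sum => [|c _]; first exact: ltW.
  rewrite !cps_fpsM; apply: norm_leM; [exact: ltW| |].
    by apply: norm_leM; [exact: ltW|exact: un|exact: un].
  exact: (bounded_opW NN' (lexx _) (GN (a, b, c))).
pose U k := iter k T (fun=> 0).
have U1 k : in_max (U k) by elim: k => [i|k IH]; [exact: ordge_zero|exact: T1].
have Un k i : norm_le v r rho (U k i).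
  elim: k i => [i|k IH i]; last exact: Tn.
  by apply: norm_leW (ltW rho0) _; exact: norm_le0.
have UU k i : ordge k.+1 (U k.+1 i - U k i).
  elim: k i => [i|k IH i]; last exact: (Tc (U1 k.+1) (U1 k) IH).
  by apply: ordgeB; [exact: U1|exact: ordge_zero].
have Uk k j i : ordge k.+1 (U (k + j)%N i - U k i).
  elim: j => [|j IH]; first by rewrite addn0 subrr; exact: ordge_zero.
  apply: ordge_trans IH; rewrite addnS; apply: ordgeW (UU _ i).
  by rewrite ltnS leq_addr.
(* By [Uk] the iterate k is final below order k+1, so iterate number |m| already has the final
   coefficient at m. *)
pose L i : fps n K := FPS (fun m => (U (mdeg m) i) @c m).
have LU k i : ordge k.+1 (L i - U k i).
  apply/ordgeBP => m mk /=; apply/esym; move: (mk); rewrite ltnS => /subnKC <-.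
  move: (Uk (mdeg m) (k - mdeg m)%N i) => /ordgeBP; apply; exact: ltnSn.
have /choice[u uL] : forall i, exists g : B n, fps_of_cps g = L i.
  move=> i; have [|g gL _] := @norm_le_cps _ _ v n r rho (L i) r0; last by exists g.
  by apply: norm_le_approx => d; exists (U d i) => //; apply: ordgeW (LU d i).
have u1 : in_max u.
  move=> i; rewrite uL; have -> : L i = (L i - U 0%N i) + U 0%N i by rewrite subrK.
  by apply: ordgeD; [exact: LU|exact: U1].
exists u => // a; apply/val_inj/ordge_eq => d.
apply: (@ordge_trans _ _ d _ (U d a)).
  by rewrite /= uL; apply: ordgeW (LU d a).
case: d => [|d]; first exact: ordge0.
apply: ordge_sym; apply: Tc => // i; rewrite cps_fpsB uL.
exact: ordgeW (LU d i).
Qed.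

End FixedPoint.
End AnalyticOperators.

(** * Units and the inverse function theorem *)

Section InverseFunction.
Variables (R : realType) (K : fieldType) (v : absval R K) (n : nat).
Local Notation B := (cps v n).
Implicit Types (f g h : B).

Definition ev0 p (f : cps v p) : K := f @c 0%MM.

Lemma ev0_is_linear p : linear_for *%R (@ev0 p).
Proof. by []. Qed.
HB.instance Definition _ p :=
  GRing.isLinear.Build K (cps v p) K _ (@ev0 p) (@ev0_is_linear p).
Lemma ev0_is_monoid_morphism p : monoid_morphism (@ev0 p).
Proof.
by split=> [|f g]; rewrite /ev0 ?cps_fps1 ?fcoef1 ?eqxx // cps_fpsM fcoefM0.
Qed.
HB.instance Definition _ p :=
  GRing.isMonoidMorphism.Build (cps v p) K (@ev0 p) (@ev0_is_monoid_morphism p).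

Lemma ev0P p (f : cps v p) : ordge 1 f <-> ev0 f = 0.
Proof. exact: ordge1P. Qed.

Lemma ev0_alg p (c : K) : ev0 (c%:A : cps v p) = c.
Proof. by rewrite linearZ /= rmorph1 mulr1. Qed.

Lemma ev0_hom p q (phi : {lrmorphism cps v p -> cps v q}) (f : cps v p) :
  lochom phi -> ev0 (phi f) = ev0 f.
Proof.
move=> phi1; have := ordge_hom phi1 (@ordge_const _ _ _ _ f : ordge 1 (f - (ev0 f)%:A)).
move=> /(proj1 (ev0P _)); rewrite raddfB /= rmorph_alg raddfB /= ev0_alg.
by move/eqP; rewrite subr_eq0 => /eqP.
Qed.

(** After scaling, f = 1 + a, and the inverse is 1 + w with w = -a - a w. The term a w is linear in
    w; taking a itself as a second unknown ([u true = a], [u false = w]) gives the quadratic shape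
    of [fixed_point]. *)
Lemma cps_unitP f : ev0 f != 0 -> f \is a GRing.unit.
Proof.
set c := ev0 f => c0; pose a : B := c^-1 *: f - 1.
have a1 : ordge 1 a by apply/ev0P; rewrite raddfB /= linearZ /= mulVf // rmorph1 subrr.
pose A (b : bool) := if b then a else - a.
pose G (b b1 b2 : bool) (_ : bool -> B) : B := (if ~~ b && b1 && ~~ b2 then -1 else 0).
have [||u _ uE] := @fixed_point _ _ v _ _ A G.
- by case=> //; exact: ordgeN.
- by move=> b b1 b2; exact: analytic_op_const.
have ut : u true = a.
  by rewrite uE !big_bool /G /= !mulr0 !addr0.
have uf := uE false; rewrite !big_bool /G /= ut !mulr0 !addr0 !add0r in uf.
apply/unitrPr; exists (c^-1 *: (1 + u false)).
rewrite -scalerAr scalerAl.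
have -> : c^-1 *: f = 1 + a by rewrite addrC subrK.
rewrite mulrDr mulr1 mulrDl mul1r {1}uf; ring.
Qed.

Definition jac (y : 'I_n -> B) : 'M[K]_n :=
  \matrix_(i, l) ev0 (cps_deriv l (y i)).

Lemma jac_hom (phi : {lrmorphism B -> B}) (y : 'I_n -> B) : lochom phi ->
  jac (fun i => phi (y i)) = jac y *m jac (fun i => phi (cps_var v i)).
Proof.
move=> phi1; apply/matrixP => i l; rewrite !mxE chain_rule // raddf_sum.
by apply: eq_bigr => k _; rewrite !mxE /= rmorphM /= ev0_hom.
Qed.

Lemma jac_id : jac (cps_var v (n := n)) = 1%:M.
Proof.
apply/matrixP => i l; rewrite !mxE cps_derivX eq_sym.
by case: eqP => _; rewrite ?rmorph1 ?rmorph0.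
Qed.

Lemma ordge2P f : ordge 1 f -> (forall l, ev0 (cps_deriv l f) = 0) -> ordge 2 f.
Proof.
move=> f1 df m; rewrite ltnS leq_eqVlt => /orP[|]; last exact: f1.
move=> /mdeg1P[l /eqP ->]; have := df l.
by rewrite /ev0 cps_fps_deriv fcoef_deriv add0m mnm0E.
Qed.

Lemma quad_part f : ordge 2 f -> exists w : 'I_n -> 'I_n -> B,
  f = \sum_j \sum_k cps_var v j * cps_var v k * w j k.
Proof.
move=> f2; have [h fh hd] := hadamard1 (ordgeW (isT : (1 <= 2)%N) f2).
have /choice[w wh] : forall j, exists w : 'I_n -> B, h j = \sum_k cps_var v k * w k.
  by move=> j; have [w hw _] := hadamard1 (hd 1%N f2 j); exists w.
exists w; rewrite fh; apply: eq_bigr => j _; rewrite wh mulr_sumr.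
by apply: eq_bigr => k _; rewrite mulrA.
Qed.

(** Write y = J x + h with h of order two. Then y(z) = x reads z = L (x - h(z)) with L the inverse
    of J, and [quad_part] makes h(z) visibly quadratic in z. The second conclusion allows the lemma
    to be applied again to [z]. *)
Lemma inverse_fam (y : locfam v n n) : jac y \in unitmx ->
  exists z : locfam v n n, (forall i, cps_subst z (y i) = cps_var v i) /\
    jac z \in unitmx.
Proof.
move=> Ju; pose J := jac y; pose L := invmx J.
have y1 i : ordge 1 (y i) by exact: locfamP.
pose h i : B := y i - \sum_l (J i l) *: cps_var v l.
have h2 i : ordge 2 (h i).
  apply: ordge2P => [|l].
    rewrite /h cps_fpsB; apply: ordgeB => //; rewrite cps_fps_sum; apply: ordge_sum => l _.
    exact/ordgeZ/ordge_cpsX.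
  rewrite /h cps_derivB cps_deriv_sum raddfB raddf_sum /= (bigD1 l) //=.
  rewrite cps_derivZ linearZ /= cps_derivX eqxx rmorph1 mulr1 big1 ?addr0.
    by rewrite /J mxE subrr.
  move=> k kl; rewrite cps_derivZ linearZ /= cps_derivX eq_sym (negbTE kl).
  by rewrite rmorph0 mulr0.
have /choice[w hw] := fun i => quad_part (h2 i).
pose A a : B := \sum_i (L a i) *: cps_var v i.
pose G a j k (u : 'I_n -> B) : B := - \sum_i (L a i)%:A * tsubst u (w i j k).
have [||z z1 zE] := @fixed_point _ _ v _ _ A G.
- move=> a; rewrite cps_fps_sum; apply: ordge_sum => l _.
  exact/ordgeZ/ordge_cpsX.
- move=> a j k; rewrite /G.
  under [fun u => _]eq_fun do rewrite -mulN1r; apply: analytic_op_mul.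
    exact: analytic_op_const.
  apply: analytic_op_sum => i; apply: analytic_op_mul; first exact: analytic_op_const.
  by apply: (@analytic_op_subst _ _ _ _ _ _ (fun j u => u j)) => l; exact: small_op_proj.
pose Z := LocFam z1; pose S : {lrmorphism B -> B} := cps_subst Z.
have SX j : S (cps_var v j) = z j by exact: cps_substX.
pose q i := \sum_j \sum_k z j * z k * S (w i j k).
have Sh i : S (h i) = q i.
  rewrite hw rmorph_sum; apply: eq_bigr => j _; rewrite rmorph_sum.
  by apply: eq_bigr => k _; rewrite !rmorphM /= !SX.
have GE l j k : G l j k z = - \sum_i (L l i) *: S (w i j k).
  rewrite /G; congr (- _); apply: eq_bigr => i _.
  by rewrite (tsubst_fam _ z1) mulr_algl.
have zE' l : z l = \sum_i L l i *: (cps_var v i - q i).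
  rewrite zE; under [in RHS]eq_bigr do rewrite scalerBr.
  rewrite sumrB; congr (_ + _).
  under eq_bigr => j _ do under eq_bigr => k _ do
    rewrite GE mulrN mulr_sumr.
  under eq_bigr do rewrite sumrN.
  rewrite sumrN; congr (- _).
  under [RHS]eq_bigr do rewrite scaler_sumr.
  rewrite [RHS]exchange_big /=; apply: eq_bigr => j _.
  under [RHS]eq_bigr do rewrite scaler_sumr.
  rewrite [RHS]exchange_big /=; apply: eq_bigr => k _.
  by apply: eq_bigr => i _; rewrite -scalerAr.
have Sy i : S (y i) = cps_var v i.
  have -> : y i = \sum_l (J i l) *: cps_var v l + h i by rewrite addrC subrK.
  rewrite rmorphD rmorph_sum /= Sh.
  have -> : \sum_l S (J i l *: cps_var v l) = cps_var v i - q i; last by rewrite subrK.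
  under eq_bigr do rewrite linearZ /= SX zE' scaler_sumr.
  rewrite exchange_big /= (bigD1 i) //=.
  under eq_bigr do rewrite scalerA; rewrite -scaler_suml.
  have JL j : \sum_k J i k * L k j = (i == j)%:R.
    have /matrixP/(_ i j) := mulmxV Ju; rewrite !mxE => <-.
    by apply: eq_bigr => k _; rewrite !mxE.
  rewrite JL eqxx scale1r big1 ?addr0 // => j ji.
  by under eq_bigr do rewrite scalerA; rewrite -scaler_suml JL eq_sym (negbTE ji) scale0r.
exists Z; split => //.
have := @jac_hom S y (cps_subst_loc Z).
have -> : (fun i => S (y i)) = cps_var v (n := n) by apply/funext.
have -> : (fun i => S (cps_var v i)) = z by apply/funext.
by rewrite jac_id => /esym/mulmx1_unit[].
Qed.

(** [inverse_fam] gives an inverse on one side only. Applied to [z] it gives a [w] which must act as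
    [y], so the inverse is two-sided. *)
Lemma inverse_function (y : locfam v n n) : jac y \in unitmx ->
  exists z : locfam v n n, cancel (cps_subst y) (cps_subst z) /\
                           cancel (cps_subst z) (cps_subst y).
Proof.
have inv (y0 z0 : locfam v n n) : (forall i, cps_subst z0 (y0 i) = cps_var v i) ->
    cancel (cps_subst y0) (cps_subst z0).
  move=> zy; apply: (@hom_eq _ _ v n n (cps_subst z0 \o cps_subst y0) idfun) => [i|i].
    exact: (ordge_cpsX v i).
  by rewrite /= cps_substX zy.
move=> /inverse_fam[z [zy /inverse_fam[w [wz _]]]].
exists z; have yz := inv _ _ zy; split => // f.
by rewrite -[LHS](inv _ _ wz) yz (inv _ _ wz).
Qed.

End InverseFunction.

(** * Ideals, automorphisms and equivalences *)

Section GeneratedIdeals.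
Variable A : comNzRingType.
Implicit Types (S : set A) (I J : ideal A) (z : A).

Lemma ideal_genS S z : S z -> ideal_gen S z.
Proof. by move=> Sz I [_]; exact. Qed.

Lemma ideal_gen_min S (I : set A) : ideal_closed I -> (forall z, S z -> I z) ->
  forall z, ideal_gen S z -> I z.
Proof. by move=> cI SI z; apply; split. Qed.

Lemma memi0 I : I 0. Proof. by have [] := idealP I. Qed.
Lemma memiD I z z' : I z -> I z' -> I (z + z').
Proof. by have [_ H _] := idealP I; exact: H. Qed.
Lemma memiMl I a z : I z -> I (a * z).
Proof. by have [_ _ H] := idealP I; exact: H. Qed.
Lemma memiMr I a z : I z -> I (z * a).
Proof. by rewrite mulrC; exact: memiMl. Qed.
Lemma memiN I z : I z -> I (- z).
Proof. by rewrite -mulN1r; exact: memiMl. Qed.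
Lemma memiB I z z' : I z -> I z' -> I (z - z').
Proof. by move=> Iz Iz'; apply: memiD => //; exact: memiN. Qed.
Lemma memi_sum I T (r : seq T) (F : T -> A) :
  (forall i, I (F i)) -> I (\sum_(i <- r) F i).
Proof.
move=> IF; elim: r => [|i r IH]; first by rewrite big_nil; exact: memi0.
by rewrite big_cons; exact: memiD.
Qed.

Lemma ideal_mul_gen I J x y : I x -> J y -> ideal_mul I J (x * y).
Proof. by move=> Ix Jy; apply: ideal_genS; exists x, y. Qed.

End GeneratedIdeals.

Lemma big_optionE (V : nmodType) (I : finType) (F : option I -> V) :
  \sum_a F a = F None + \sum_i F (Some i).
Proof.
rewrite (bigD1 None) //= (reindex_omap Some id) => [|[]//].
by congr (_ + _); apply: eq_bigl => i /=; rewrite eqxx.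
Qed.

Section Ideals.
Variables (R : realType) (K : fieldType) (v : absval R K) (n : nat).
Local Notation B := (cps v n).
Implicit Types (f g h z : B) (e : bool) (k : nat).

Lemma ordge_ideal_closed k : ideal_closed [set h : B | ordge k h].
Proof.
split=> [|x y|a x]; [exact: ordge_zero|exact: ordgeD|exact: ordgeMl].
Qed.

Lemma max_idealP h : max_ideal v n h <-> ordge 1 h.
Proof.
split.
  apply: (@ideal_gen_min _ _ [set g : B | ordge 1 g]%classic); first exact: ordge_ideal_closed.
  by move=> _ [i _ <-]; exact: ordgeX1.
move=> h1; have [w -> _] := hadamard1 h1; apply: memi_sum => i.
by apply: memiMr; apply: ideal_genS; exists i.
Qed.

Lemma max_ideal_expP k h : ideal_exp (max_ideal v n) k h <-> ordge k h.
Proof.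
elim: k h => [|k IH] h.
  split=> // _; rewrite -[h]mulr1; apply: memiMl; exact: ideal_genS.
split.
  apply: (@ideal_gen_min _ _ [set g : B | ordge k.+1 g]%classic); first exact: ordge_ideal_closed.
  move=> _ [x [y [/max_idealP x1 /IH yk ->]]]; exact: (@ordgeM _ _ 1 k).
move=> hk; have [w hw wk] := hadamard1 (ordgeW (ltn0Sn k) hk); rewrite hw.
apply: (@memi_sum _ (ideal_exp _ k.+1)) => i; apply: ideal_mul_gen.
  by apply: ideal_genS; exists i.
by apply/IH; exact: (wk k hk i).
Qed.

(* Contact equivalence ([e = true]) and right equivalence ([e = false]) are treated
   together: the generator [f] of the tangent ideal is replaced by [0] in the
   latter case. *)
Definition gens e f (a : option 'I_n) : B :=
  if a is Some i then cps_deriv i f else if e then f else 0.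

(** This is the ideal m^k j(f), with f added as a generator when [e] holds; the coefficient of f is
    not restricted. Explicit coefficients are kept because they become the components of a vector
    field. *)
Definition tangent e k f z := exists xi : option 'I_n -> B,
  (forall i, ordge k (xi (Some i))) /\ z = \sum_a xi a * gens e f a.

Lemma tangent_ideal_closed e k f : ideal_closed (tangent e k f).
Proof.
split=> [|x y [xi [xk ->]] [eta [yk ->]]|c x [xi [xk ->]]].
- exists (fun=> 0); split=> [i|]; first exact: ordge_zero.
  by rewrite big1 // => a _; rewrite mul0r.
- exists (fun a => xi a + eta a); split=> [i|]; first exact: (ordgeD (xk i) (yk i)).
  by rewrite -big_split /=; apply: eq_bigr => a _; rewrite mulrDl.
- exists (fun a => c * xi a); split=> [i|]; first exact: (ordgeMl _ (xk i)).
  by rewrite mulr_sumr; apply: eq_bigr => a _; rewrite mulrA.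
Qed.
Definition tangent_ideal e k f : ideal B := Ideal (@tangent_ideal_closed e k f).

Lemma tangent_gen e k f i (x : B) : ordge k x -> tangent e k f (x * cps_deriv i f).
Proof.
move=> xk; exists (fun a => if a == Some i then x else 0); split=> [j|].
  by case: eqP => // _; exact: ordge_zero.
by rewrite (bigD1 (Some i)) //= eqxx big1 ?addr0 // => a /negbTE ->; rewrite mul0r.
Qed.
Lemma tangent_fun k f : tangent true k f f.
Proof.
exists (fun a => if a == None then 1 else 0); split=> [j|]; first exact: ordge_zero.
by rewrite (bigD1 None) //= mul1r big1 ?addr0 // => -[i|] //= _; rewrite mul0r.
Qed.
Lemma tangentP e k f (I : ideal B) :
  (e -> I f) -> (forall i (x : B), ordge k x -> I (x * cps_deriv i f)) ->
  forall z, tangent e k f z -> I z.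
Proof.
move=> If Id z [xi [xk ->]]; apply: memi_sum => -[i|] /=; first exact: Id.
by case: e If => [/(_ isT) If|_]; [exact: memiMl|rewrite mulr0; exact: memi0].
Qed.

Lemma jacobian_idealP f z : jacobian_ideal f z <-> tangent false 0 f z.
Proof.
split; last first.
  apply: tangentP => // i x _; apply: memiMl; apply: ideal_genS.
  by exists i.
apply: (@ideal_gen_min _ _ (tangent false 0 f)); first exact: tangent_ideal_closed.
by move=> _ [i _ <-]; rewrite -[cps_deriv _ _]mul1r; exact: tangent_gen.
Qed.

Lemma milnor_idealP k f z : milnor_ideal k f z <-> tangent false k f z.
Proof.
split; last first.
  apply: tangentP => // i x xk; apply: ideal_mul_gen; first exact/max_ideal_expP.
  by apply: ideal_genS; exists i.
apply: (@ideal_gen_min _ _ (tangent false k f)); first exact: tangent_ideal_closed.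
move=> _ [x [y [/max_ideal_expP xk /jacobian_idealP[xi [_ ->]] ->]]].
rewrite mulr_sumr; apply: (@memi_sum _ (tangent_ideal false k f)) => -[i|] /=.
  by rewrite mulrA; apply: tangent_gen; exact: ordgeMr.
by rewrite !mulr0; exact: (@memi0 _ (tangent_ideal false k f)).
Qed.

Lemma tangent_true e k f z : tangent e k f z -> tangent true k f z.
Proof.
apply: (@tangentP e k f (tangent_ideal true k f)) => [_|i x]; first exact: tangent_fun.
exact: tangent_gen.
Qed.

Lemma tangentW e k l f z : (k <= l)%N -> tangent e l f z -> tangent e k f z.
Proof. by move=> kl [xi [xl ->]]; exists xi; split=> // i; apply: ordgeW (xl i). Qed.

Lemma tjurina_idealP k f z : tjurina_ideal k f z <-> tangent true k f z.
Proof.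
split; last first.
  apply: tangentP => [_|i x xk]; first by apply: ideal_genS; left.
  by apply: ideal_genS; right; apply/milnor_idealP; exact: tangent_gen.
apply: (@ideal_gen_min _ _ (tangent true k f)); first exact: tangent_ideal_closed.
move=> w [->|/milnor_idealP]; [exact: tangent_fun|exact: tangent_true].
Qed.

Lemma tjurina_ideal0P f z :
  ideal_gen (f |` ideal_set (jacobian_ideal f))%classic z <-> tangent true 0 f z.
Proof.
split; last first.
  apply: tangentP => [_|i x xk]; first by apply: ideal_genS; left.
  by apply: ideal_genS; right; apply/jacobian_idealP; exact: tangent_gen.
apply: (@ideal_gen_min _ _ (tangent true 0 f)); first exact: tangent_ideal_closed.
move=> w [->|/jacobian_idealP]; [exact: tangent_fun|exact: tangent_true].
Qed.

(** * Local automorphisms and their action on tangent ideals *)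

Section Automorphisms.

Lemma local_aut_loc (phi : {lrmorphism B -> B}) : is_local_aut phi -> lochom phi.
Proof.
case=> _ phi1 i; apply: (proj1 (max_idealP _)); apply: phi1.
by apply: (proj2 (max_idealP _)); exact: ordge_cpsX.
Qed.

Lemma bij_local_aut (phi : {lrmorphism B -> B}) :
  bijective phi -> lochom phi -> is_local_aut phi.
Proof.
move=> bphi phi1; split=> // h /max_idealP h1; apply/max_idealP.
exact: ordge_hom.
Qed.

Lemma subst_local_aut (y : locfam v n n) : jac y \in unitmx ->
  is_local_aut (cps_subst y).
Proof.
move=> /inverse_function[z [yz zy]].
by apply: bij_local_aut; [exists (cps_subst z)|exact: cps_subst_loc].
Qed.

Lemma local_aut_inv (phi : {lrmorphism B -> B}) : is_local_aut phi ->
  exists psi : {lrmorphism B -> B},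
    [/\ is_local_aut psi, cancel phi psi & cancel psi phi].
Proof.
move=> aphi; have phi1 := local_aut_loc aphi; case: aphi => -[g phiK gK] _.
have lin : linear g.
  by move=> c x y; apply: (can_inj phiK); rewrite gK linearP /= !gK.
have mul : monoid_morphism g.
  split=> [|x y]; apply: (can_inj phiK); first by rewrite gK rmorph1.
  by rewrite gK rmorphM /= !gK.
pose lg := GRing.isLinear.Build K B B _ g lin.
pose mg := GRing.isMonoidMorphism.Build B B g mul.
pose psi : {lrmorphism B -> B} := HB.pack g lg mg.
exists psi; split=> //; apply: bij_local_aut; first by exists phi.
move=> i; apply/ev0P; rewrite -[LHS](ev0_hom _ phi1) [phi _]gK.
by apply/ev0P; exact: (ordge_cpsX v i).
Qed.

Lemma local_aut_comp (phi psi : {lrmorphism B -> B}) :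
  is_local_aut phi -> is_local_aut psi -> is_local_aut (phi \o psi).
Proof.
case=> bphi mphi [bpsi mpsi]; split; first exact: bij_comp.
by move=> h /mpsi/mphi.
Qed.

Definition rcequiv e f g := exists phi : {lrmorphism B -> B}, exists u : B,
  [/\ is_local_aut phi, u \is a GRing.unit, ~~ e -> u = 1 & f = u * phi g].

Lemma contact_equivP f g : contact_equivalent f g <-> rcequiv true f g.
Proof. by split=> -[phi [u [? ? ?]]]; exists phi, u. Qed.

Lemma right_equivP f g : right_equivalent f g <-> rcequiv false f g.
Proof.
split=> [[phi [aphi fg]]|[phi [u [aphi _ /(_ isT) -> fg]]]].
  by exists phi, 1; split; rewrite ?unitr1 ?mul1r.
by exists phi; rewrite fg mul1r.
Qed.

Lemma rcequiv_sym e f g : rcequiv e f g -> rcequiv e g f.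
Proof.
move=> [phi [u [aphi uu eu ->]]].
have [psi [apsi phiK psiK]] := local_aut_inv aphi.
exists psi, (psi u^-1); split => //.
- by rewrite rmorph_unit // unitrV.
- by move=> /eu ->; rewrite invr1 rmorph1.
- by rewrite -rmorphM mulKr //= phiK.
Qed.

Lemma rcequiv_trans e f g h : rcequiv e f g -> rcequiv e g h -> rcequiv e f h.
Proof.
move=> [phi [u [aphi uu eu ->]]] [psi [w [apsi uw ew ->]]].
exists (phi \o psi), (u * phi w); split.
- exact: local_aut_comp.
- by rewrite unitrM uu rmorph_unit.
- by move=> ee; rewrite eu // ew // rmorph1 mulr1.
- by rewrite rmorphM mulrA.
Qed.

Lemma rcequivW e f g : rcequiv false f g -> rcequiv e f g.
Proof.
by move=> [phi [u [a b c d]]]; exists phi, u; split=> // _; exact: c.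
Qed.

(** The chain rule for f = psi (phi f) expresses the image under [phi] of a derivative of f through
    the derivatives of [phi f]. *)
Lemma tangent_aut e k f z (phi : {lrmorphism B -> B}) : is_local_aut phi ->
  tangent e k f z -> tangent e k (phi f) (phi z).
Proof.
move=> aphi; have [psi [apsi phiK psiK]] := local_aut_inv aphi.
move=> [xi [xk ->]]; rewrite rmorph_sum.
apply: (@memi_sum _ (tangent_ideal e k (phi f))) => -[i|] /=; last first.
  rewrite rmorphM; apply: (@memiMl _ (tangent_ideal e k (phi f))).
  case: (e) => /=; first exact: tangent_fun.
  by rewrite rmorph0; exact: (@memi0 _ (tangent_ideal _ _ _)).
have -> : cps_deriv i f = cps_deriv i (psi (phi f)) by rewrite phiK.
rewrite rmorphM /= (chain_rule _ _ (local_aut_loc apsi)) rmorph_sum mulr_sumr.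
apply: (@memi_sum _ (tangent_ideal e k (phi f))) => l.
rewrite rmorphM /= psiK mulrCA mulrC; apply: tangent_gen; apply: ordgeMr.
by apply: ordge_hom => //; exact: local_aut_loc.
Qed.

Lemma tangent_unit k f z u : u \is a GRing.unit ->
  tangent true k f z -> tangent true k (u * f) z.
Proof.
move=> uu; apply: (@tangentP _ _ _ (tangent_ideal true k (u * f))) => [_|i x xk].
  rewrite -[X in tangent_ideal _ _ _ X](mulKr uu f).
  by apply: (@memiMl _ (tangent_ideal true k (u * f))); exact: tangent_fun.
have -> : x * cps_deriv i f =
    (u^-1 * x) * cps_deriv i (u * f) - (u^-1 * u^-1 * x * cps_deriv i u) * (u * f).
  rewrite cps_derivM; have uV := mulVr uu; symmetry.
  (* [ring] treats u^-1 as an unknown, so the deviation is first isolated as a multiple of 1 - u^-1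
     u. *)
  transitivity ((u^-1 * u) * (x * cps_deriv i f) +
                (1 - u^-1 * u) * (u^-1 * x * (cps_deriv i u * f))); first by ring.
  by rewrite uV subrr mul0r addr0 mul1r.
apply: (@memiB _ (tangent_ideal true k (u * f))).
  by apply: tangent_gen; exact: ordgeMl.
by apply: (@memiMl _ (tangent_ideal true k (u * f))); exact: tangent_fun.
Qed.

Lemma rcequiv_tangent e k f g : rcequiv e f g ->
  exists phi : {lrmorphism B -> B}, exists u : B,
    [/\ is_local_aut phi, ~~ e -> u = 1, f = u * phi g &
      forall z, tangent e k f (phi z) <-> tangent e k g z].
Proof.
have H f1 g1 (phi : {lrmorphism B -> B}) u z : is_local_aut phi ->
    u \is a GRing.unit -> (~~ e -> u = 1) -> f1 = u * phi g1 ->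
    tangent e k g1 z -> tangent e k f1 (phi z).
  move=> aphi uu eu -> /(tangent_aut aphi); case: (e) eu => eu.
    exact: tangent_unit.
  by rewrite eu // mul1r.
move=> [phi [u [aphi uu eu fg]]]; exists phi, u; split=> // z.
split; last exact: (H _ _ _ _ _ aphi uu eu fg).
have [psi [apsi phiK psiK]] := local_aut_inv aphi.
rewrite -{2}(phiK z); apply: (@H g f psi (psi u^-1)) => //.
- by rewrite rmorph_unit // unitrV.
- by move=> /eu ->; rewrite invr1 rmorph1.
- by rewrite fg -rmorphM mulKr //= phiK.
Qed.

End Automorphisms.
End Ideals.

(** * Quotient algebras and lifting of isomorphisms *)

(** In the normal form M = L P U with P a diagonal idempotent and Q = 1 - P, the hypothesis makes W
    conjugate by U to 1 - D P. Hence C = L Q U gives M + C W = L (1 - Q D P) U, and Q D P squares to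
    zero because P Q = 0. *)
Lemma complement_unitmx (F : fieldType) n (M B W : 'M[F]_n) :
  1%:M = B *m M + W -> exists C, M + C *m W \in unitmx.
Proof.
move=> E; pose L := col_ebase M; pose U := row_ebase M; pose r := \rank M.
have Lu : L \in unitmx by exact: col_ebase_unit.
have Uu : U \in unitmx by exact: row_ebase_unit.
pose P : 'M[F]_n := pid_mx r; pose Q := 1%:M - P.
have ME : M = L *m P *m U by exact: esym (mulmx_ebase M).
have PP : P *m P = P by rewrite pid_mx_id // rank_leq_row.
have PQ : P *m Q = 0 by rewrite mulmxBr mulmx1 PP subrr.
pose D := U *m B *m L.
have WE : U *m W *m invmx U = 1%:M - D *m P.
  have -> : W = 1%:M - B *m M by rewrite E addrC addKr.
  rewrite mulmxBr mulmx1 mulmxBl mulmxV // {1}ME /D !mulmxA mulmxK //.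
exists (L *m Q *m U).
have -> : M + L *m Q *m U *m W = L *m (1%:M - Q *m D *m P) *m U.
  have -> : L *m Q *m U *m W = L *m (Q *m (U *m W *m invmx U)) *m U.
    by rewrite !mulmxA mulmxKV.
  rewrite WE {1}ME -mulmxDl -mulmxDr mulmxBr mulmx1 addrA (addrC P) subrK.
  by rewrite !mulmxA.
rewrite !unitmx_mul Lu Uu andbT /=.
set N := Q *m D *m P.
have NN : N *m N = 0 by rewrite /N -!mulmxA (mulmxA P Q) PQ mul0mx !mulmx0.
have /mulmx1_unit[] // : (1%:M - N) *m (1%:M + N) = 1%:M.
by rewrite mulmxBl mul1mx mulmxDr mulmx1 NN addr0 addrK.
Qed.

Section Quotients.
Variables (R : realType) (K : fieldType) (v : absval R K) (n : nat).
Local Notation B := (cps v n).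
Local Notation xv := (cps_var v).
Implicit Types (f g h z : B) (e : bool) (k : nat) (I J : ideal B).

Lemma cps_fps_exp f k : fps_of_cps (f ^+ k) = fps_of_cps f ^+ k.
Proof. by elim: k => // k IH; rewrite !exprS cps_fpsM IH. Qed.

Lemma qclass_surj I (x : quot I) : exists b, qclass I b = x.
Proof. by exists (repr (x : Quotient.quot (ideal_pred I))); exact: reprK. Qed.

Lemma qclass0P I b : qclass I b = 0 <-> I b.
Proof. by rewrite -(raddf0 (qclass I)) qclassP subr0. Qed.

(** In dimension d the first d+1 powers of x_i are linearly dependent modulo I. The relation is the
    lowest power occurring in it times a series with nonzero constant term, that is, times a
    unit. *)
Lemma finite_dim_nilpotent I : finite_dim (quot I) -> forall i, exists r, I (xv i ^+ r).
Proof.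
move=> [d [[w wlin wbij]]] i.
pose A : 'M[K]_(d.+1, d) := \matrix_(j < d.+1) w (qclass I (xv i ^+ j)).
have kA : kermx A != 0.
  by rewrite kermx_eq0 /row_free neq_ltn ltnS rank_leq_col.
pose c := nz_row (kermx A).
have c0 : c != 0 by rewrite nz_row_eq0.
have cA : c *m A = 0 by apply/sub_kermxP; exact: nz_row_sub.
pose P : B := \sum_(j < d.+1) c 0 j *: xv i ^+ j.
pose wl := GRing.isLinear.Build K (quot I) 'rV[K]_d _ w wlin.
pose W : {linear quot I -> 'rV[K]_d} := HB.pack w wl.
have IP : I P.
  apply/qclass0P; apply: (bij_inj wbij); rewrite -[w _]/(W _) -[w 0]/(W 0) raddf0.
  rewrite !raddf_sum -[RHS]cA; apply/rowP => l; rewrite summxE mxE.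
  have wZ a x : w (a *: x) = a *: w x by rewrite -[a *: x]addr0 wlin (raddf0 W : w 0 = 0) addr0.
  by apply: eq_bigr => j _; rewrite /= linearZ /= wZ !mxE.
have [j0 cj0] : exists j, c 0 j != 0.
  by move: c0; case: (pickP (fun j => c 0 j != 0)) => [j ? _|c00 /eqP[]];
     [exists j|apply/rowP => j; rewrite mxE; apply/eqP/negbFE/c00].
case: (@arg_minnP _ j0 (fun j => c 0 j != 0) (fun j => nat_of_ord j) cj0) => r cr rmin.
exists r; pose Q : B := \sum_(j < d.+1) c 0 j *: (if (r <= j)%N then xv i ^+ (j - r) else 0).
have PQ : P = xv i ^+ r * Q.
  rewrite mulr_sumr; apply: eq_bigr => j _; rewrite -scalerAr.
  case: leqP => [rj|jr]; first by rewrite -exprD subnKC.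
  by rewrite (_ : c 0 j = 0) ?scale0r //; apply/eqP; apply: contraTT jr => /rmin; rewrite -leqNgt.
have Qu : Q \is a GRing.unit.
  apply: cps_unitP; rewrite raddf_sum /= (bigD1 r) //= leqnn subnn expr0.
  rewrite linearZ /= rmorph1 mulr1 big1 ?addr0 // => j jr.
  rewrite linearZ /=; case: leqP => [rj|_]; last by rewrite rmorph0 mulr0.
  rewrite rmorphXn /= (proj1 (ev0P _) (ordge_cpsX v i)) expr0n subn_eq0.
  by rewrite leqNgt ltn_neqAle rj andbT eq_sym (inj_eq val_inj) jr mulr0.
by rewrite -(mulrK Qu (xv i ^+ r)) -PQ; exact: (memiMr _ IP).
Qed.

(** Pigeonhole: a monomial of degree above the sum of the r_i is divisible by some x_i^(r_i). As
    [hadamard1] splits off one variable at a time, the induction carries the monomial [mon b]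
    collected so far. *)
Lemma ideal_ordge I : (forall i, exists r, I (xv i ^+ r)) ->
  exists M, forall h, ordge M h -> I h.
Proof.
move=> /choice[r Ir]; pose mon (b : 'X_{1..n}) : B := \prod_i xv i ^+ b i.
have H d h b : ordge d h -> (\sum_i r i < mdeg b + d)%N -> I (mon b * h).
  elim: d h b => [|d IH] h b hd.
    rewrite addn0 mdegE => rb; apply: memiMr.
    have [i rbi] : exists i, (r i <= b i)%N.
      apply: contrapT => /forallNP nex; move: rb; rewrite ltnNge => /negP; apply.
      by apply: leq_sum => i _; apply: ltnW; rewrite ltnNge; apply/negP.
    rewrite /mon (bigD1 i) //=; apply: memiMr.
    by rewrite -(subnK rbi) exprD; exact: memiMl.
  move=> rb; have [w hw wd] := hadamard1 (ordgeW (ltn0Sn d) hd).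
  rewrite hw mulr_sumr; apply: memi_sum => i; rewrite mulrA.
  have -> : mon b * xv i = mon (b + U_(i))%MM.
    rewrite /mon; under [RHS]eq_bigr do rewrite mnmDE exprD mnm1E.
    rewrite big_split /=; congr (_ * _).
    by rewrite (bigD1 i) //= eqxx big1 ?mulr1 // => j ji; rewrite eq_sym (negbTE ji).
  by apply: IH; [exact: (wd d hd)|rewrite mdegD mdeg1 addn1 addSnnS].
exists (\sum_i r i).+1 => h hM; rewrite -[h]mul1r.
have -> : 1 = mon 0%MM by rewrite /mon big1 // => i _; rewrite mnm0E.
by apply: H hM _; rewrite mdeg0.
Qed.

(** Order M is spent on membership in the ideal; the remaining order d is passed to all
    coefficients, that of f included. *)
Lemma tangent_high e f M d h :
  (forall z, ordge M z -> tangent e 0 f z) -> ordge (M + d) h ->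
 exists2 xi : option 'I_n -> B, forall a, ordge d (xi a) & h = \sum_a xi a * gens e f a.
Proof.
move=> Mf; elim: d h => [|d IH] h hd.
  by rewrite addn0 in hd; have [xi [_ ->]] := Mf _ hd; exists xi.
rewrite addnS in hd; have [w hw wd] := hadamard1 (ordgeW (ltn0Sn _) hd).
have /choice[xi xiP] : forall i, exists xi : option 'I_n -> B,
    (forall a, ordge d (xi a)) /\ w i = \sum_a xi a * gens e f a.
  by move=> i; have [xi xd wE] := IH _ (wd _ hd i); exists xi.
exists (fun a => \sum_i xv i * xi i a) => [a|].
  rewrite cps_fps_sum; apply: ordge_sum => i _; apply: (@ordgeM _ _ 1 d).
    exact: (ordge_cpsX v i).
  exact: (proj1 (xiP i)).
rewrite hw; under eq_bigr => i _ do rewrite (proj2 (xiP i)) mulr_sumr.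
rewrite exchange_big /=; apply: eq_bigr => a _; rewrite mulr_suml.
by apply: eq_bigr => i _; rewrite mulrA.
Qed.

Lemma tangent_ordge e k f M :
  (forall z, ordge M z -> tangent e 0 f z) ->
  forall z, ordge (M + k) z -> tangent e k f z.
Proof. by move=> Mf z /(tangent_high Mf)[xi xk ->]; exists xi. Qed.

Lemma quot_iso I J (psi : {lrmorphism B -> B}) : bijective psi ->
  (forall z, J (psi z) <-> I z) ->
  exists Psi : {rmorphism quot I -> quot J}, [/\ scalable Psi, bijective Psi &
    forall b, Psi (qclass I b) = qclass J (psi b)].
Proof.
move=> [phi psiK phiK] IJ.
pose F (x : quot I) : quot J := qclass J (psi (repr (x : Quotient.quot (ideal_pred I)))).
have FE b : F (qclass I b) = qclass J (psi b).
  apply/qclassP; rewrite -raddfB; apply/IJ/qclassP.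
  exact: (reprK (qclass I b : Quotient.quot (ideal_pred I))).
have Fz : zmod_morphism F.
  move=> x y; have [a <-] := qclass_surj x; have [b <-] := qclass_surj y.
  by rewrite -raddfB !FE !raddfB.
have Fm : monoid_morphism F.
  split=> [|x y]; first by rewrite -(rmorph1 (qclass I)) FE !rmorph1.
  have [a <-] := qclass_surj x; have [b <-] := qclass_surj y.
  by rewrite -rmorphM !FE !rmorphM.
pose az := GRing.isZmodMorphism.Build (quot I) (quot J) F Fz.
pose am := GRing.isMonoidMorphism.Build (quot I) (quot J) F Fm.
pose Psi : {rmorphism quot I -> quot J} := HB.pack F az am.
exists Psi; split; last exact: FE.
- move=> c x; have [a <-] := qclass_surj x.
  by rewrite -linearZ /= [LHS]FE [X in _ = _ *: X]FE -linearZ /= linearZ.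
- pose G (x : quot J) : quot I := qclass I (phi (repr (x : Quotient.quot (ideal_pred J)))).
  have GE b : G (qclass J b) = qclass I (phi b).
    apply/qclassP; apply/IJ; rewrite raddfB /= !phiK; apply/qclassP.
    exact: (reprK (qclass J b : Quotient.quot (ideal_pred J))).
  exists G => x; have [a <-] := qclass_surj x.
    by rewrite [X in G X]FE GE psiK.
  by rewrite GE [LHS]FE phiK.
Qed.

Lemma ideal_proper I : ~ I 1 -> forall z, I z -> ev0 z = 0.
Proof.
move=> I1 z Iz; apply/eqP; apply: contraPT I1 => /cps_unitP zu.
by apply; rewrite -(mulVr zu); exact: memiMl.
Qed.

Section Lift.
Variables (I J : ideal B) (phi : {rmorphism quot I -> quot J}).
Hypotheses (phiZ : scalable phi) (phi_bij : bijective phi).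

(** Nothing is assumed about [phi] beyond algebra. Expanding by [hadamard1] puts the difference of
    the two maps into the class of m^M, which J absorbs. *)
Lemma lift_hom M (psi : {lrmorphism B -> B}) : lochom psi ->
  (forall h, ordge M h -> J h) ->
  (forall i, phi (qclass I (xv i)) = qclass J (psi (xv i))) ->
  forall b, phi (qclass I b) = qclass J (psi b).
Proof.
move=> psi1 MJ eX b; apply/eqP; rewrite -subr_eq0; apply/eqP.
suff [w wM ->] : exists2 w : B, ordge M w & phi (qclass I b) - qclass J (psi b) = qclass J w.
  exact/qclass0P/MJ.
elim: M b {MJ} => [b|d IH b].
  have [x xE] := qclass_surj (phi (qclass I b)).
  by exists (x - psi b) => //; rewrite -xE raddfB.
have [h bh _] := hadamard1 (@ordge_const _ _ _ _ b).
have -> : b = (ev0 b)%:A + \sum_i xv i * h i by rewrite -bh addrC subrK.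
have /choice[w wP] : forall i, exists w : B, ordge d w /\
    phi (qclass I (h i)) - qclass J (psi (h i)) = qclass J w.
  by move=> i; have [w wd wE] := IH (h i); exists w.
exists (\sum_i psi (xv i) * w i).
  rewrite cps_fps_sum; apply: ordge_sum => i _; apply: (@ordgeM _ _ 1 d).
    exact: psi1.
  exact: (proj1 (wP i)).
rewrite !raddfD /= !linearZ /= phiZ !rmorph1 scalerN addrACA subrr add0r.
rewrite !raddf_sum -big_split /=; apply: eq_bigr => i _.
by rewrite !rmorphM /= eX -mulrBr (proj2 (wP i)).
Qed.

(* The linear part of an arbitrary lift need not be invertible when [J] contains
   elements of order one; adding elements of [J] repairs it. *)
Lemma lift_iso : (forall i, exists r, I (xv i ^+ r)) ->
  exists Phi : {lrmorphism B -> B}, [/\ is_local_aut Phi,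
    forall b, J (Phi b) <-> I b & forall b, phi (qclass I b) = qclass J (Phi b)].
Proof.
move=> nilI; have inj := bij_inj phi_bij.
have [J1|J1] := pselect (J 1).
  have Jall z : J z by rewrite -[z]mulr1; exact: memiMl.
  have Iall z : I z.
    apply/qclass0P; apply: inj; rewrite raddf0.
    by have [x <-] := qclass_surj (phi (qclass I z)); apply/qclass0P.
  exists idfun; split=> [|//|b].
    by apply: bij_local_aut; [exists idfun|move=> i; exact: (ordge_cpsX v i)].
  have [x <-] := qclass_surj (phi (qclass I b)); exact/qclassP.
have J0 := ideal_proper J1.
have [psi phiK psiK] := phi_bij.
have lift b : exists b', phi (qclass I b) = qclass J b'.
  by have [x] := qclass_surj (phi (qclass I b)); exists x.
have colift b' : exists b, phi (qclass I b) = qclass J b'.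
  by have [x xE] := qclass_surj (psi (qclass J b')); exists x; rewrite xE psiK.
have [MI IM] := ideal_ordge nilI.
(* Let b be a preimage of the class of x_i. Then b - b(0) is nilpotent modulo I, so x_i - b(0) is
   nilpotent modulo J. As J is proper, evaluation at the origin forces b(0) = 0. *)
have nilJ i : exists r, J (xv i ^+ r).
  have [b bX] := colift (xv i).
  have /IM Ib : ordge MI ((b - (ev0 b)%:A) ^+ MI).
    have := @ordgeX _ _ 1 (b - (ev0 b)%:A) MI (@ordge_const _ _ _ _ b).
    by rewrite muln1 cps_fps_exp.
  have JX : J ((xv i - (ev0 b)%:A) ^+ MI).
    apply/qclass0P; rewrite rmorphXn raddfB /= -bX linearZ /= rmorph1.
    rewrite -(rmorph1 phi) -phiZ -raddfB -rmorphXn.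
    rewrite -(rmorph1 (qclass I)) -linearZ /= -raddfB -rmorphXn /=.
    by rewrite (proj2 (qclass0P I _) Ib) raddf0.
  exists MI; suff bz : ev0 b = 0 by move: JX; rewrite bz scale0r subr0.
  have /eqP := J0 _ JX; rewrite rmorphXn raddfB /= ev0_alg.
  rewrite (proj1 (ev0P _) (ordge_cpsX v i)) sub0r expf_eq0 oppr_eq0.
  by case/andP => _ /eqP.
have [MJ JM] := ideal_ordge nilJ.
have /choice[y0 y0E] := fun i => lift (xv i).
have y01 i : ordge 1 (y0 i).
  apply/ev0P; have [r Ir] := nilI i.
  have Jy : J (y0 i ^+ r).
    by apply/qclass0P; rewrite rmorphXn /= -y0E -!rmorphXn /= (proj2 (qclass0P I _) Ir) raddf0.
  by have /eqP := J0 _ Jy; rewrite rmorphXn expf_eq0 => /andP[_ /eqP].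
pose y := LocFam y01; pose S : {lrmorphism B -> B} := cps_subst y.
have S1 : lochom S by exact: cps_subst_loc.
have SX i : S (xv i) = y0 i by exact: (cps_substX y).
have SE : forall b, phi (qclass I b) = qclass J (S b).
  by apply: (lift_hom S1 JM) => i; rewrite SX.
have /choice[b bE] := fun i => colift (xv i).
(* Differentiating x_i = S (b_i) + j_i at the origin gives 1 = jac b * jac y0 + jac j, which is the
   hypothesis of [complement_unitmx]. *)
pose j i : B := xv i - S (b i).
have Jj i : J (j i) by apply/qclassP; rewrite -SE bE.
have [C Cu] : exists C, jac y0 + C *m jac j \in unitmx.
  apply: (@complement_unitmx _ _ _ (jac b)).
  have -> : jac y0 = jac (fun i => S (xv i)) by congr jac; apply/funext => i; rewrite SX.
  rewrite -jac_hom // -(jac_id v n); apply/matrixP => i l; rewrite !mxE.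
  by rewrite /j cps_derivB raddfB /= addrC subrK.
pose y' i : B := y0 i + \sum_l C i l *: j l.
have y'1 i : ordge 1 (y' i).
  apply/ev0P; rewrite raddfD raddf_sum /= (proj1 (ev0P _) (y01 i)) add0r.
  by rewrite big1 // => l _; rewrite linearZ /= J0 ?mulr0.
pose S' : {lrmorphism B -> B} := cps_subst (LocFam y'1).
have S'E : forall c, phi (qclass I c) = qclass J (S' c).
  apply: (lift_hom _ JM) => [i|i]; first exact: (cps_subst_loc (LocFam y'1) i).
  rewrite [S' _](cps_substX (LocFam y'1)) y0E; apply/qclassP.
  rewrite opprD addrA subrr sub0r; apply/memiN/memi_sum => l.
  by rewrite -mulr_algl; exact: memiMl.
exists S'; split=> //.
  apply: subst_local_aut => /=; have -> // : jac y' = jac y0 + C *m jac j.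
  apply/matrixP => i l; rewrite !mxE cps_derivD cps_deriv_sum raddfD raddf_sum /=.
  by congr (_ + _); apply: eq_bigr => k _; rewrite mxE cps_derivZ linearZ.
move=> c; split=> Hc.
  by apply/qclass0P; apply: inj; rewrite S'E raddf0; apply/qclass0P.
by apply/qclass0P; rewrite -S'E (proj2 (qclass0P I _) Hc) raddf0.
Qed.

End Lift.
End Quotients.

(** * Power series in a deformation parameter *)

(** Formal in the parameter s even for A = K{x}: each coefficient converges, but their radii may
    tend to zero. *)
Record ser (A : Type) := Ser { sc :> nat -> A }.
HB.instance Definition _ (A : comNzRingType) := gen_eqMixin (ser A).
HB.instance Definition _ (A : comNzRingType) := gen_choiceMixin (ser A).

Section SerRing.
Variable A : comNzRingType.
Implicit Types (a b c : ser A) (d i j k : nat).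

Lemma serP a b : (forall i, a i = b i) -> a = b.
Proof. by case: a b => [a] [b] /= ab; congr Ser; apply/funext. Qed.

Definition ser_zero : ser A := Ser (fun=> 0).
Definition serC (x : A) : ser A := Ser (fun i => if i == 0%N then x else 0).
Definition ser_opp a : ser A := Ser (fun i => - a i).
Definition ser_add a b : ser A := Ser (fun i => a i + b i).
Definition ser_mul a b : ser A := Ser (fun i => \sum_(j < i.+1) a j * b (i - j)%N).

Let addA : associative ser_add.
Proof. by move=> a b c; apply/serP => i /=; rewrite addrA. Qed.
Let addC : commutative ser_add.
Proof. by move=> a b; apply/serP => i /=; rewrite addrC. Qed.
Let add0 : left_id ser_zero ser_add.
Proof. by move=> a; apply/serP => i /=; rewrite add0r. Qed.
Let addN : left_inverse ser_zero ser_opp ser_add.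
Proof. by move=> a; apply/serP => i /=; rewrite addNr. Qed.
HB.instance Definition _ := GRing.isZmodule.Build (ser A) addA addC add0 addN.

Definition ser_trunc d a : {poly A} := \poly_(i < d) a i.

Lemma coef_ser_trunc d a i : (i < d)%N -> (ser_trunc d a)`_i = a i.
Proof. by rewrite coef_poly => ->. Qed.

Lemma coefM_eq d (p p' q q' : {poly A}) i : (i < d)%N ->
  (forall j, (j < d)%N -> p`_j = p'`_j) -> (forall j, (j < d)%N -> q`_j = q'`_j) ->
  (p * q)`_i = (p' * q')`_i.
Proof.
move=> id pp qq; rewrite !coefM; apply: eq_bigr => j _.
by rewrite pp ?qq // ?(leq_ltn_trans (leq_subr _ _)) // (leq_trans (ltn_ord j)).
Qed.

Lemma ser_mulE d a b i : (i < d)%N ->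
  ser_mul a b i = (ser_trunc d a * ser_trunc d b)`_i.
Proof.
move=> id; rewrite coefM; apply: eq_bigr => j _.
rewrite !coef_ser_trunc // ?(leq_ltn_trans (leq_subr _ _)) //.
exact: leq_trans (ltn_ord j) id.
Qed.

Let mulA : associative ser_mul.
Proof.
move=> a b c; apply/serP => i; have id := ltnSn i.
rewrite !(ser_mulE _ _ id).
rewrite (@coefM_eq i.+1 _ (ser_trunc i.+1 a) _ (ser_trunc i.+1 b * ser_trunc i.+1 c)) //;
  last by move=> k kd; rewrite coef_ser_trunc // (ser_mulE _ _ kd); apply: (coefM_eq kd).
rewrite mulrA; apply: (coefM_eq id) => // k kd.
by rewrite coef_ser_trunc // (ser_mulE _ _ kd).
Qed.
Let mulC : commutative ser_mul.
Proof.
move=> a b; apply/serP => i; have id := ltnSn i.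
by rewrite !(ser_mulE _ _ id) mulrC.
Qed.
Let mul1 : left_id (serC 1) ser_mul.
Proof.
move=> a; apply/serP => i /=; rewrite big_ord_recl /= mul1r subn0.
by rewrite big1 ?addr0 // => j _; rewrite mul0r.
Qed.
Let mulDl : left_distributive ser_mul ser_add.
Proof.
by move=> a b c; apply/serP => i /=; rewrite -big_split; apply: eq_bigr => j _; rewrite mulrDl.
Qed.
Let one_neq0 : serC 1 != 0.
Proof. by apply/eqP => /(congr1 (fun a : ser A => a 0%N)) /= /eqP; rewrite oner_eq0. Qed.
HB.instance Definition _ :=
  GRing.Zmodule_isComNzRing.Build (ser A) mulA mulC mul1 mulDl one_neq0.

Lemma serD a b i : (a + b) i = a i + b i. Proof. by []. Qed.
Lemma serN a i : (- a) i = - a i. Proof. by []. Qed.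
Lemma ser0 i : (0 : ser A) i = 0. Proof. by []. Qed.
Lemma ser1 i : (1 : ser A) i = (i == 0%N)%:R. Proof. by rewrite /=; case: eqP. Qed.
Lemma serM a b i : (a * b) i = \sum_(j < i.+1) a j * b (i - j)%N. Proof. by []. Qed.
Lemma ser_sum I (r : seq I) (P : pred I) (F : I -> ser A) i :
  (\sum_(j <- r | P j) F j) i = \sum_(j <- r | P j) F j i.
Proof. by elim/big_rec2: _ => // j x y _ <-. Qed.
Lemma serM0 a b : (a * b) 0%N = a 0%N * b 0%N.
Proof. by rewrite serM big_ord_recl big_ord0 addr0. Qed.
Lemma serCE x i : serC x i = if i == 0%N then x else 0. Proof. by []. Qed.

Lemma serCM x a i : (serC x * a) i = x * a i.
Proof.
by rewrite serM big_ord_recl /= subn0 big1 ?addr0 // => j _; rewrite mul0r.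
Qed.

Lemma serC_is_zmod_morphism : zmod_morphism serC.
Proof.
by move=> x y; apply/serP => i; rewrite serD serN !serCE; case: eqP; rewrite ?subr0.
Qed.
HB.instance Definition _ := GRing.isZmodMorphism.Build A (ser A) serC serC_is_zmod_morphism.
Lemma serC_is_monoid_morphism : monoid_morphism serC.
Proof.
by split=> // x y; apply/serP => i; rewrite serCM !serCE; case: eqP; rewrite ?mulr0.
Qed.
HB.instance Definition _ :=
  GRing.isMonoidMorphism.Build A (ser A) serC serC_is_monoid_morphism.

Definition sc0 a : A := a 0%N.
Lemma sc0_is_zmod_morphism : zmod_morphism sc0. Proof. by []. Qed.
HB.instance Definition _ := GRing.isZmodMorphism.Build (ser A) A sc0 sc0_is_zmod_morphism.
Lemma sc0_is_monoid_morphism : monoid_morphism sc0.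
Proof. by split=> // a b; exact: serM0. Qed.
HB.instance Definition _ :=
  GRing.isMonoidMorphism.Build (ser A) A sc0 sc0_is_monoid_morphism.

Definition serX : ser A := Ser (fun i => (i == 1%N)%:R).

Lemma serXM a i : (serX * a) i = if i is j.+1 then a j else 0.
Proof.
rewrite serM big_ord_recl mul0r add0r; case: i => [|i]; first by rewrite big_ord0.
rewrite big_ord_recl /= mul1r subSS subn0 big1 ?addr0 // => j _.
by rewrite mul0r.
Qed.

Definition sder a : ser A := Ser (fun i => a i.+1 *+ i.+1).

Lemma sderD a b : sder (a + b) = sder a + sder b.
Proof. by apply/serP => i; rewrite serD /= mulrnDl. Qed.
Lemma sderM a b : sder (a * b) = sder a * b + a * sder b.
Proof.
apply/serP => i; rewrite serD; set d := i.+2.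
have i1d : (i.+1 < d)%N by []. have id : (i < i.+1)%N by [].
rewrite -[LHS]/(ser_mul a b i.+1 *+ i.+1) (ser_mulE a b i1d) -coef_deriv derivM coefD.
rewrite [X in _ = X + _](ser_mulE _ _ id) [X in _ = _ + X](ser_mulE _ _ id).
have TE (c : ser A) k : (k < i.+1)%N -> (ser_trunc d c)`_k = (ser_trunc i.+1 c)`_k.
  by move=> ki; rewrite !coef_ser_trunc // ltnW.
have TD (c : ser A) k : (k < i.+1)%N ->
    ((ser_trunc d c)^`())`_k = (ser_trunc i.+1 (sder c))`_k.
  by move=> ki; rewrite coef_deriv !coef_ser_trunc.
by congr (_ + _); apply: (coefM_eq id) => k ki; rewrite ?TE ?TD.
Qed.

End SerRing.

Arguments ser_mul : simpl never.
Arguments serX {A}.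

Section SerMap.
Variables (A C : comNzRingType).

Definition ser_map (phi : A -> C) (a : ser A) : ser C := Ser (fun i => phi (a i)).

Variable phi : {rmorphism A -> C}.
Lemma ser_map_is_zmod_morphism : zmod_morphism (ser_map phi).
Proof. by move=> a b; apply/serP => i /=; rewrite rmorphB. Qed.
HB.instance Definition _ :=
  GRing.isZmodMorphism.Build (ser A) (ser C) (ser_map phi) ser_map_is_zmod_morphism.
Lemma ser_map_is_monoid_morphism : monoid_morphism (ser_map phi).
Proof.
split=> [|a b]; apply/serP => i.
  by rewrite ser1 -(rmorph_nat phi) -ser1.
rewrite serM /= rmorph_sum; apply: eq_bigr => j _; exact: rmorphM.
Qed.
HB.instance Definition _ :=
  GRing.isMonoidMorphism.Build (ser A) (ser C) (ser_map phi) ser_map_is_monoid_morphism.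
End SerMap.

Lemma ser_integral (F : fieldType) (a b : ser F) : a * b = 0 -> a = 0 \/ b = 0.
Proof.
move=> ab; have [[i ai]|na] := pselect (exists i, a i != 0); last first.
  by left; apply/serP => i; apply: contrapT => /eqP ai; apply: na; exists i.
right; have [j0 aj jmin] := ex_minnP (ex_intro (fun i => a i != 0) i ai).
apply/serP => k; elim/ltn_ind: k => k IH.
have := congr1 (fun c : ser F => c (j0 + k)%N) ab; rewrite serM ser0.
have jk : (j0 < (j0 + k).+1)%N by rewrite ltnS leq_addr.
rewrite (bigD1 (Ordinal jk)) //= addKn big1 ?addr0.
  by move=> /eqP; rewrite mulf_eq0 (negbTE aj) => /eqP.
move=> l lj; have [lt|ge] := ltnP l j0.
  have [->|/jmin] := eqVneq (a l) 0; first by rewrite mul0r.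
  by rewrite leqNgt lt.
rewrite IH ?mulr0 //; have {lj ge}lt : (j0 < l)%N.
  by rewrite ltn_neqAle ge andbT eq_sym; apply: contraNneq lj => jl; apply/eqP/val_inj.
by rewrite ltn_subLR ?ltn_add2r // -ltnS.
Qed.

(** * Flows of vector fields *)

Section Flow.
Variables (R : realType) (K : fieldType) (v : absval R K) (n : nat).
Hypothesis char0 : [pchar K] =i pred0.
Local Notation B := (cps v n).
Local Notation xv := (cps_var v).
Implicit Types (c : ser B) (b : B).

Lemma natr_neq0 k : k.+1%:R != 0 :> K.
Proof. by rewrite (proj1 (pcharf0P K) char0). Qed.

Lemma mulrn_eq0_cps b k : b *+ k.+1 = 0 -> b = 0.
Proof.
rewrite -scaler_nat => /eqP; rewrite scaler_eq0 (negbTE (natr_neq0 k)) /=.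
by move/eqP.
Qed.

Definition sD (l : 'I_n) : ser B -> ser B := ser_map (cps_deriv l).

Lemma sDE l c i : sD l c i = cps_deriv l (c i). Proof. by []. Qed.
Lemma sDD l c c' : sD l (c + c') = sD l c + sD l c'.
Proof. by apply/serP => i; rewrite serD !sDE cps_derivD. Qed.
Lemma sD0 l : sD l 0 = 0.
Proof. by apply/serP => i; rewrite sDE ser0 cps_deriv0. Qed.
Lemma sDB l c c' : sD l (c - c') = sD l c - sD l c'.
Proof. by apply/serP => i; rewrite serD serN !sDE cps_derivB. Qed.
Lemma sDM l c c' : sD l (c * c') = sD l c * c' + c * sD l c'.
Proof.
apply/serP => i; rewrite serD sDE !serM cps_deriv_sum -big_split /=.
by apply: eq_bigr => j _; rewrite cps_derivM.
Qed.
Lemma sDC l b : sD l (serC b) = serC (cps_deriv l b).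
Proof. by apply/serP => i; rewrite sDE !serCE; case: eqP; rewrite ?cps_deriv0. Qed.
Lemma sDX l c : sD l (serX * c) = serX * sD l c.
Proof.
by apply/serP => i; rewrite sDE !serXM; case: i => [|i]; rewrite ?cps_deriv0.
Qed.
Lemma sD_sum l I (r : seq I) (F : I -> ser B) :
  sD l (\sum_(j <- r) F j) = \sum_(j <- r) sD l (F j).
Proof.
by apply/serP => i; rewrite ser_sum sDE ser_sum cps_deriv_sum.
Qed.
Lemma sD_comm l m c : sD l (sD m c) = sD m (sD l c).
Proof. by apply/serP => i; rewrite !sDE cps_deriv_comm. Qed.
Lemma sder_sD l c : sder (sD l c) = sD l (sder c).
Proof.
apply/serP => i.
rewrite -[LHS]/(cps_deriv l (c i.+1) *+ i.+1) -[RHS]/(cps_deriv l (c i.+1 *+ i.+1)).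
by rewrite -!scaler_nat cps_derivZ.
Qed.
Lemma sderC b : sder (serC b) = 0.
Proof. by apply/serP => i /=; rewrite mul0rn. Qed.
Lemma sderX c : sder (serX * c) = c + serX * sder c.
Proof.
rewrite sderM; congr (_ + _); rewrite -[RHS]mul1r; congr (_ * _).
apply/serP => i /=; rewrite eqSS; case: i => [|i] //=; exact: mul0rn.
Qed.

Variable xi : 'I_n -> ser B.

(** The derivation d/ds - xi on K{x}[[s]]. Its kernel consists of the series transported by the
    vector field xi, each determined by its value at s = 0. *)
Definition delta c : ser B := sder c - \sum_l xi l * sD l c.

Lemma deltaD c c' : delta (c + c') = delta c + delta c'.
Proof.
rewrite /delta sderD addrACA -opprD -big_split /=; congr (_ - _).
by apply: eq_bigr => l _; rewrite sDD mulrDr.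
Qed.
Lemma delta0 : delta 0 = 0.
Proof. by apply: (addrI (delta 0)); rewrite -deltaD !addr0. Qed.
Lemma deltaN c : delta (- c) = - delta c.
Proof. by apply/eqP; rewrite -addr_eq0 -deltaD addNr delta0. Qed.
Lemma deltaB c c' : delta (c - c') = delta c - delta c'.
Proof. by rewrite deltaD deltaN. Qed.
Lemma delta_sum I (r : seq I) (F : I -> ser B) :
  delta (\sum_(j <- r) F j) = \sum_(j <- r) delta (F j).
Proof. by elim/big_rec2: _ => [|i x y _ <-]; rewrite ?delta0 ?deltaD. Qed.
Lemma deltaM c c' : delta (c * c') = delta c * c' + c * delta c'.
Proof.
rewrite /delta sderM mulrBl mulrBr addrACA -opprD; congr (_ - _).
rewrite mulr_suml mulr_sumr -big_split /=; apply: eq_bigr => l _.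
by rewrite sDM mulrDr mulrA [X in _ + X = _]mulrCA.
Qed.
Lemma delta_sD l c : delta (sD l c) = sD l (delta c) + \sum_m sD l (xi m) * sD m c.
Proof.
rewrite /delta sDB sder_sD -addrA; congr (_ + _).
rewrite sD_sum -sumrN -[in RHS]sumrN -big_split /=; apply: eq_bigr => m _.
by rewrite sDM sD_comm opprD addrAC addNr add0r.
Qed.

(** The equation expresses (k+1) times the coefficient of s^(k+1) through lower coefficients, and
    k+1 is invertible in characteristic 0. *)
Lemma delta_uniq (I : finType) (M : I -> I -> ser B) (c : I -> ser B) :
  (forall i, delta (c i) = \sum_l M i l * c l) -> (forall i, c i 0%N = 0) ->
  forall i, c i = 0.
Proof.
move=> cM c0 i; apply/serP => k; elim/ltn_ind: k i => -[_|k IH] i; first exact: c0.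
apply: (@mulrn_eq0_cps _ k).
have := congr1 (fun a : ser B => a k) (cM i); rewrite /delta serD serN.
move=> /eqP; rewrite subr_eq -[_ *+ _]/(sder (c i) k) => /eqP ->.
rewrite !ser_sum !big1 ?addr0 // => l _; rewrite serM big1 // => j _.
  by rewrite sDE IH ?cps_deriv0 ?mulr0 // ltnS leq_subr.
by rewrite IH ?mulr0 // ltnS leq_subr.
Qed.

Lemma delta_uniq1 (a c c' : ser B) :
  delta c = a * c -> delta c' = a * c' -> c 0%N = c' 0%N -> c = c'.
Proof.
move=> ca ca' c0; apply/eqP; rewrite -subr_eq0; apply/eqP.
apply: (@delta_uniq unit (fun _ _ => a) (fun=> c - c') _ _ tt) => -[].
  by rewrite deltaB ca ca' (big_pred1 tt) ?mulrBr //; case.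
by rewrite serD serN c0 subrr.
Qed.

(** Integrating in s turns the equation into c = T c, where [T] gains one order in s; the
    coefficient of s^i is final from the iterate i+1 on. *)
Lemma delta_exists (a : ser B) b : exists c, delta c = a * c /\ c 0%N = b.
Proof.
pose N c := \sum_l xi l * sD l c + a * c.
pose T c : ser B := Ser (fun i => if i is j.+1 then j.+1%:R^-1 *: N c j else b).
pose agree d c c' := forall i, (i < d)%N -> c i = c' i.
have NN d c c' : agree d c c' -> agree d (N c) (N c').
  move=> cc j jd; rewrite /N !serD !ser_sum; congr (_ + _).
    apply: eq_bigr => l _; rewrite !serM; apply: eq_bigr => q _.
    by rewrite !sDE cc // (leq_ltn_trans (leq_subr _ _)).
  rewrite !serM; apply: eq_bigr => q _.
  by rewrite cc // (leq_ltn_trans (leq_subr _ _)).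
have NT d c c' : agree d c c' -> agree d.+1 (T c) (T c').
  by move=> cc -[//|j] jd; congr (_ *: _); exact: (NN d).
pose U k := iter k T 0.
have UU k : agree k (U k.+1) (U k) by elim: k => // k IH; exact: NT.
have Uk k j : agree k (U (k + j)%N) (U k).
  elim: j => [|j IH] i ik; first by rewrite addn0.
  by rewrite addnS UU ?IH // (leq_trans ik) // leq_addr.
pose c : ser B := Ser (fun i => U i.+1 i).
have cU k : agree k c (U k).
  by move=> i ik; rewrite -[LHS]/(U i.+1 i) -(Uk i.+1 (k - i.+1)%N) // subnKC.
have cT : c = T c.
  apply/serP => i; rewrite (cU i.+1) // -[U i.+1]/(T (U i)).
  by apply: (NT i) => // j ji; rewrite (cU i).
exists c; split; last by rewrite cT.
apply/eqP; rewrite subr_eq addrC; apply/eqP/serP => i.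
have ci : c i.+1 = i.+1%:R^-1 *: N c i by rewrite {1}cT.
rewrite -[LHS]/(c i.+1 *+ i.+1) ci -scaler_nat scalerA mulfV ?natr_neq0 //.
by rewrite scale1r.
Qed.

(* [pi b] is [b] transported along the flow of the vector field [xi]. *)
Lemma flow_exists : exists pi : {rmorphism B -> ser B},
  forall b, delta (pi b) = 0 /\ pi b 0%N = b.
Proof.
have /choice[p pP] : forall b, exists c, delta c = 0 /\ c 0%N = b.
  by move=> b; have [c] := delta_exists 0 b; rewrite mul0r; exists c.
have uniq c c' : delta c = 0 -> delta c' = 0 -> c 0%N = c' 0%N -> c = c'.
  by move=> dc dc'; apply: (@delta_uniq1 0); rewrite mul0r.
have pz : zmod_morphism p.
  move=> x y; have [dx x0] := pP x; have [dy y0] := pP y; have [dxy xy0] := pP (x - y).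
  by apply: uniq; rewrite ?deltaB ?dx ?dy ?subr0 // xy0 serD serN x0 y0.
have pm : monoid_morphism p.
  split=> [|x y].
    have [d1 p1] := pP 1; apply: uniq => //.
    rewrite -(rmorph1 (@serC B)) /delta sderC sub0r big1 ?oppr0 // => l _.
    by rewrite sDC -(scale1r 1) cps_derivC rmorph0 mulr0.
  have [dx x0] := pP x; have [dy y0] := pP y; have [dxy xy0] := pP (x * y).
  by apply: uniq; rewrite ?deltaM ?dx ?dy ?mul0r ?mulr0 ?addr0 // xy0 serM0 x0 y0.
pose az := GRing.isZmodMorphism.Build B (ser B) p pz.
pose am := GRing.isMonoidMorphism.Build B (ser B) p pm.
by exists (HB.pack p az am : {rmorphism B -> ser B}).
Qed.

Section FlowProperties.
Variable pi : {rmorphism B -> ser B}.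
Hypothesis pi_delta : forall b, delta (pi b) = 0.
Hypothesis pi0 : forall b, pi b 0%N = b.

Lemma flow_alg k : pi k%:A = serC k%:A.
Proof.
apply: (@delta_uniq1 0); rewrite ?mul0r ?pi0 //.
rewrite /delta sderC sub0r big1 ?oppr0 // => l _.
by rewrite sDC cps_derivC rmorph0 mulr0.
Qed.

(** By [delta_sD], both sides satisfy the same linear system with matrix [sD j (xi m)], and they
    agree at s = 0; [delta_uniq] applies to their difference. *)
Lemma flow_chain i b : sD i (pi b) = \sum_l pi (cps_deriv l b) * sD i (pi (xv l)).
Proof.
have dsD c j : delta c = 0 -> delta (sD j c) = \sum_m sD j (xi m) * sD m c.
  by move=> dc; rewrite delta_sD dc sD0 add0r.
apply/eqP; rewrite -subr_eq0; apply/eqP; move: i.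
apply: (@delta_uniq _ (fun j m => sD j (xi m))) => j.
  rewrite deltaB dsD // delta_sum.
  under [X in _ = X]eq_bigr do rewrite mulrBr.
  rewrite [RHS]sumrB; congr (_ - _).
  under eq_bigr => l _ do rewrite deltaM pi_delta mul0r add0r dsD // mulr_sumr.
  rewrite exchange_big; apply: eq_bigr => m _; rewrite mulr_sumr.
  by apply: eq_bigr => l _; rewrite mulrCA.
rewrite serD serN ser_sum sDE pi0 (bigD1 j) // serM0 pi0 sDE pi0 cps_derivX eqxx mulr1.
rewrite big1 => [|l lj]; first by rewrite /= addr0 subrr.
by rewrite serM0 sDE pi0 pi0 cps_derivX eq_sym (negbTE lj) mulr0.
Qed.

End FlowProperties.
End Flow.

(** * Families with constant tangent ideal *)

Section Family.
Variables (R : realType) (K : fieldType) (v : absval R K) (n : nat).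
Hypothesis char0 : [pchar K] =i pred0.
Local Notation B := (cps v n).
Local Notation xv := (cps_var v).
Implicit Types (f g h z : B) (e : bool) (k : nat).

Lemma gensB e f g a : gens e (g - f) a = gens e g a - gens e f a.
Proof.
by case: a => [i|] /=; [exact: cps_derivB|case: e; rewrite ?subr0].
Qed.

Definition sgens e f h a : ser B := serC (gens e f a) + serX * serC (gens e h a).

Lemma sgens_deriv e f h l : sgens e f h (Some l) = sD l (serC f + serX * serC h).
Proof. by rewrite sDD sDX !sDC. Qed.

Lemma serM_lin (c : ser B) u w j : (c * (serC u + serX * serC w)) j =
  c j * u + if j is i.+1 then c i * w else 0.
Proof.
rewrite mulrDr serD [c * serC u]mulrC serCM mulrC mulrCA serXM.
by case: j => // j; rewrite [c * _]mulrC serCM [w * _]mulrC.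
Qed.

(* The relations [z = zeta_0 . D f] and [zeta_(j+1) . D f + zeta_j . D (g - f) = 0]
   express that [z] is a combination of the generators of the deformed ideal. *)
Lemma tangent_expand e k f g z :
  (forall y, tangent e k f y <-> tangent e k g y) -> tangent e k f z ->
  exists xi : option 'I_n -> ser B, serC z = \sum_a xi a * sgens e f (g - f) a.
Proof.
move=> fg [z0 [z0k zE]]; set h := g - f.
pose T := {zeta : option 'I_n -> B | forall i, ordge k (zeta (Some i))}.
have step (zeta : T) : exists zeta' : T,
    \sum_a sval zeta' a * gens e f a = - \sum_a sval zeta a * gens e h a.
  case: zeta => zeta zk /=.
  have [w [wk wE]] : tangent e k f (- \sum_a zeta a * gens e h a).
    apply: (@memiN _ (tangent_ideal e k f)).
    under eq_bigr do rewrite gensB mulrBr.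
    rewrite sumrB; apply: (@memiB _ (tangent_ideal e k f)); last by exists zeta.
    by apply/fg; exists zeta.
  by exists (exist _ w wk).
have [next nextE] := choice step.
pose zs j := iter j next (exist _ z0 z0k : T).
exists (fun a => Ser (fun j => sval (zs j) a)); apply/serP => j.
rewrite ser_sum; under eq_bigr do rewrite serM_lin /=.
case: j => [|j]; first by rewrite serCE eqxx zE; apply: eq_bigr => a _; rewrite addr0.
by rewrite big_split /= nextE addNr.
Qed.

(** Put F = f + s h with h = g - f. Then dF/ds = h, and [tangent_expand] writes h as a F plus xi
    applied to F; hence [delta F = a F]. The solution E of the same equation with E(0) = 1 makes E
    times the transported f another solution, with the same value at s = 0. For right equivalence a
    = 0, so E = 1. *)
Lemma family_flow e k f g :
  (forall y, tangent e k f y <-> tangent e k g y) -> tangent e k f (g - f) ->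
  exists pi : {rmorphism B -> ser B}, exists E : ser B,
    [/\ E 0%N = 1, ~~ e -> E = 1, serC f + serX * serC (g - f) = E * pi f &
      [/\ forall b, pi b 0%N = b, forall c, pi c%:A = serC c%:A &
        forall i b, sD i (pi b) = \sum_l pi (cps_deriv l b) * sD i (pi (xv l))]].
Proof.
move=> fg fh; have [xi xiE] := tangent_expand fg fh.
pose eta l := xi (Some l); set h := g - f in xiE *.
pose F := serC f + serX * serC h.
have [pi piP] := flow_exists char0 eta.
have pid b : delta eta (pi b) = 0 by case: (piP b).
have pi0 b : pi b 0%N = b by case: (piP b).
pose a := if e then xi None else 0.
have FE : delta eta F = a * F.
  have S : \sum_l eta l * sD l F = \sum_l xi (Some l) * sgens e f h (Some l).
    by apply: eq_bigr => l _; rewrite sgens_deriv.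
  have dF : sder F = serC h by rewrite /F sderD sderC sderX sderC mulr0 addr0 add0r.
  rewrite /delta S dF xiE big_optionE.
  rewrite addrK /a; case: (e) => //.
  rewrite /sgens -[gens false f None]/(0 : B) -[gens false h None]/(0 : B).
  by rewrite rmorph0 mulr0 addr0 mulr0 mul0r.
have [E [EE E0]] := delta_exists char0 eta a 1.
exists pi, E; split=> //.
- move=> ee; apply: (@delta_uniq1 _ _ _ _ char0 eta a) => //.
  rewrite /a (negbTE ee) mul0r -(rmorph1 (@serC B)) /delta sderC sub0r.
  by rewrite big1 ?oppr0 // => l _; rewrite sDC -(scale1r 1) cps_derivC rmorph0 mulr0.
- apply: (@delta_uniq1 _ _ _ _ char0 eta a) => //.
    by rewrite deltaM EE pid mulr0 addr0 mulrA.
  by rewrite serD serXM serM0 E0 pi0 mul1r addr0.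
- split=> // [c|i b]; [exact: (flow_alg char0 pid pi0)|exact: (flow_chain char0 pid pi0)].
Qed.

Lemma ser_ev0_eq0 (c : ser B) : (forall i, ev0 (c i) = 0) <-> ser_map (@ev0 _ _ v n) c = 0.
Proof.
split=> [c0|c0 i]; first by apply/serP => i; exact: c0.
by have := congr1 (fun a : ser K => a i) c0.
Qed.

(* The flow fixes the origin: along its orbit [f] and its derivatives vanish,
   so a power of each coordinate does. *)
Lemma flow_base e f h (pi : {rmorphism B -> ser B}) (E : ser B) :
  ordge 2 f -> ordge 2 h -> (forall l, exists r, tangent e 0 f (xv l ^+ r)) ->
  E 0%N = 1 -> serC f + serX * serC h = E * pi f ->
  (forall b, pi b 0%N = b) ->
  (forall i b, sD i (pi b) = \sum_l pi (cps_deriv l b) * sD i (pi (xv l))) ->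
  forall l j, ev0 (pi (xv l) j) = 0.
Proof.
move=> f2 h2 nil E0 FE pi0 chain.
pose eps : {rmorphism ser B -> ser K} := ser_map (@ev0 _ _ v n).
have epsF (F1 F2 : B) : ordge 1 F1 -> ordge 1 F2 -> eps (serC F1 + serX * serC F2) = 0.
  move=> /ev0P F10 /ev0P F20; apply/ser_ev0_eq0 => i.
  rewrite serD serXM raddfD serCE /=; case: i => [|i] /=; first by rewrite F10 raddf0 addr0.
  by rewrite raddf0 add0r; case: eqP => _; rewrite ?F20 ?raddf0.
have E1 : eps E <> 0.
  move=> /(congr1 (fun a : ser K => a 0%N)) /=; rewrite E0 rmorph1 => /eqP.
  by rewrite oner_eq0.
have cancelE x : eps (E * x) = 0 -> eps x = 0.
  by rewrite rmorphM => /ser_integral[/E1|].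
have f1 := ordgeW (isT : (1 <= 2)%N) f2; have h1 := ordgeW (isT : (1 <= 2)%N) h2.
have pf : eps (pi f) = 0 by apply: cancelE; rewrite -FE; exact: epsF.
pose u l := eps (pi (cps_deriv l f)).
pose M i l := eps (sD i (pi (xv l))).
have uM i : \sum_l u l * M i l = 0.
  have : eps (sD i (pi f)) = 0.
    apply: cancelE.
    have -> : E * sD i (pi f) = sD i (serC f + serX * serC h) - sD i E * pi f.
      by rewrite FE sDM addrAC subrr add0r.
    rewrite rmorphB rmorphM pf mulr0 subr0.
    by rewrite sDD sDX !sDC; apply: epsF; exact: ordge_deriv.
  by rewrite chain rmorph_sum; under eq_bigr do rewrite rmorphM.
have M0 i l : M i l 0%N = (i == l)%:R.
  rewrite /M /= pi0 cps_derivX; by case: eqP => _; rewrite ?rmorph1 ?rmorph0.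
(* At s = 0 the Jacobian [M] of the flow at the origin is the identity, so u M = 0 determines u to
   be zero, one power of s at a time. *)
have u0 l : u l = 0.
  apply/serP => k; elim/ltn_ind: k l => k IH i.
  have := congr1 (fun a : ser K => a k) (uM i); rewrite ser_sum ser0 => <-.
  have uMk l : (u l * M i l) k = u l k * (i == l)%:R.
    rewrite serM big_ord_recr big1 => [|q _]; last by rewrite IH ?mul0r ?(ltn_ord q).
    by rewrite -[LHS]/(0 + u l k * M i l (k - k)%N) add0r subnn M0.
  under eq_bigr do rewrite uMk.
  rewrite (bigD1 i) //= eqxx mulr1 big1 ?addr0 // => l li.
  by rewrite eq_sym (negbTE li) mulr0.
move=> l; apply/ser_ev0_eq0; have [r [xi [_ xr]]] := nil l.
have : eps (pi (xv l)) ^+ r = 0.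
  rewrite -!rmorphXn xr rmorph_sum rmorph_sum big1 // => a _.
  rewrite !rmorphM; case: a => [i|]; first by rewrite [X in _ * X]u0 mulr0.
  by rewrite /gens; case: (e); rewrite ?pf ?rmorph0 mulr0.
elim: r {xr} => [/eqP|r IH]; first by rewrite expr0 oner_eq0.
by rewrite exprS => /ser_integral[].
Qed.

End Family.

(** * Specialization *)

Section PolyEval.
Variables (P L : comNzRingType) (theta : {rmorphism P -> L}) (y : L).
Definition map_eval (p : {poly P}) : L := (map_poly theta p).[y].
Lemma map_eval_is_zmod_morphism : zmod_morphism map_eval.
Proof. by move=> p q; rewrite /map_eval rmorphB hornerD hornerN. Qed.
HB.instance Definition _ :=
  GRing.isZmodMorphism.Build {poly P} L map_eval map_eval_is_zmod_morphism.
Lemma map_eval_is_monoid_morphism : monoid_morphism map_eval.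
Proof.
by split=> [|p q]; rewrite /map_eval ?rmorph1 ?hornerC // rmorphM hornerM.
Qed.
HB.instance Definition _ :=
  GRing.isMonoidMorphism.Build {poly P} L map_eval map_eval_is_monoid_morphism.
Lemma map_evalC c : map_eval c%:P = theta c.
Proof. by rewrite /map_eval map_polyC hornerC. Qed.
Lemma map_evalX : map_eval 'X = y.
Proof. by rewrite /map_eval map_polyX hornerX. Qed.
Lemma map_eval0 p : map_poly theta p = 0 -> map_eval p = 0.
Proof. by rewrite /map_eval => ->; rewrite horner0. Qed.
Lemma map_evalZ c p : map_eval (c *: p) = theta c * map_eval p.
Proof. by rewrite /map_eval map_polyZ hornerZ. Qed.
End PolyEval.

Section Specialization.
Import Pdiv.CommonRing Pdiv.ComRing.
Variables (K : closedFieldType) (L : comNzRingType) (iota : {rmorphism {poly K} -> L}).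
Hypothesis iota_inj : injective iota.
Hypothesis L_integral : forall x y : L, x * y = 0 -> x = 0 \/ y = 0.

Lemma exp_neq0_integral (x : L) k : x <> 0 -> x ^+ k <> 0.
Proof.
move=> x0; elim: k => [|k IH]; first by move/eqP; rewrite expr0 oner_eq0.
by rewrite exprS => /L_integral[].
Qed.

(* A subring of [L] is presented as a quotient of a polynomial ring [P]: all but
   finitely many points [t] of the line lift to points of its spectrum, off any
   given proper closed subset. *)
Definition specializable (P : comNzRingType) (c : {rmorphism {poly K} -> P})
    (theta : {rmorphism P -> L}) :=
  (forall p, theta (c p) = iota p) /\
  forall b, theta b <> 0 -> exists2 a : {poly K}, a != 0 &
    forall t, a.[t] != 0 -> exists psi : {rmorphism P -> K},
      [/\ forall p, psi (c p) = p.[t], psi b != 0 & forall x, theta x = 0 -> psi x = 0].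

Lemma specializable_base : specializable idfun iota.
Proof.
split=> // b b0; exists b; first by apply/eqP => bE; apply: b0; rewrite bE rmorph0.
move=> t bt; exists (horner_eval t); split=> // x.
by rewrite -(rmorph0 iota) => /iota_inj ->; exact: rmorph0.
Qed.

Section Step.
Variables (P : comNzRingType) (c : {rmorphism {poly K} -> P}).
Variables (theta : {rmorphism P -> L}) (y : L).
Hypothesis spec : specializable c theta.
Local Notation theta' := (map_eval theta y).
Local Notation mt := (map_poly theta).

Lemma ker_map_psi (psi : {rmorphism P -> K}) p :
  (forall x, theta x = 0 -> psi x = 0) -> mt p = 0 -> map_poly psi p = 0.
Proof.
move=> ker p0; apply/polyP => i; rewrite coef_map coef0; apply: ker.
by rewrite -coef_map /= p0 coef0.
Qed.

(** Over the fraction field of theta(P) the image of the ideal [Q] would be principal. Without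
    denominators, an element of least degree in the image still divides the others up to powers of
    its leading coefficient, by pseudo-division. *)
Lemma pseudo_generator (Q : {poly P} -> Prop) :
  (forall p q, Q p -> Q q -> Q (p - q)) -> (forall a p, Q p -> Q (a * p)) ->
  (forall p, mt p = 0 -> Q p) -> (exists p, Q p /\ mt p <> 0) ->
  exists r, [/\ Q r, theta (lead_coef r) <> 0 &
    forall p, Q p -> exists k q, mt (lead_coef r ^+ k *: p - q * r) = 0].
Proof.
move=> QB QM Q0 [p0 [Qp0 p00]].
pose S m := `[< exists p, [/\ Q p, mt p <> 0 & size (mt p) = m] >].
have exS : exists m, S m by exists (size (mt p0)); apply/asboolP; exists p0.
case: (ex_minnP exS) => N /asboolP[p1 [Qp1 p10 sp1]] Nmin.
(* Cutting off the top coefficients, which [theta] kills, makes the leading coefficient of [r]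
   itself nonzero in [L]. *)
pose r := \poly_(i < N) p1`_i.
have mr : mt r = mt p1.
  apply/polyP => i; rewrite !coef_map coef_poly; case: ltnP => // Ni.
  by rewrite raddf0 -coef_map /= nth_default // sp1.
have N0 : (0 < N)%N by rewrite -sp1 size_poly_gt0; apply/eqP.
have lr0 : theta p1`_N.-1 <> 0.
  by move: p10; rewrite -coef_map /= -sp1 -lead_coefE => p10 /eqP; rewrite lead_coef_eq0 => /eqP.
have sr : size r = N.
  by rewrite size_poly_eq //; apply/eqP => pE; apply: lr0; rewrite pE rmorph0.
have lr : lead_coef r = p1`_N.-1 by rewrite lead_coefE sr coef_poly prednK // leqnn.
have Qr : Q r.
  have -> : r = p1 - (p1 - r) by rewrite opprB addrC subrK.
  by apply: QB => //; apply: Q0; rewrite rmorphB /= mr subrr.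
exists r; split=> //; first by rewrite lr.
move=> p Qp; exists (rscalp p r), (rdivp p r).
have -> : lead_coef r ^+ rscalp p r *: p - rdivp p r * r = rmodp p r.
  by rewrite rdivp_eq addrC addKr.
apply/eqP; apply: contraT => /eqP m0.
have r0 : r != 0 by rewrite -size_poly_gt0 sr.
have /Nmin : S (size (mt (rmodp p r))).
  apply/asboolP; exists (rmodp p r); split=> //.
  have -> : rmodp p r = lead_coef r ^+ rscalp p r *: p - rdivp p r * r.
    by rewrite rdivp_eq addrC addKr.
  by apply: QB; [rewrite -mul_polyC; exact: QM|exact: QM].
rewrite leqNgt; have := ltn_rmodpN0 p r0; rewrite sr => /(leq_ltn_trans _) -> //.
exact: size_poly.
Qed.

(** If y is transcendental over theta(P), a coefficient of b survives under [psi], and any nonroot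
    of the resulting polynomial can serve as the image of y. If y is algebraic, let r be its minimal
    polynomial up to denominators. Since b(y) is nonzero, b and r are coprime, so the ideal [J] of
    b, r and the kernel of the coefficient map contains a constant s not killed by [theta]. Any root
    of psi(r) then serves as the image of y, and psi(s) nonzero keeps b nonzero there. *)
Lemma specializable_step : specializable (polyC \o c) theta'.
Proof.
case: spec => cE sp; split=> [p|b b0]; first by rewrite /= map_evalC cE.
have [alg|tr] := pselect (exists p, theta' p = 0 /\ mt p <> 0); last first.
  have ker p : theta' p = 0 -> mt p = 0.
    by move=> p0; apply: contrapT => mp; apply: tr; exists p.
  have [i bi] : exists i, theta b`_i <> 0.
    apply: contrapT => nex; apply: b0; apply: map_eval0; apply/polyP => i.
    by rewrite coef_map coef0; apply: contrapT => bi; apply: nex; exists i.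
  have [a a0 aP] := sp _ bi; exists a => // t /aP[psi [psic psib psik]].
  have /closed_nonrootP[eta] : map_poly psi b != 0.
    by apply: contraNneq psib => b0'; rewrite -coef_map /= b0' coef0.
  move=> beta; exists (map_eval psi eta); split=> // [p|p /ker].
    by rewrite /= map_evalC.
  by move=> /(ker_map_psi psik); exact: map_eval0.
have [|||r [r0 lr rgen]] := @pseudo_generator (fun p => theta' p = 0) _ _ _ alg.
- by move=> p q p0 q0; rewrite rmorphB /= p0 q0 subrr.
- by move=> a p p0; rewrite rmorphM /= p0 mulr0.
- exact: map_eval0.
pose J q := exists u w z, [/\ q = u * b + w * r + z & mt z = 0].
have JM a p : J p -> J (a * p).
  move=> [u [w [z [-> z0]]]]; exists (a * u), (a * w), (a * z).
  by rewrite rmorphM /= z0 mulr0 !mulrDr !mulrA.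
have JD p q : J p -> J q -> J (p + q).
  move=> [u [w [z [-> z0]]]] [u' [w' [z' [-> z0']]]].
  exists (u + u'), (w + w'), (z + z'); rewrite rmorphD /= z0 z0' addr0; split=> //.
  by rewrite !mulrDl addrACA [X in X + _ = _]addrACA.
have [||||s [Js ls sgen]] := @pseudo_generator J.
- by move=> p q Jp Jq; apply: JD => //; rewrite -mulN1r; exact: JM.
- exact: JM.
- by move=> p p0; exists 0, 0, p; rewrite !mul0r !add0r.
- exists r; split; first by exists 0, 1, 0; rewrite mul0r mul1r add0r addr0 rmorph0.
  by move=> mr; apply: lr; rewrite lead_coefE -coef_map /= mr coef0.
have Jr : J r by exists 0, 1, 0; rewrite mul0r mul1r add0r addr0 rmorph0.
have Jb : J b by exists 1, 0, 0; rewrite mul0r mul1r !addr0 rmorph0.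
have s_y : theta' s <> 0.
  move=> s0; have [k [q /(map_eval0 y)]] := sgen _ Jb.
  rewrite rmorphB rmorphM /= s0 mulr0 subr0 map_evalZ rmorphXn => /L_integral[|//].
  exact: exp_neq0_integral.
have smt (p : {poly P}) : theta (lead_coef p) <> 0 -> size (mt p) = size p.
  by move=> lp; rewrite size_map_poly_id0 //; apply/eqP.
(* Up to a constant, r = q s over [L]. Since r(y) = 0 and s(y) is nonzero, q(y) = 0, so q has at
   least the degree of r by minimality, and nothing is left for s. *)
have ssz : size s = 1%N.
  have [k [q mq]] := sgen _ Jr.
  have mqE : mt q * mt s = theta (lead_coef s) ^+ k *: mt r.
    move/eqP: mq; rewrite rmorphB rmorphM /= subr_eq0 map_polyZ rmorphXn => /eqP.
    by move=> <-.
  have q_y : theta' q = 0.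
    have : theta' (lead_coef s ^+ k *: r - q * s) = 0 by exact: map_eval0.
    rewrite rmorphB rmorphM /= map_evalZ r0 mulr0 sub0r => /eqP.
    by rewrite oppr_eq0 => /eqP/L_integral[].
  have q0 : mt q <> 0.
    move=> q0; move: mqE; rewrite q0 mul0r => /(congr1 (fun p : {poly L} => p`_(size r).-1)).
    rewrite coef0 coefZ coef_map /= -lead_coefE => /esym/L_integral[|//].
    exact: exp_neq0_integral.
  have [k' [q' mq']] := rgen _ q_y.
  have sq : (size r <= size (mt q))%N.
    have q'r : theta (lead_coef r) ^+ k' *: mt q = mt q' * mt r.
      move/eqP: mq'; rewrite rmorphB rmorphM /= subr_eq0 map_polyZ rmorphXn => /eqP.
      by move=> <-.
    have q'0 : mt q' <> 0.
      move=> q'0; move: q'r; rewrite q'0 mul0r => /(congr1 (fun p : {poly L} => p`_(size (mt q)).-1)).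
      rewrite coef0 coefZ -lead_coefE => /L_integral[|/eqP].
        exact: exp_neq0_integral.
      by rewrite lead_coef_eq0 => /eqP.
    have := size_scale_leq (theta (lead_coef r) ^+ k') (mt q); rewrite q'r.
    rewrite size_proper_mul; last first.
      apply/eqP => /L_integral[/eqP|]; first by rewrite lead_coef_eq0 => /eqP.
      by rewrite lead_coef_map_eq //; apply/eqP.
    rewrite (smt r lr) => le; apply: leq_trans le.
    have: (0 < size (mt q'))%N by rewrite size_poly_gt0; apply/eqP.
    by case: (size (mt q')) => // m _; rewrite addSn /= leq_addl.
  have := size_scale_leq (theta (lead_coef s) ^+ k) (mt r); rewrite -mqE.
  rewrite size_proper_mul; last first.
    apply/eqP => /L_integral[/eqP|]; first by rewrite lead_coef_eq0 => /eqP.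
    by rewrite lead_coef_map_eq //; apply/eqP.
  rewrite (smt r lr) (smt s ls) => /leq_trans /(_ sq).
  have: (0 < size (mt q))%N by rewrite size_poly_gt0; apply/eqP.
  have: (0 < size s)%N.
    by rewrite size_poly_gt0; apply/eqP => s0; apply: ls; rewrite s0 lead_coef0 rmorph0.
  case: (size (mt q)) (size s) => [|m] [|[|l]] // _ _.
  by rewrite addSn /= addnS -addSn -[X in (_ <= X)%N]addn0 leq_add2l.
have sE : s = (lead_coef s)%:P.
  by rewrite {1}[s]size1_polyC ?ssz // lead_coefE ssz.
(* The previous stage is asked to keep both leading coefficients nonzero: that of r so that psi(r)
   keeps its positive degree and has a root, that of s for the Bezout relation. *)
have rs : theta (lead_coef r * lead_coef s) <> 0.
  by rewrite rmorphM => /L_integral[].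
have [a a0 aP] := sp _ rs; exists a => // t /aP[psi [psic]].
rewrite rmorphM mulf_eq0 negb_or => /andP[psir psis] psik.
have szr : size (map_poly psi r) = size r by rewrite size_map_poly_id0.
have /closed_rootP[eta /rootP re] : size (map_poly psi r) != 1%N.
  rewrite szr; apply/eqP => /eqP sr1.
  have rE : r = (lead_coef r)%:P.
    by rewrite {1}[r]size1_polyC ?(eqP sr1) // lead_coefE (eqP sr1).
  by apply: lr; rewrite -[LHS](map_evalC _ y) -rE.
have re' : map_eval psi eta r = 0 by [].
exists (map_eval psi eta); split=> [p||p p0]; first by rewrite /= map_evalC.
  have [u [w [z [sz z0]]]] := Js.
  apply: contraNneq psis => be0; rewrite -(map_evalC psi eta) -sE sz.
  rewrite !rmorphD !rmorphM /= be0 re' !mulr0 !add0r.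
  by rewrite (map_eval0 eta (ker_map_psi psik z0)).
have [k [q mq]] := rgen _ p0.
have := map_eval0 eta (ker_map_psi psik mq).
rewrite rmorphB rmorphM /= re' mulr0 subr0 map_evalZ rmorphXn => /eqP.
by rewrite mulf_eq0 expf_eq0 (negbTE psir) andbF => /eqP.
Qed.

End Step.

Lemma specialization (w : seq L) : exists (P : comNzRingType)
    (c : {rmorphism {poly K} -> P}) (theta : {rmorphism P -> L}) (x : seq P),
  specializable c theta /\ map theta x = w.
Proof.
elim: w => [|y w [P [c [theta [x [sp xw]]]]]].
  by exists {poly K}, idfun, iota, [::]; split=> //; exact: specializable_base.
exists {poly P}, (polyC \o c : {rmorphism _ -> _}), (map_eval theta y : {rmorphism _ -> _}).
exists ('X :: map polyC x); split; first exact: specializable_step.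
rewrite /= map_evalX -map_comp -xw; congr cons; apply: eq_map => z /=.
by rewrite map_evalC.
Qed.

End Specialization.

(** * Finite determinacy *)

Lemma big_pairE (V : nmodType) (I J : finType) (F : I * J -> V) :
  \sum_p F p = \sum_i \sum_j F (i, j).
Proof. by rewrite pair_bigA; apply: eq_bigr => -[]. Qed.

Section Taylor.
Variables (R : realType) (K : fieldType) (v : absval R K) (n : nat).
Local Notation B := (cps v n).
Local Notation B2 := (cps v (n + n)).
Local Notation xv := (cps_var v).
Local Notation xL i := (cps_var v (lshift n i)).
Local Notation xR i := (cps_var v (rshift n i)).
Implicit Types (f g h z : B) (F : B2) (e : bool) (Y : 'I_n -> B).

Definition left_only F := forall m, F @c m != 0 -> forall i, m (rshift n i) = 0%N.

Lemma split_right F : exists P : B2, exists2 G : 'I_n -> B2,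
  F = P + \sum_i xR i * G i & left_only P.
Proof.
pose S := [pred j : 'I_(n + n) | (n <= j)%N].
pose p : fps (n + n) K := FPS (fun m =>
  if [forall j in S, m j == 0%N] then F @c m else 0).
have [r r0 [M FM]] := cps_norm_le F.
have [|P PE _] := @norm_le_cps _ _ v _ r M p r0.
  move=> d; apply: le_trans (FM d); apply: ler_sum => m _.
  rewrite ler_wpM2r ?exprn_ge0 ?(ltW r0) //=.
  by case: ifP; rewrite ?absval0 ?absval_ge0.
have [|G GE _] := @hadamard _ _ v _ S (F - P).
  move=> m mS; rewrite cps_fpsB fcoefB PE /= ifT ?subrr //.
  by apply/forall_inP => j jS; rewrite mS.
exists P; exists (fun i => G (rshift n i)).
  rewrite -[F](subrK P) addrC GE; congr (_ + _).
  rewrite big_mkcond big_split_ord /= big1 ?add0r.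
    by apply: eq_bigr => i _; rewrite inE /= leq_addr.
  by move=> i _; rewrite inE /= leqNgt ltn_ord.
move=> m; rewrite PE /=; case: ifP => [/forall_inP mS _ i|_ /eqP //].
by apply/eqP/mS; rewrite inE /= leq_addr.
Qed.

Definition pairfam (Y : 'I_n -> B) (j : 'I_(n + n)) : B :=
  match split j with inl i => xv i | inr i => Y i end.

Lemma pairfamL Y i : pairfam Y (lshift n i) = xv i.
Proof. by rewrite /pairfam -[lshift n i]/(unsplit (inl i)) unsplitK. Qed.
Lemma pairfamR Y i : pairfam Y (rshift n i) = Y i.
Proof. by rewrite /pairfam -[rshift n i]/(unsplit (inr i)) unsplitK. Qed.

Lemma pairfam1 Y : in_max Y -> forall j, ordge 1 (pairfam Y j).
Proof.
move=> Y1 j; rewrite /pairfam; case: split => i; [exact: (ordge_cpsX v i)|exact: Y1].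
Qed.

Lemma shift1 Y : in_max Y -> forall i, ordge 1 (xv i + Y i).
Proof. by move=> Y1 i; apply: ordgeD; [exact: (ordge_cpsX v i)|exact: Y1]. Qed.

Lemma tsubst_left Y F : in_max Y -> left_only F ->
  tsubst (pairfam Y) F = tsubst (pairfam (fun=> 0)) F.
Proof.
move=> Y1 FL; have Z1 : in_max (fun _ : 'I_n => 0 : B) by move=> i; exact: ordge_zero.
rewrite (tsubst_fam _ (pairfam1 Y1)) (tsubst_fam _ (pairfam1 Z1)).
apply: val_inj; apply: fps_subst_eq => m j /FL mR mj /=.
case: (splitP j) (mj) => [i ji|i ji].
  have -> : j = lshift n i by exact: val_inj.
  by rewrite !pairfamL.
have -> : j = rshift n i by exact: val_inj.
by rewrite mR.
Qed.

(** The expansion is made once for all Y, in 2n variables: f(x_L + x_R) is divided twice by the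
    right-hand variables. The parts free of these are recognized by setting Y = 0; the [H i j] do
    not depend on Y. *)
Lemma taylor f : exists H : 'I_n -> 'I_n -> B2, forall Y : 'I_n -> B, in_max Y ->
  tsubst (fun i => xv i + Y i) f =
  f + \sum_i Y i * cps_deriv i f +
  \sum_i \sum_j Y i * Y j * tsubst (pairfam Y) (H i j).
Proof.
have W1 i : ordge 1 (xL i + xR i) by apply: ordgeD; exact: ordge_cpsX.
pose W := LocFam W1; pose SW : {lrmorphism B -> B2} := cps_subst W.
have [P [G FE PL]] := split_right (SW f).
have /choice[PG /choice[H GE]] : forall i, exists P, exists H : 'I_n -> B2,
    G i = P + \sum_j xR j * H j /\ left_only P.
  by move=> i; have [P' [H GE P'L]] := split_right (G i); exists P', H.
exists H => Y Y1.
have Z1 : in_max (fun _ : 'I_n => 0 : B) by move=> i; exact: ordge_zero.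
pose SZ Y' (hY : in_max Y') : {lrmorphism B2 -> B} := cps_subst (LocFam (pairfam1 hY)).
have SZE Y' hY (g : B2) : tsubst (pairfam Y') g = SZ Y' hY g by exact: tsubst_fam.
have SZL Y' hY i : SZ Y' hY (xL i) = xv i.
  by rewrite [LHS](cps_substX (LocFam (pairfam1 hY))) /= pairfamL.
have SZR Y' hY i : SZ Y' hY (xR i) = Y' i.
  by rewrite [LHS](cps_substX (LocFam (pairfam1 hY))) /= pairfamR.
have comp Y' hY g : SZ Y' hY (SW g) = cps_subst (LocFam (shift1 hY)) g.
  apply: (@hom_eq _ _ v n n (SZ Y' hY \o SW)) => i; first exact: cps_subst_loc.
  rewrite /= [SW _](cps_substX W) rmorphD /= SZL SZR.
  by rewrite -[RHS]/(cps_subst (LocFam (shift1 hY)) (xv i)) cps_substX.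
have comp0 g : SZ _ Z1 (SW g) = g.
  rewrite comp; apply: (@hom_eq _ _ v n n (cps_subst (LocFam (shift1 Z1))) idfun) => i.
    exact: (ordge_cpsX v i).
  by rewrite -[LHS]/(cps_subst _ _) cps_substX /= addr0.
have SP : SZ Y Y1 P = f.
  rewrite -SZE tsubst_left // (SZE _ Z1) -[RHS]comp0 FE rmorphD rmorph_sum /=.
  by rewrite big1 ?addr0 // => i _; rewrite rmorphM /= SZR mul0r.
(* Differentiating f(x_L + x_R) in the i-th right-hand variable and then setting these variables to
   zero leaves exactly [PG i]. *)
have SPG i : SZ Y Y1 (PG i) = cps_deriv i f.
  have [GEi PLi] := GE i.
  rewrite -SZE tsubst_left // (SZE _ Z1) -[RHS]comp0.
  have -> : SW (cps_deriv i f) = cps_deriv (rshift n i) (SW f).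
    rewrite chain_rule; last exact: cps_subst_loc.
    rewrite (bigD1 i) //= [SW (xv i)](cps_substX W) cps_derivD !cps_derivX eqxx.
    rewrite eq_rlshift add0r mulr1 big1 ?addr0 // => l li.
    rewrite [SW (xv l)](cps_substX W) cps_derivD !cps_derivX eq_rlshift eq_rshift.
    by rewrite eq_sym (negbTE li) addr0 mulr0.
  rewrite FE cps_derivD cps_deriv_sum.
  have -> : cps_deriv (rshift n i) P = 0.
    apply: cpsP => m; rewrite cps_fps_deriv fcoef_deriv cps_fps0 fcoef0.
    have [->|/PL/(_ i)] := eqVneq (P @c (m + U_(rshift n i))%MM) 0; first by rewrite mul0rn.
    by rewrite mnmDE mnm1E eqxx addn1.
  have T l : SZ _ Z1 (cps_deriv (rshift n i) (xR l * G l)) = (i == l)%:R * SZ _ Z1 (G l).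
    rewrite cps_derivM cps_derivX eq_rshift rmorphD !rmorphM /= SZR mul0r addr0.
    by case: eqP => _; rewrite ?rmorph1 ?rmorph0.
  rewrite add0r rmorph_sum (bigD1 i) // big1 => [|l li]; last first.
    by rewrite [LHS]T eq_sym (negbTE li) mul0r.
  rewrite /= addr0 T eqxx mul1r.
  rewrite GEi rmorphD rmorph_sum /= big1 ?addr0 // => l _.
  by rewrite rmorphM /= SZR mul0r.
rewrite (tsubst_fam _ (shift1 Y1)) -comp FE rmorphD rmorph_sum /= SP -addrA; congr (_ + _).
rewrite -big_split /=; apply: eq_bigr => i _; rewrite rmorphM /= SZR.
rewrite (proj1 (GE i)) rmorphD rmorph_sum /= SPG mulrDr mulr_sumr; congr (_ + _).
apply: eq_bigr => j _; rewrite rmorphM /= SZR mulrA; congr (_ * _).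
by rewrite SZE.
Qed.

(* Solve [(1 + c y_0) f(x + y) = f + h] with the ansatz [y_a = sum_b u_ab D_b], where
   the [D_b] generate the tangent ideal. Since [h] is a combination of the products
   [D_a D_b], comparing their coefficients leaves a fixed point equation for [u]. *)
Lemma determinacy e f M h : ordge 2 f ->
  (forall z, ordge M z -> tangent e 0 f z) -> ordge (M + M.+1) h ->
  rcequiv e (f + h) f.
Proof.
move=> f2 Mf hM; pose D a := gens e f a; pose c : B := e%:R.
have D1 a : ordge 1 (D a).
  case: a => [i|]; first exact: ordge_deriv.
  by rewrite /D /=; case: (e); [exact: ordgeW f2|exact: ordge_zero].
have DNone : D None = c * f by rewrite /D /c /=; case: (e); rewrite ?mul1r ?mul0r.
(* Of the order 2M+1, each of the two expansions in the generators consumes M. The coefficients [A]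
   are left with order one, as [fixed_point] requires. *)
have [A' A'M hA'] := tangent_high Mf hM.
have /choice[A AP] : forall a, exists A : option 'I_n -> B,
    (forall b, ordge 1 (A b)) /\ A' a = \sum_b A b * D b.
  move=> a; have := A'M a; rewrite -addn1 => /(tangent_high Mf)[A A1 AE].
  by exists A.
have [H HE] := taylor f.
pose J := (option 'I_n * option 'I_n)%type.
pose y (u : J -> B) a := \sum_b u (a, b) * D b.
(* Coefficients of the products y_q y_q' in the nonlinear part of (1 + c y_0) f(x + y): the cross
   term of y_0 with the gradient, and the Taylor remainder times the unit. *)
pose G (q q' : option 'I_n) (u : J -> B) : B :=
  match q, q' with
  | None, Some i => c * D (Some i)
  | Some i, Some j =>
    (1 + c * y u None) * tsubst (fun l => pairfam (fun i => y u (Some i)) l) (H i j)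
  | _, _ => 0
  end.
have ys a : small_op (fun u : J -> B => y u a).
  apply: small_op_sum => b; apply: small_op_mul; first exact: small_op_proj.
  exact: analytic_op_const.
have Ga q q' : analytic_op (G q q').
  case: q q' => [i|] [j|] /=; try exact: analytic_op_const.
  apply: analytic_op_mul.
    apply: analytic_op_add; first exact: analytic_op_const.
    by apply: analytic_op_mul; [exact: analytic_op_const|exact: small_op_analytic].
  apply: (@analytic_op_subst _ _ _ _ _ _ (fun l u => pairfam (fun i => y u (Some i)) l)) => l.
  rewrite /pairfam; case: split => i'; last exact: ys.
  by apply: small_op_const; exact: (ordge_cpsX v i').
(* The product y_q y_q' is the sum of u_(q,a) u_(q',b) D_a D_b, so a pair of unknowns feeds the
   equation at (a, b) only if its second indices are a and b. *)
pose Gam (p q q' : J) (u : J -> B) : B :=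
  if (q.2 == p.1) && (q'.2 == p.2) then - G q.1 q'.1 u else 0.
have [||u u1 uE] := @fixed_point _ _ v n J (fun p => A p.1 p.2) Gam.
- by move=> p; exact: (proj1 (AP p.1)).
- move=> p q q'; rewrite /Gam; case: andP => _; last exact: analytic_op_const.
  under [fun u => _]eq_fun do rewrite -mulN1r; apply: analytic_op_mul => //.
  exact: analytic_op_const.
have uE' a b : u (a, b) + \sum_q \sum_q' u (q, a) * u (q', b) * G q q' u = A a b.
  rewrite {1}uE big_pairE /=.
  rewrite -addrA -big_split /= big1 ?addr0 // => q _.
  rewrite (bigD1 a) //= [X in _ + X + _]big1 ?addr0; last first.
    by move=> a' aa; rewrite big1 // => q' _; rewrite /Gam /= (negbTE aa) mulr0.
  rewrite big_pairE -big_split /= big1 // => q' _.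
  rewrite (bigD1 b) //= [X in _ + X + _]big1 ?addr0; last first.
    by move=> b' bb; rewrite /Gam /= (negbTE bb) andbF mulr0.
  by rewrite /Gam /= !eqxx /= mulrN addNr.
pose Y i := y u (Some i); pose y0 := y u None.
have y2 a : ordge 2 (y u a).
  rewrite /y cps_fps_sum; apply: ordge_sum => b _.
  by apply: (@ordgeM _ _ 1 1); [exact: u1|exact: D1].
have Y1 : in_max Y by move=> i; apply: ordgeW (y2 _).
pose phi : {lrmorphism B -> B} := cps_subst (LocFam (shift1 Y1)).
exists phi, (1 + c * y0); split.
- apply: subst_local_aut => /=.
  suff -> : jac (fun i => xv i + Y i) = 1%:M by exact: unitmx1.
  rewrite -(jac_id v n); apply/matrixP => i l; rewrite !mxE cps_derivD raddfD /=.
  have /ev0P -> : ordge 1 (cps_deriv l (Y i)) by apply: ordge_deriv; exact: y2.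
  by rewrite addr0.
- apply: cps_unitP; rewrite raddfD /= rmorph1 rmorphM /=.
  have /ev0P -> : ordge 1 y0 by exact: ordgeW (y2 None).
  by rewrite mulr0 addr0 oner_neq0.
- by move=> /negbTE ee; rewrite /c ee mul0r addr0.
- have -> : phi f = tsubst (fun i => xv i + Y i) f by exact: esym (tsubst_fam _ (shift1 Y1)).
  rewrite HE //.
  have hE : h = \sum_a \sum_b A a b * (D a * D b).
    rewrite hA'; apply: eq_bigr => a _; rewrite (proj2 (AP a)) mulr_suml.
    by apply: eq_bigr => b _; rewrite -mulrA [D b * _]mulrC.
  have hy : h = \sum_a D a * y u a + \sum_q \sum_q' y u q * y u q' * G q q' u.
    rewrite hE; under eq_bigr => a _ do under eq_bigr => b _ do rewrite -uE' mulrDl.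
    under eq_bigr do rewrite big_split /=.
    rewrite big_split /=; congr (_ + _).
      apply: eq_bigr => a _; rewrite /y mulr_sumr; apply: eq_bigr => b _; ring.
    under eq_bigr => a _ do under eq_bigr => b _ do rewrite mulr_suml.
    under eq_bigr => a _ do rewrite exchange_big /=.
    rewrite exchange_big /=; apply: eq_bigr => q _.
    under eq_bigr => a _ do under eq_bigr => b _ do rewrite mulr_suml.
    under eq_bigr => a _ do rewrite exchange_big /=.
    rewrite exchange_big /=; apply: eq_bigr => q' _.
    rewrite {1 2}/y big_distrlr /= mulr_suml; apply: eq_bigr => a _.
    rewrite mulr_suml; apply: eq_bigr => b _; ring.
  set T := \sum_i \sum_j Y i * Y j * _.
  have Q0 : \sum_q' y u None * y u q' * G None q' u = c * y0 * \sum_i Y i * cps_deriv i f.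
    rewrite big_optionE mulr0 add0r mulr_sumr; apply: eq_bigr => i _.
    by rewrite /G -/y0 -/(Y i) -[D _]/(cps_deriv i f); ring.
  have QS : \sum_i \sum_q' y u (Some i) * y u q' * G (Some i) q' u = (1 + c * y0) * T.
    rewrite /T mulr_sumr; apply: eq_bigr => i _.
    rewrite big_optionE mulr0 add0r mulr_sumr; apply: eq_bigr => j _.
    by rewrite /G -/y0 -/(Y i) -/(Y j); ring.
  have S1 : \sum_i D (Some i) * y u (Some i) = \sum_i Y i * cps_deriv i f.
    by apply: eq_bigr => i _; rewrite mulrC.
  by rewrite hy 2!big_optionE Q0 QS S1 DNone -/y0; ring.
Qed.

End Taylor.

(** * Polynomials as series in the parameter and in the variables *)

Section PolySer.
Variable K : fieldType.
Definition ser_of_poly (p : {poly K}) : ser K := Ser (fun i => p`_i).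
Lemma ser_of_poly_is_zmod_morphism : zmod_morphism ser_of_poly.
Proof. by move=> p q; apply/serP => i /=; rewrite coefB. Qed.
HB.instance Definition _ :=
  GRing.isZmodMorphism.Build {poly K} (ser K) ser_of_poly ser_of_poly_is_zmod_morphism.
Lemma ser_of_poly_is_monoid_morphism : monoid_morphism ser_of_poly.
Proof.
split=> [|p q]; apply/serP => i; first by rewrite ser1 /= coef1.
by rewrite serM /= coefM.
Qed.
HB.instance Definition _ :=
  GRing.isMonoidMorphism.Build {poly K} (ser K) ser_of_poly ser_of_poly_is_monoid_morphism.
Lemma ser_of_poly_inj : injective ser_of_poly.
Proof.
by move=> p q pq; apply/polyP => i; have := congr1 (fun a : ser K => a i) pq.
Qed.
Lemma ser_of_polyC c : ser_of_poly c%:P = serC c.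
Proof. by apply/serP => i; rewrite /= coefC. Qed.
Lemma ser_of_polyX : ser_of_poly 'X = serX.
Proof. by apply/serP => i; rewrite /= coefX. Qed.
End PolySer.

Lemma rmorph_mmap n (S T U : comNzRingType) (chi : {rmorphism T -> U})
    (h : S -> T) (y : 'I_n -> T) (p : {mpoly S[n]}) :
  chi (mmap h y p) = mmap (chi \o h) (chi \o y) p.
Proof.
rewrite /mmap rmorph_sum; apply: eq_bigr => m _; rewrite rmorphM /mmap1 rmorph_prod.
by congr (_ * _); apply: eq_bigr => i _; rewrite rmorphXn.
Qed.

Lemma eq_mmap n (S T : comNzRingType) (h h' : S -> T) (y y' : 'I_n -> T)
    (p : {mpoly S[n]}) : h =1 h' -> y =1 y' -> mmap h y p = mmap h' y' p.
Proof.
move=> hh yy; rewrite /mmap; apply: eq_bigr => m _; rewrite hh; congr (_ * _).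
by apply: eq_bigr => i _; rewrite yy.
Qed.

Section PolyCps.
Variables (R : realType) (K : fieldType) (v : absval R K) (n : nat).
Local Notation B := (cps v n).
Local Notation xv := (cps_var v).

Definition cps_of_mpoly : {mpoly K[n]} -> B := mmap (in_alg B) (xv (n := n)).
HB.instance Definition _ := GRing.RMorphism.on cps_of_mpoly.

Lemma cps_mmap1 (m : 'X_{1..n}) : fps_of_cps (mmap1 (xv (n := n)) m) = fps_delta m 1.
Proof.
elim: {m}(mdeg m) {-2}m (erefl (mdeg m)) => [|d IH] m md.
  have -> : m = 0%MM by apply/eqP; rewrite -mdeg_eq0 md.
  by rewrite mmap11.
have [i mi] : exists i, (0 < m i)%N.
  apply: contrapT => mn; move: md; rewrite mdegE big1 // => i _.
  by case: (posnP (m i)) => // mi; case: mn; exists i.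
have um : (U_(i) <= m)%MM.
  by apply/mnm_lepP => j; rewrite mnm1E; case: eqP => //= <-.
have := congr1 (@mdeg n) (submK um); rewrite mdegD mdeg1 addn1 md => -[mdU].
have -> : mmap1 (xv (n := n)) m = xv i * mmap1 (xv (n := n)) (m - U_(i))%MM.
  rewrite -{1}(submK um) addmC commr_mmap1_M ?mmap1U // => j x.
  exact: mulrC.
rewrite cps_fpsM IH //.
apply/fpsP => k; rewrite fcoefXM /=.
case: posnP => ki; last first.
  have uk : (U_(i) <= k)%MM.
    by apply/mnm_lepP => j; rewrite mnm1E; case: eqP => //= <-.
  by congr (_ *+ _); rewrite -[in RHS](submK uk) -[in RHS](submK um) (inj_eq (@addIm _ _)).
by case: eqP => // km; move: mi; rewrite -km ki.
Qed.

Lemma coef_cps_of_mpoly p m : (cps_of_mpoly p) @c m = p@_m.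
Proof.
rewrite /cps_of_mpoly /mmap cps_fps_sum fcoef_sum [in RHS](mpolyE p) raddf_sum.
apply: eq_bigr => k _.
have -> : in_alg B p@_k * mmap1 (xv (n := n)) k = p@_k *: mmap1 (xv (n := n)) k.
  exact: mulr_algl.
rewrite cps_fpsZ fcoefZ cps_mmap1 [RHS]mcoeffZ mcoeffX.
by rewrite /= eq_sym; case: eqP.
Qed.
End PolyCps.

(** * Jets of the family *)

Section Jets.
Variables (R : realType) (K : fieldType) (v : absval R K) (n N : nat).
Local Notation B := (cps v n).
Local Notation xv := (cps_var v).
Implicit Types (c d : ser B) (p q : {mpoly (ser K)[n]}) (m : 'X_{1..n}).

Definition coef_ser m c : ser K := Ser (fun j => (c j) @c m).

(* [p] is the [N]-jet of [c], with the order of the two expansions exchanged. *)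
Definition jet_of c p := forall m, (mdeg m < N)%N -> p@_m = coef_ser m c.

Lemma jet_ofD c d p q : jet_of c p -> jet_of d q -> jet_of (c + d) (p + q).
Proof. by move=> cp dq m mN; rewrite mcoeffD cp // dq //; apply/serP. Qed.

Lemma jet_of0 : jet_of 0 0.
Proof. by move=> m mN; rewrite mcoeff0; apply/serP. Qed.

Lemma jet_ofC k : jet_of (serC (k%:A : B)) (serC k)%:MP.
Proof.
move=> m mN; rewrite mcoeffC -(rmorph_nat (@serC K)) -rmorphM; apply/serP => j.
rewrite -[RHS]/((serC (k%:A : B) j) @c m) !serCE; case: (j == 0%N) => //.
Qed.

Lemma jet_of1 : jet_of 1 1.
Proof. by have := jet_ofC 1; rewrite scale1r rmorph1 mpolyC1. Qed.

Lemma jet_ofX c p : jet_of c p -> jet_of (serX * c) (serX *: p).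
Proof.
move=> cp m mN; rewrite mcoeffZ cp //; apply/serP => j.
by rewrite -[RHS]/(((serX * c) j) @c m) !serXM; case: j.
Qed.

Lemma jet_ofM c d p q : jet_of c p -> jet_of d q -> jet_of (c * d) (p * q).
Proof.
move=> cp dq m mN; rewrite mcoeffM; apply/serP => j.
rewrite -[RHS]/(((c * d) j) @c m) ser_sum serM cps_fps_sum fcoef_sum.
under [RHS]eq_bigr do rewrite cps_fpsM fcoefM.
rewrite exchange_big /=; apply: eq_bigr => k _.
apply: eq_bigr => i _; have iN l : (mdeg (l : 'X_{1..n < (mdeg m).+1}) < N)%N.
  exact: leq_trans (bmdeg l) mN.
by rewrite cp ?dq.
Qed.

Lemma jet_of_sum I (r : seq I) (F : I -> ser B) (G : I -> {mpoly (ser K)[n]}) :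
  (forall i, jet_of (F i) (G i)) -> jet_of (\sum_(i <- r) F i) (\sum_(i <- r) G i).
Proof.
move=> FG; elim/big_rec2: _ => [|i p c _ cp]; first exact: jet_of0.
exact: jet_ofD.
Qed.

Lemma jet_of_mmap (S : comNzRingType) (h : S -> ser B) (h' : S -> {mpoly (ser K)[n]})
    (y : 'I_n -> ser B) (y' : 'I_n -> {mpoly (ser K)[n]}) (p : {mpoly S[n]}) :
  (forall s, jet_of (h s) (h' s)) -> (forall i, jet_of (y i) (y' i)) ->
  jet_of (mmap h y p) (mmap h' y' p).
Proof.
move=> hh yy; apply: jet_of_sum => m; apply: jet_ofM => //.
apply: (big_ind2 (fun c q => jet_of c q)); first exact: jet_of1.
  by move=> *; exact: jet_ofM.
by move=> i _; elim: (m i) => [|k IH]; [exact: jet_of1|rewrite !exprS; exact: jet_ofM].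
Qed.

Lemma jet_of_eq c d p : (forall j, ordge N (c j - d j)) -> jet_of c p -> jet_of d p.
Proof.
move=> cd cp m mN; rewrite cp //; apply/serP => j /=.
by move: (cd j) => /ordgeBP; exact.
Qed.

End Jets.

(** * Specialization of the jet of the flow at points of the parameter line *)

Section Specialize.
Variables (R : realType) (K : closedFieldType) (v : absval R K) (n : nat).
Local Notation B := (cps v n).
Local Notation xv := (cps_var v).

Lemma flow_ordge (pi : {rmorphism B -> ser B}) d (f : B) :
  (forall l j, ev0 (pi (xv l) j) = 0) -> ordge d f -> forall j, ordge d (pi f j).
Proof.
move=> pi1; elim: d f => [|d IH] f fd j; first exact: ordge0.
have [w fE wd] := hadamard1 (ordgeW (ltn0Sn d) fd).
rewrite fE rmorph_sum ser_sum cps_fps_sum; apply: ordge_sum => i _.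
rewrite rmorphM serM cps_fps_sum; apply: ordge_sum => k _.
apply: (@ordgeM _ _ 1 d); first by apply/ev0P; exact: pi1.
exact/IH/wd.
Qed.

(** Modulo order N+2 in x, the identity f + s h = E pi(f) amounts to finitely many polynomial
    equations over K[s] in the jet coefficients of E and of the [pi (x_l)]. These coefficients are
    elements of K[[s]], so [specialization] provides solutions in [K] for almost all s = t. *)
Lemma family_specialize e (f h : B) (pi : {rmorphism B -> ser B}) (E : ser B) N :
  E 0%N = 1 -> (~~ e -> E = 1) -> serC f + serX * serC h = E * pi f ->
  (forall b, pi b 0%N = b) -> (forall k, pi k%:A = serC k%:A) ->
  (forall l j, ev0 (pi (xv l) j) = 0) ->
  exists2 a : {poly K}, a != 0 & forall t, a.[t] != 0 ->
    exists phi : {lrmorphism B -> B}, exists u : B,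
      [/\ is_local_aut phi, u \is a GRing.unit, ~~ e -> u = 1 &
          ordge N.+2 (f + t *: h - u * phi f)].
Proof.
(* With N+2 the jets contain the constant and linear terms for every N; these decide whether [u] is
   a unit and [phi] an automorphism. *)
move=> E0 eE FE pi0 piC pi1; set N2 := N.+2.
pose J : finType := (option 'I_n * 'X_{1..n < N2})%type.
pose cc (a : option 'I_n) : ser B := if a is Some l then pi (xv l) else E.
pose wv (p : J) : ser K := coef_ser p.2 (cc p.1).
pose iota : {rmorphism {poly K} -> ser K} := @ser_of_poly K.
have [P [c [theta [x [[cE sp] xw]]]]] := specialization (@ser_of_poly_inj K : injective iota)
  (@ser_integral K) [seq wv p | p <- enum {: J}].
pose U (p : J) : P := x`_(enum_rank p).
have szx : size x = #|{: J}| by rewrite -(size_map theta) xw size_map cardE.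
have thU p : theta (U p) = wv p.
  rewrite /U -(nth_map 0 (theta 0)) ?szx // xw (nth_map p) -?cardE //.
  by rewrite nth_enum_rank.
pose Yu a : {mpoly P[n]} := \sum_(m : 'X_{1..n < N2}) U (a, m) *: 'X_[m].
have coefYu a (m : 'X_{1..n}) (mN : (mdeg m < N2)%N) : (Yu a)@_m = U (a, BMultinom mN).
  rewrite /Yu raddf_sum (bigD1 (BMultinom mN)) //= mcoeffZ mcoeffX eqxx mulr1.
  rewrite big1 ?addr0 // => k; rewrite -val_eqE /= => /negbTE km.
  by rewrite mcoeffZ mcoeffX km mulr0.
pose kap : {rmorphism K -> P} := c \o polyC.
pose Tf := fps_trunc N2 f; pose Th := fps_trunc N2 h.
pose S : {mpoly P[n]} := mmap (@mpolyC n P \o kap) (fun l => Yu (Some l)) Tf.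
(* The defect of the identity with generic coefficients [U]. Below order N2 its coefficients die
   under [theta], hence under every specialization [psi]. *)
pose W : {mpoly P[n]} :=
  map_mpoly kap Tf + c 'X *: map_mpoly kap Th - Yu None * S.
have thc k : theta (kap k) = serC k by rewrite /= cE [LHS]ser_of_polyC.
have jetY a : jet_of N2 (cc a) (map_mpoly theta (Yu a)).
  by move=> m mN; rewrite mcoeff_map_mpoly /= (coefYu _ _ mN) thU.
have jetf (g : B) : jet_of N2 (serC g) (map_mpoly theta (map_mpoly kap (fps_trunc N2 g))).
  move=> m mN; rewrite !mcoeff_map_mpoly /= fps_truncE // -[LHS]/(theta (kap _)) thc.
  by apply/serP => j /=; case: eqP.
have thW m : (mdeg m < N2)%N -> theta W@_m = 0.
  move=> mN; rewrite -mcoeff_map_mpoly rmorphB rmorphD rmorphM /=.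
  have mX : map_mpoly theta (c 'X)%:MP = serX%:MP_[n].
    by rewrite map_mpolyC; congr (_%:MP); rewrite [LHS]cE; exact: ser_of_polyX.
  rewrite -mul_mpolyC rmorphM /= mX mul_mpolyC.
  rewrite mcoeffB.
  have jF := jet_ofD (jetf f) (jet_ofX (jetf h)).
  rewrite (jF m mN) FE.
  have jS : jet_of N2 (pi f) (map_mpoly theta S).
    pose Sf : ser B := mmap (pi \o in_alg B) (pi \o xv (n := n)) Tf.
    apply: (@jet_of_eq _ _ _ _ _ Sf).
      move=> j; have -> : Sf = pi (cps_of_mpoly v Tf) by rewrite /Sf -rmorph_mmap.
      rewrite -serN -serD -rmorphB; apply: flow_ordge => // k kN.
      by rewrite cps_fpsB fcoefB coef_cps_of_mpoly fps_truncE // subrr.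
    rewrite /S rmorph_mmap; apply: jet_of_mmap => [s|l]; last exact: (jetY (Some l)).
    have -> : (map_mpoly theta \o (@mpolyC n P \o kap)) s = (serC s)%:MP.
      by rewrite /= map_mpolyC; congr (_%:MP); exact: thc.
    by rewrite -[(pi \o _) s]/(pi s%:A) piC; exact: jet_ofC.
  rewrite (jet_ofM (jetY None) jS mN); exact: subrr.
have mN0 : (mdeg (0%MM : 'X_{1..n}) < N2)%N by rewrite mdeg0.
have mN1 (l : 'I_n) : (mdeg U_(l)%MM < N2)%N by rewrite mdeg1.
pose D : 'M[P]_n := \matrix_(i, l) U (Some i, BMultinom (mN1 l)).
(* Jacobian determinant times the constant term of E. It equals 1 at s = 0, so it is not killed by
   [theta], and specialization can keep it nonzero. *)
pose b := \det D * U (None, BMultinom mN0).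
have thD : sc0 (theta (\det D)) = 1.
  rewrite -!det_map_mx -[RHS](det1 _ n); congr (\det _).
  apply/matrixP => i l; rewrite !mxE thU /sc0 /= pi0 cps_fpsX fcoefX.
  by rewrite eq_mnm1 eq_sym.
have thb : theta b <> 0.
  move=> tb; have : sc0 (theta b) = 1.
    by rewrite !rmorphM /= thD thU mul1r /sc0 /= E0 cps_fps1 fcoef1 eqxx.
  by rewrite tb => /esym/eqP; rewrite oner_eq0.
have [a a0 aP] := sp b thb; exists a => // t /aP[psi [psic psib psik]].
have psikap : psi \o kap =1 id by move=> k; rewrite /= psic hornerC.
pose y l : {mpoly K[n]} := map_mpoly psi (Yu (Some l)).
pose Ek : {mpoly K[n]} := map_mpoly psi (Yu None).
have coefpsi a' (m : 'X_{1..n}) (mN : (mdeg m < N2)%N) :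
    (map_mpoly psi (Yu a'))@_m = psi (U (a', BMultinom mN)).
  by rewrite mcoeff_map_mpoly /= (coefYu _ _ mN).
have psiE a' m : (mdeg m < N2)%N -> coef_ser m (cc a') = 0 -> (map_mpoly psi (Yu a'))@_m = 0.
  by move=> mN z; rewrite (coefpsi _ _ mN); apply: psik; rewrite thU.
have y1 l : ordge 1 (cps_of_mpoly v (y l)).
  apply/ordge1P; rewrite coef_cps_of_mpoly; apply: psiE => //.
  by apply/serP => j; exact: pi1.
pose Y := LocFam y1; pose phi : {lrmorphism B -> B} := cps_subst Y.
pose u := cps_of_mpoly v Ek.
move: psib; rewrite rmorphM mulf_eq0 negb_or => /andP[psiD psiU].
exists phi, u; split.
- apply: subst_local_aut; rewrite unitmxE unitfE.
  suff -> : jac Y = map_mx psi D by rewrite det_map_mx.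
  apply/matrixP => i l; rewrite !mxE /ev0 cps_fps_deriv fcoef_deriv add0m mnm0E mulr1n.
  by rewrite coef_cps_of_mpoly (coefpsi _ _ (mN1 l)).
- by apply: cps_unitP; rewrite /ev0 coef_cps_of_mpoly (coefpsi _ _ mN0).
- move=> /eE E1; apply: cpsP => m; rewrite coef_cps_of_mpoly cps_fps1 fcoef1.
  have [mN|mN] := ltnP (mdeg m) N2; last first.
    rewrite (_ : (m == 0%MM) = false); last first.
      by apply/negbTE; apply: contraTneq mN => ->; rewrite mdeg0.
    rewrite mcoeff_map_mpoly /Yu raddf_sum big1 ?raddf0 //=.
    move=> k _; rewrite mcoeffZ mcoeffX; case: eqP => km; rewrite ?mulr0 //.
    by move: (bmdeg k); rewrite km ltnNge mN.
  rewrite (coefpsi _ _ mN); apply/eqP; rewrite -subr_eq0 -(rmorph_nat psi) -rmorphB.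
  apply/eqP/psik; rewrite rmorphB thU rmorph_nat /wv /= E1.
  by rewrite -(@jet_of1 _ _ v n N2 m mN) mcoeff1 subrr.
- have phif : ordge N2 (phi f - cps_of_mpoly v (map_mpoly psi S)).
    have -> : cps_of_mpoly v (map_mpoly psi S) = phi (cps_of_mpoly v Tf).
      rewrite /S [map_mpoly psi _]rmorph_mmap [LHS](rmorph_mmap (@cps_of_mpoly _ _ v n)).
      rewrite [RHS]rmorph_mmap.
      apply: eq_mmap => [k|l].
        have kE : map_mpoly psi (@mpolyC n P (kap k)) = k%:MP_[n].
          by rewrite map_mpolyC; congr (_%:MP); exact: psikap.
        rewrite -[LHS]/(cps_of_mpoly v (map_mpoly psi (@mpolyC n P (kap k)))) kE.
        by rewrite /cps_of_mpoly mmapC -[RHS]/(phi k%:A) rmorph_alg.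
      by rewrite [RHS](cps_substX Y).
    rewrite -raddfB; apply: ordge_hom; first exact: cps_subst_loc.
    by move=> k kN; rewrite cps_fpsB fcoefB coef_cps_of_mpoly fps_truncE // subrr.
  have : ordge N2 (u * phi f - u * cps_of_mpoly v (map_mpoly psi S)).
    by rewrite -mulrBr; exact: ordgeMl.
  move=> /ordge_sym; apply: ordge_trans => m mN; rewrite /u -rmorphM fcoefB coef_cps_of_mpoly.
  have := psik _ (thW m mN); rewrite -mcoeff_map_mpoly rmorphB rmorphD rmorphM /=.
  have mX : map_mpoly psi (c 'X)%:MP = t%:MP_[n].
    by rewrite map_mpolyC; congr (_%:MP); rewrite [LHS]psic hornerX.
  rewrite -mul_mpolyC rmorphM /= mX mul_mpolyC mcoeffB mcoeffD mcoeffZ.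
  rewrite !mcoeff_map_mpoly /= -![psi (c _)]/((psi \o kap) _) !psikap !fps_truncE //.
Qed.

End Specialize.

(** * Proof of the theorem *)

Section Regular.
Variables (R : realType) (K : fieldType) (v : absval R K) (n : nat).
Local Notation B := (cps v n).
Local Notation xv := (cps_var v).
Implicit Types (f g : B).

(** Taking f as the new i-th coordinate changes the identity Jacobian only in row i, which becomes
    the gradient of f with nonzero i-th entry. *)
Lemma coordinate_equiv f i : ordge 1 f -> ev0 (cps_deriv i f) != 0 ->
  rcequiv false f (xv i).
Proof.
move=> f1 fi; pose y j := if j == i then f else xv j.
have y1 j : ordge 1 (y j) by rewrite /y; case: eqP => // _; exact: (ordge_cpsX v j).
exists (cps_subst (LocFam y1)), 1; split; rewrite ?unitr1 //; last first.
  by rewrite mul1r [RHS](cps_substX (LocFam y1)) /= /y eqxx.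
apply: subst_local_aut; rewrite -row_free_unit -kermx_eq0; apply/rowV0P => w.
move=> /sub_kermxP wJ.
have wE l : w 0 i * ev0 (cps_deriv l f) + (if l == i then 0 else w 0 l) = 0.
  have := congr1 (fun M : 'rV_n => M 0 l) wJ; rewrite !mxE (bigD1 i) //= => wJl.
  apply: etrans wJl; rewrite !mxE /= {1}/y eqxx; congr (_ + _).
  case: (eqVneq l i) => [->|li].
    rewrite big1 // => j ji; rewrite !mxE /= /y (negbTE ji) cps_derivX.
    by rewrite eq_sym (negbTE ji) rmorph0 mulr0.
  rewrite (bigD1 l) //= !mxE /= /y (negbTE li) cps_derivX eqxx rmorph1 mulr1.
  rewrite big1 ?addr0 // => j /andP[ji jl]; rewrite !mxE /= /y (negbTE ji) cps_derivX.
  by rewrite eq_sym (negbTE jl) rmorph0 mulr0.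
have wi : w 0 i = 0.
  by have /eqP := wE i; rewrite eqxx addr0 mulf_eq0 (negbTE fi) orbF => /eqP.
apply/rowP => l; rewrite mxE; have := wE l; rewrite wi mul0r add0r.
by case: eqP => // ->.
Qed.

Lemma coordinates_equiv (i l : 'I_n) : rcequiv false (xv i) (xv l).
Proof.
pose y j := xv (tperm i l j).
have y1 j : ordge 1 (y j) by exact: (ordge_cpsX v _).
exists (cps_subst (LocFam y1)), 1; split; rewrite ?unitr1 //; last first.
  by rewrite mul1r [RHS](cps_substX (LocFam y1)) /= /y tpermR.
apply: subst_local_aut; suff -> : jac (LocFam y1) = perm_mx (tperm i l) by exact: unitmx_perm.
apply/matrixP => j m; rewrite !mxE /= cps_derivX eq_sym.
by case: eqP => _; rewrite ?rmorph1 ?rmorph0.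
Qed.

Lemma regular_equiv f g : ordge 1 f -> ordge 1 g -> ~ ordge 2 f -> ~ ordge 2 g ->
  rcequiv false f g.
Proof.
have nz (h : B) : ordge 1 h -> ~ ordge 2 h -> exists i, ev0 (cps_deriv i h) != 0.
  move=> h1 h2; apply: contrapT => /forallNP nz; apply: h2; apply: ordge2P => // l.
  by apply/eqP/negbNE/negP.
move=> f1 g1 /(nz _ f1)[i fi] /(nz _ g1)[l gl].
apply: rcequiv_trans (coordinate_equiv f1 fi) _.
apply: rcequiv_trans (coordinates_equiv i l) _.
exact/rcequiv_sym/coordinate_equiv.
Qed.

Lemma tangent_order e k f z : ordge 2 f -> tangent e k f z ->
  ordge (if k is 0 then 1 else 2) z.
Proof.
move=> f2 [xi [xk ->]]; rewrite cps_fps_sum; apply: ordge_sum => -[i|] _ /=.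
  have fi : ordge 1 (cps_deriv i f) by exact: ordge_deriv.
  case: k xk => [|k] xk; first exact: ordgeMl.
  by apply: (@ordgeM _ _ 1 1) => //; apply: ordgeW (xk i).
apply: ordgeMl; case: (e); last exact: ordge_zero.
by apply: ordgeW f2; case: k {xk}.
Qed.

(** For k > 0 the difference g - f has order two. For k = 0 it need not by membership alone, but the
    derivatives of g lie in the tangent ideal of f, which consists of nonunits. *)
Lemma tangent_singular e k f g : ordge 1 g ->
  (forall z, tangent e k f z <-> tangent e k g z) -> tangent e k f (g - f) ->
  ordge 2 f -> ordge 2 g.
Proof.
move=> g1 fg fh f2; case: k fg fh => [|k] fg fh; last first.
  have := ordgeD f2 (tangent_order f2 fh).
  by rewrite -cps_fpsD addrC subrK.
apply: ordge2P => // l; apply/ev0P; apply: (tangent_order (k := 0) f2).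
by apply/fg; rewrite -[cps_deriv _ _]mul1r; exact: tangent_gen.
Qed.

End Regular.

Section Main.
Variables (R : realType) (K : closedFieldType) (v : absval R K) (n : nat).
Hypothesis char0 : [pchar K] =i pred0.
Local Notation B := (cps v n).
Local Notation xv := (cps_var v).
Implicit Types (f g z : B) (e : bool).

Lemma generic_member_equiv e k M f g : ordge 2 f -> ordge 2 g ->
  (forall z, ordge M z -> tangent e 0 f z) ->
  (forall z, tangent e k f z <-> tangent e k g z) -> tangent e k f (g - f) ->
  exists2 a : {poly K}, a != 0 & forall t, a.[t] != 0 ->
    rcequiv e (f + t *: (g - f)) f.
Proof.
move=> f2 g2 Mf fg fh.
have [pi [E [E0 eE FE [pi0 piC chain]]]] := family_flow char0 fg fh.
have h2 : ordge 2 (g - f) by exact: ordgeB.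
have nil l : exists r, tangent e 0 f (xv l ^+ r).
  exists M; apply: Mf; rewrite cps_fps_exp -[X in ordge X]muln1.
  by apply: ordgeX; exact: (ordge_cpsX v l).
have pi1 := flow_base f2 h2 nil E0 FE pi0 chain.
(* N = 2M gives agreement to order 2M+2, which covers the order 2M+1 demanded by [determinacy]. *)
have [a a0 aP] := family_specialize (M + M) E0 eE FE pi0 piC pi1.
exists a => // t /aP[phi [u [aphi uu eu]]]; set F := f + _ => FN.
have [psi [apsi phiK psiK]] := local_aut_inv aphi.
(* Pulling F back by the approximate equivalence turns it into f + h with h of high order, so
   [determinacy] applies to f itself. *)
pose h := psi (u^-1 * (F - u * phi f)).
have fE : f + h = psi (u^-1 * F).
  by rewrite /h mulrBr mulKr // raddfB /= phiK addrC subrK.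
have hN : ordge (M + M.+1) h.
  apply: ordge_hom; first exact: local_aut_loc.
  by apply: ordgeMl; apply: ordgeW FN; rewrite addnS.
apply: rcequiv_trans (determinacy f2 Mf hN).
by exists phi, u; split=> //; rewrite fE psiK mulVKr.
Qed.

Lemma equal_tangent_equiv e k M f g : ordge 1 f -> ordge 1 g ->
  (forall z, ordge M z -> tangent e 0 f z) ->
  (forall z, tangent e k f z <-> tangent e k g z) -> tangent e k f (g - f) ->
  rcequiv e f g.
Proof.
move=> f1 g1 Mf fg fh.
have gf z : tangent e k g z <-> tangent e k f z by apply: iff_sym.
have gh : tangent e k g (f - g).
  by apply/fg; rewrite -opprB; apply: (@memiN _ (tangent_ideal e k f)).
have [f2|f2] := pselect (ordge 2 f); last first.
  apply/rcequivW/regular_equiv => // g2; apply: f2; exact: tangent_singular gf gh g2.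
have g2 := tangent_singular g1 fg fh f2.
(* Only the tangent ideals of level k are known to coincide, so the bound for g passes through level
   k of f and grows by k. *)
have Mg z : ordge (M + k) z -> tangent e 0 g z.
  by move=> /(tangent_ordge Mf)/fg; exact: tangentW.
have [a a0 aP] := generic_member_equiv f2 g2 Mf fg fh.
have [b b0 bP] := generic_member_equiv g2 f2 Mg gf gh.
(* The line from g to f is the line from f to g run backwards, s to 1 - s; a common good value is a
   nonroot of a(s) b(1 - s). *)
pose r : {poly K} := 1 - 'X.
have br0 : b \Po r != 0.
  apply: contraNneq b0 => br; rewrite -[b]comp_polyXr.
  have -> : 'X = r \Po r :> {poly K} by rewrite /r comp_polyB comp_polyX comp_polyC opprB addrC subrK.
  by rewrite comp_polyA br comp_poly0.
have /closed_nonrootP[t] : a * (b \Po r) != 0 by rewrite mulf_neq0.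
rewrite rootE hornerM mulf_eq0 negb_or horner_comp => /andP[/aP at_ /bP].
rewrite hornerD hornerN hornerC hornerX => bt.
apply: rcequiv_trans (rcequiv_sym at_) _; apply: rcequiv_trans bt.
suff -> : g + (1 - t) *: (f - g) = f + t *: (g - f).
  by exists idfun, 1; split=> //; [apply: bij_local_aut; [exists idfun|move=> i; exact: (ordge_cpsX v i)]|rewrite unitr1|rewrite mul1r].
rewrite scalerBl scale1r addrA (_ : g + (f - g) = f); last by rewrite addrC subrK.
by rewrite -(opprB g f) scalerN opprK.
Qed.

Lemma aut_tangent_equiv e k M f g (Phi : {lrmorphism B -> B}) :
  is_local_aut Phi -> ordge 1 f -> ordge 1 g ->
  (forall z, ordge M z -> tangent e 0 f z) ->
  (forall z, tangent e k g (Phi z) <-> tangent e k f z) ->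
  tangent e k g (Phi f - g) -> rcequiv e f g.
Proof.
move=> aPhi f1 g1 Mf fg fh; have [Psi [aPsi PhiK PsiK]] := local_aut_inv aPhi.
have aT k' z : tangent e k' (Phi f) (Phi z) <-> tangent e k' f z.
  split; last exact: tangent_aut.
  by move/(tangent_aut aPsi); rewrite !PhiK.
apply: (@rcequiv_trans _ _ _ _ _ _ (Phi f)).
  apply/rcequiv_sym/rcequivW; exists Phi, 1; split=> //; [exact: unitr1|by rewrite mul1r].
have Tg z : tangent e k (Phi f) z <-> tangent e k g z.
  by rewrite -(PsiK z); apply: iff_trans (aT _ _) _; apply: iff_sym.
apply: (@equal_tangent_equiv e k M) => //.
- by apply: ordge_hom => //; exact: local_aut_loc.
- move=> z zM; rewrite -(PsiK z); apply/aT/Mf.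
  by apply: ordge_hom => //; exact: local_aut_loc.
- by apply/Tg; rewrite -opprB; apply: (@memiN _ (tangent_ideal e k g)).
Qed.

Lemma tangent_nilpotent e k M f : (forall z, ordge M z -> tangent e 0 f z) ->
  forall i, exists r, tangent e k f (xv i ^+ r).
Proof.
move=> Mf i; exists (M + k)%N; apply: (tangent_ordge Mf).
by rewrite cps_fps_exp -[X in ordge X]muln1; apply: ordgeX; exact: (ordge_cpsX v i).
Qed.

(** The lift carries the Tjurina ideal of f onto that of g, so both [Phi f] and g lie in the latter,
    and so does their difference. *)
Lemma tjurina_iso_equiv k f g : ordge 1 f -> ordge 1 g -> tjurina_finite f ->
  tjurina_iso k f g -> rcequiv true f g.
Proof.
move=> f1 g1 /finite_dim_nilpotent/ideal_ordge[M MI] [phi [phiZ phi_bij]].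
have Mf z : ordge M z -> tangent true 0 f z by move=> /MI/tjurina_ideal0P.
have [i|Phi [aPhi PhiI _]] := lift_iso phiZ phi_bij.
  by have [r Ir] := tangent_nilpotent k Mf i; exists r; apply/tjurina_idealP.
have T z : tangent true k g (Phi z) <-> tangent true k f z.
  apply: iff_trans (iff_sym (tjurina_idealP _ _ _)) _.
  by apply: iff_trans (PhiI z) _; exact: tjurina_idealP.
apply: (aut_tangent_equiv aPhi f1 g1 Mf T).
apply: (@memiB _ (tangent_ideal true k g)); last exact: tangent_fun.
by apply/T; exact: tangent_fun.
Qed.

(** Here f need not lie in its own tangent ideal; compatibility with the action of t is what puts
    [Phi f - g] into m^k j(g). *)
Lemma milnor_iso_equiv k f g : ordge 1 f -> ordge 1 g -> milnor_finite f ->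
  milnor_iso k f g -> rcequiv false f g.
Proof.
move=> f1 g1 /finite_dim_nilpotent/ideal_ordge[M MI] [phi [phiZ phi_bij phif]].
have Mf z : ordge M z -> tangent false 0 f z by move=> /MI/jacobian_idealP.
have [i|Phi [aPhi PhiI PhiE]] := lift_iso phiZ phi_bij.
  by have [r Ir] := tangent_nilpotent k Mf i; exists r; apply/milnor_idealP.
have T z : tangent false k g (Phi z) <-> tangent false k f z.
  apply: iff_trans (iff_sym (milnor_idealP _ _ _)) _.
  by apply: iff_trans (PhiI z) _; exact: milnor_idealP.
apply: (aut_tangent_equiv aPhi f1 g1 Mf T).
by apply/milnor_idealP/qclassP; rewrite -PhiE.
Qed.

Lemma equiv_tjurina_iso k f g : rcequiv true f g -> tjurina_iso k f g.
Proof.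
move=> /rcequiv_sym/(rcequiv_tangent k)[psi [u [[bpsi _] _ _ T]]].
have [|Psi [PsiZ bPsi _]] := @quot_iso _ _ v n (tjurina_ideal k f) (tjurina_ideal k g) psi bpsi.
  move=> z; apply: iff_trans (tjurina_idealP _ _ _) _.
  by apply: iff_trans (T z) _; apply: iff_sym; exact: tjurina_idealP.
by exists Psi.
Qed.

Lemma equiv_milnor_iso k f g : rcequiv false f g -> milnor_iso k f g.
Proof.
move=> /rcequiv_sym/(rcequiv_tangent k)[psi [u [[bpsi _] /(_ isT) u1 gE T]]].
have [|Psi [PsiZ bPsi PsiE]] := @quot_iso _ _ v n (milnor_ideal k f) (milnor_ideal k g) psi bpsi.
  move=> z; apply: iff_trans (milnor_idealP _ _ _) _.
  by apply: iff_trans (T z) _; apply: iff_sym; exact: milnor_idealP.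
have psif : psi f = g by rewrite [RHS]gE u1 mul1r.
by exists Psi; split=> //; rewrite PsiE psif.
Qed.

End Main.

Unset Implicit Arguments.

Theorem proposition1p17 (R : realType) (K : closedFieldType) (v : absval R K)
    (n : nat) (f g : cps v n) :
  [pchar K] =i pred0 ->
  max_ideal v n f -> max_ideal v n g ->
  (tjurina_finite f ->
     (contact_equivalent f g <-> (forall k : nat, tjurina_iso k f g)) /\
     ((forall k : nat, tjurina_iso k f g) <->
        (exists k : nat, tjurina_iso k f g)))
  /\
  (milnor_finite f ->
     (right_equivalent f g <-> (forall k : nat, milnor_iso k f g)) /\
     ((forall k : nat, milnor_iso k f g) <->
        (exists k : nat, milnor_iso k f g))).
Proof.
move=> char0 /max_idealP f1 /max_idealP g1; split=> fin.
  have isoE k := @tjurina_iso_equiv _ _ _ _ char0 k f g f1 g1 fin.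
  have eqI H k := @equiv_tjurina_iso _ _ _ _ k f g H.
  split; split.
  - by move=> /contact_equivP H k; exact: eqI.
  - by move=> iso; apply/contact_equivP/(isoE 0%N).
  - by move=> iso; exists 0%N.
  - by move=> [k /isoE H] l; exact: eqI.
have isoE k := @milnor_iso_equiv _ _ _ _ char0 k f g f1 g1 fin.
have eqI H k := @equiv_milnor_iso _ _ _ _ k f g H.
split; split.
- by move=> /right_equivP H k; exact: eqI.
- by move=> iso; apply/right_equivP/(isoE 0%N).
- by move=> iso; exists 0%N.
- by move=> [k /isoE H] l; exact: eqI.
Qed.
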